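(* Assume that $f:\mathbb{R}^n\to\mathbb{R}$ is $\mu$-strongly convex ($\mu>0$) and $\|\nabla f(x^* )\|_2=M_f$. Let $\varepsilon>0$ be a desired accuracy. Assume that $f$ is $L_f$-Lipschitz continuous on the ball $B_{R_f}(0)$ with $$R_f=\widetilde{\Omega}\left(\max\left\{\frac{R_y}{A_N\sqrt{\lambda_{\max}(A^\top A)}},\ \frac{\sqrt{\lambda_{\max}(A^\top A)}\,R_y}{\mu},\ R_x\right\}\right),$$ where $R_y$ is such that $\|y^*\|_2\le R_y$, $y^*$ is the solution of the dual problem, and $R_x=\|x(A^\top y^* )\|_2$. Assume that at iteration $k$ of SPDSTM the batch size satisfies $$r_k\ge\max\left\{1,\frac{\sigma_\psi^2\,\widetilde\alpha_k\ln(N/\beta)}{\hat C\varepsilon}\right\},\qquad \widetilde\alpha_k=\frac{k+1}{2\tilde L},$$ and that $0<\varepsilon\le \frac{H\tilde L R_0^2}{N^2}$, $0\le\delta\le\frac{G\tilde L R_0}{(N+1)^2}$ and $N\ge 1$ for some numeric constants $H>0$, $G>0$, $\hat C>0$. Let $\beta\in(0,1/4)$ be such that $\frac{1+\sqrt{\ln(1/\beta)}}{\sqrt{\ln(N/\beta)}}\le 2$. Then after $$N=\widetilde O\left(\sqrt{\frac{M_f^2}{\mu\varepsilon}\chi(A^\top A)}\right)$$ iterations, with probability at least $1-4\beta$, the outputs $\tilde x^N$ and $y^N$ of SPDSTM satisfy $$f(\tilde x^N)-f(x^* )\le f(\tilde x^N)+\psi(y^N)\le\varepsilon,\qquad \|A\tilde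 x^N\|_2\le\frac{\varepsilon}{R_y}.$$ Moreover, to guarantee this with probability at least $1-4\beta$, SPDSTM requires $$\widetilde O\left(\max\left\{\frac{\sigma_x^2M_f^2}{\varepsilon^2}\chi(A^\top A)\ln\left(\frac1\beta\sqrt{\frac{M_f^2}{\mu\varepsilon}\chi(A^\top A)}\right),\ \sqrt{\frac{M_f^2}{\mu\varepsilon}\chi(A^\top A)}\right\}\right)$$ calls of the biased stochastic oracle $\tilde\nabla\psi(y,\xi)$, i.e. of $\tilde x(y,\xi)$.
   Context: Problem. The primal problem is $\min\{f(x): x\in\mathbb{R}^n,\ Ax=0\}$ with $A\in\mathbb{R}^{n\times n}$ (not necessarily symmetric), $\mathrm{Ker}A\ne\{0\}$; $x^*$ is its solution. Define $\varphi(y)=\max_{x\in\mathbb{R}^n}\{\langle y,x\rangle-f(x)\}$, $x(y)=\mathrm{argmax}_{x}\{\langle y,x\rangle-f(x)\}$, $\psi(y)=\varphi(A^\top y)$. The dual problem is $\min_y\psi(y)$, and $y^*$ is its solution of smallest Euclidean norm. One has $\nabla\varphi(y)=x(y)$, $\nabla\psi(y)=Ax(A^\top y)$, and $\psi$ is $L_\psi$-smooth with $L_\psi=\lambda_{\max}(A^\top A)/\mu$. Also $\lambda_{\max}$, $\lambda_{\min}^+$ are the maximal and the minimal positive eigenvalues, $\chi(A^\top A)=\lambda_{\max}(A^\top A)/\lambda_{\min}^+(A^\top A)$, and $B_r(y)$ is the closed Euclidean ball of radius $r$ centered at $y$. $R_0=\|y^*-y^0\|_2$ with starting point $y^0=0$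 (the paper uses $R_0=R_y$). Stochastic oracle. $\varphi(y)=\mathbb{E}_\xi[\varphi(y,\xi)]$ with $\varphi(\cdot,\xi)$ differentiable almost surely, $\varphi(y,\xi)=\max_x\{\langle y,x\rangle-f(x,\xi)\}$ and $x(y,\xi)=\mathrm{argmax}_x\{\langle y,x\rangle-f(x,\xi)\}=\nabla\varphi(y,\xi)$, so $x(y)=\mathbb{E}_\xi[x(y,\xi)]$. Only noisy observations $\tilde x(y,\xi)=x(y,\xi)+\delta(y,\xi)$ are available, where for all $y$: $\|\mathbb{E}_\xi[\delta(y,\xi)]\|_2\le\delta_y$ (a constant $\delta_y\ge0$) and $\mathbb{E}_\xi\left[\exp\left(\|\tilde x(y,\xi)-\mathbb{E}_\xi[\tilde x(y,\xi)]\|_2^2/\sigma_x^2\right)\right]\le\exp(1)$. The biased stochastic gradient is $\tilde\nabla\psi(y,\xi)=A\tilde x(A^\top y,\xi)$; set $\delta=\sqrt{\lambda_{\max}(A^\top A)}\,\delta_y$ and $\sigma_\psi=\sqrt{\lambda_{\max}(A^\top A)}\,\sigma_x$. For a batch $\boldsymbol\xi^k$ of $r_k$ i.i.d. samples $\xi^1,\dots,\xi^{r_k}$, $\tilde\nabla\Psi(y,\boldsymbol\xi^k)=\frac1{r_k}\sum_{l=1}^{r_k}\tilde\nabla\psi(y,\xi^l)$ and $\tilde x(A^\top y,\boldsymbol\xi^k)=\frac1{r_k}\sum_{l=1}^{r_k}\tilde x(A^\top y,\xi^l)$; batches are independent. Algorithm SPDSTM. $\tilde y^0=z^0=y^0=0$,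 $\alpha_0=A_0=0$, $\tilde L=2L_\psi$. For $k=0,1,\dots,N-1$: choose $\alpha_{k+1}>0$ with $2\tilde L\alpha_{k+1}^2=A_k+\alpha_{k+1}$ and put $A_{k+1}=A_k+\alpha_{k+1}$; $\tilde y^{k+1}=(A_ky^k+\alpha_{k+1}z^k)/A_{k+1}$; $z^{k+1}=z^k-\alpha_{k+1}\tilde\nabla\Psi(\tilde y^{k+1},\boldsymbol\xi^{k+1})$; $y^{k+1}=(A_ky^k+\alpha_{k+1}z^{k+1})/A_{k+1}$. Output $y^N$ and $\tilde x^N=\frac1{A_N}\sum_{k=0}^N\alpha_k\tilde x(A^\top\tilde y^k,\boldsymbol\xi^k)$. Notation: $\widetilde O,\widetilde\Omega$ are $O,\Omega$ that may additionally hide polylogarithmic factors of the parameters of the method or the problem.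
   Formalization: The constants are not purely numeric: H and the iteration constant may depend on an upper bound for R_y/R_0, and G, Ĉ and the oracle-call constant also on an upper bound for L_f/(sqrt(λ_max(A^T A)) R_y); with purely numeric constants the claim fails. *)

(* Defs.v *)
From mathcomp Require Import all_boot all_order all_algebra.
From mathcomp Require Import all_classical all_reals all_analysis.

Set Implicit Arguments.
Unset Strict Implicit.
Unset Printing Implicit Defensive.

Import Order.TTheory GRing.Theory Num.Theory.
Import numFieldNormedType.Exports.

Local Open Scope classical_set_scope.
Local Open Scope ring_scope.

(* The library norm on matrices is the sup norm, so the Euclidean inner product
   and norm on column vectors are introduced here; the topologies agree, hence
   so do [differentiable] and Borel measurability. *)
Definition dot (R : realType) (n : nat) (u v : 'cV[R]_n) : R :=
  \sum_(i < n) u i 0 * v i 0.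

Definition enorm (R : realType) (n : nat) (u : 'cV[R]_n) : R :=
  Num.sqrt (\sum_(i < n) u i 0 ^+ 2).

Definition is_gradient (R : realType) (n : nat) (f : 'cV[R]_n -> R)
    (x g : 'cV[R]_n) : Prop :=
  differentiable f x /\ forall h, 'd f x h = dot g h.

Definition strongly_convex (R : realType) (n : nat) (mu : R)
    (f : 'cV[R]_n -> R) : Prop :=
  forall (x y : 'cV[R]_n) (t : R), 0 <= t <= 1 ->
    f (t *: x + (1 - t) *: y) <=
      t * f x + (1 - t) * f y - mu / 2 * t * (1 - t) * enorm (x - y) ^+ 2.

Definition lipschitz_on_ball (R : realType) (n : nat) (L r : R)
    (f : 'cV[R]_n -> R) : Prop :=
  forall x y, enorm x <= r -> enorm y <= r -> `|f x - f y| <= L * enorm (x - y).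

Definition is_lambda_max (R : realType) (n : nat) (S : 'M[R]_n) (a : R) : Prop :=
  eigenvalue S a /\ forall b, eigenvalue S b -> b <= a.

Definition is_lambda_min_pos (R : realType) (n : nat) (S : 'M[R]_n) (a : R) :
    Prop :=
  [/\ eigenvalue S a, 0 < a & forall b, eigenvalue S b -> 0 < b -> a <= b].

Definition phi (R : realType) (n : nat) (f : 'cV[R]_n -> R) (y : 'cV[R]_n) : R :=
  sup (range (fun x => dot y x - f x)).

Definition is_dual_argmax (R : realType) (n : nat) (f : 'cV[R]_n -> R)
    (y x : 'cV[R]_n) : Prop :=
  forall z, dot y z - f z <= dot y x - f x.

(* x(y); the value is 0 when the maximum is not attained. *)
Definition dual_argmax (R : realType) (n : nat) (f : 'cV[R]_n -> R)
    (y : 'cV[R]_n) : 'cV[R]_n :=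
  xget 0 [set x | is_dual_argmax f y x].

Definition psi (R : realType) (n : nat) (A : 'M[R]_n) (f : 'cV[R]_n -> R)
    (y : 'cV[R]_n) : R :=
  phi f (A^T *m y).

Definition is_primal_solution (R : realType) (n : nat) (A : 'M[R]_n)
    (f : 'cV[R]_n -> R) (xs : 'cV[R]_n) : Prop :=
  A *m xs = 0 /\ forall x, A *m x = 0 -> f xs <= f x.

Definition is_dual_solution (R : realType) (n : nat) (A : 'M[R]_n)
    (f : 'cV[R]_n -> R) (y : 'cV[R]_n) : Prop :=
  forall z, psi A f y <= psi A f z.

Definition is_min_norm_dual_solution (R : realType) (n : nat) (A : 'M[R]_n)
    (f : 'cV[R]_n -> R) (ys : 'cV[R]_n) : Prop :=
  is_dual_solution A f ys /\
  forall y, is_dual_solution A f y -> enorm ys <= enorm y.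

Definition vec_expectation (R : realType) (n : nat) (d : measure_display)
    (T : measurableType d) (D : probability T R) (X : T -> 'cV[R]_n) :
    'cV[R]_n :=
  \col_i fine ('E_D[fun t => X t i 0%R])%E.

Definition borel_cV (R : realType) (n : nat) :=
  g_sigma_algebraType (@open 'cV[R]_n).

Definition exact_x (R : realType) (n : nat) (Xi : Type)
    (F : Xi -> 'cV[R]_n -> R) (y : 'cV[R]_n) (xi : Xi) : 'cV[R]_n :=
  dual_argmax (F xi) y.

Definition noisy_x (R : realType) (n : nat) (Xi : Type)
    (F : Xi -> 'cV[R]_n -> R) (err : 'cV[R]_n -> Xi -> 'cV[R]_n)
    (y : 'cV[R]_n) (xi : Xi) : 'cV[R]_n :=
  exact_x F y xi + err y xi.

(* [F xi x] is f(x,xi), [err y xi] is delta(y,xi) and [D] is the law of xi.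
   The joint measurability [so_meas] is what gives a meaning to querying the
   oracle at the random points produced by the algorithm. *)
Record stochastic_dual_oracle (R : realType) (n : nat) (d : measure_display)
    (Xi : measurableType d) (D : probability Xi R) (f : 'cV[R]_n -> R)
    (F : Xi -> 'cV[R]_n -> R) (err : 'cV[R]_n -> Xi -> 'cV[R]_n)
    (delta_y sigma_x : R) : Prop := {
  so_phi_int : forall y, D.-integrable setT (fun xi => (phi (F xi) y)%:E);
  so_phi : forall y, ('E_D[fun xi => phi (F xi) y])%E = (phi f y)%:E;
  so_grad : {ae D, forall xi, forall y,
    is_dual_argmax (F xi) y (exact_x F y xi) /\
    is_gradient (phi (F xi)) y (exact_x F y xi)};
  so_x_int : forall y (i : 'I_n),
    D.-integrable setT (fun xi => (exact_x F y xi i 0)%:E);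
  so_x : forall y, vec_expectation D (exact_x F y) = dual_argmax f y;
  so_err_int : forall y (i : 'I_n),
    D.-integrable setT (fun xi => (err y xi i 0)%:E);
  so_meas : forall i : 'I_n,
    measurable_fun setT
      (fun p : borel_cV R n * Xi => noisy_x F err p.1 p.2 i 0);
  so_bias : forall y, enorm (vec_expectation D (err y)) <= delta_y;
  so_light_tail : forall y,
    (\int[D]_xi (expR (enorm (noisy_x F err y xi -
        vec_expectation D (noisy_x F err y)) ^+ 2 / sigma_x ^+ 2))%:E
     <= (expR 1)%:E)%E
}.

(* The samples xi k l with (k, l) in [used] are mutually independent with common
   law D.  The product rule is written with D on the right, so that one-element
   lists J give the law and the others the independence. *)
Definition iid_samples (R : realType) (d d' : measure_display)
    (Omega : measurableType d') (P : probability Omega R)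
    (Xi : measurableType d) (D : probability Xi R)
    (used : pred (nat * nat)) (xi : nat -> nat -> Omega -> Xi) : Prop :=
  (forall j : nat * nat, used j -> measurable_fun setT (xi j.1 j.2)) /\
  (forall (J : seq (nat * nat)) (B : nat * nat -> set Xi),
    uniq J -> all used J -> (forall j, measurable (B j)) ->
    P [set w | forall j, j \in J -> B j (xi j.1 j.2 w)] =
      (\prod_(j <- J) D (B j))%E).

(* Coefficients alpha_k and A_k. *)
Definition spdstm_coefs (R : realType) (Lt : R) (alpha Acc : nat -> R) : Prop :=
  [/\ alpha 0%N = 0, Acc 0%N = 0 &
    forall k, [/\ 0 < alpha k.+1,
                  2 * Lt * alpha k.+1 ^+ 2 = Acc k + alpha k.+1 &
                  Acc k.+1 = Acc k + alpha k.+1]].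

Section SPDSTM.
Variables (R : realType) (n : nat) (Xi : Type) (A : 'M[R]_n).
Variables (xt : 'cV[R]_n -> Xi -> 'cV[R]_n) (alpha Acc : nat -> R).
Variables (r : nat -> nat) (s : nat -> nat -> Xi).

Definition batch_x (k : nat) (y : 'cV[R]_n) : 'cV[R]_n :=
  (r k)%:R^-1 *: \sum_(l < r k) xt (A^T *m y) (s k l).

Definition batch_grad (k : nat) (y : 'cV[R]_n) : 'cV[R]_n :=
  (r k)%:R^-1 *: \sum_(l < r k) A *m xt (A^T *m y) (s k l).

(* The triple (ytilde^k, z^k, y^k). *)
Fixpoint spdstm (k : nat) : 'cV[R]_n * 'cV[R]_n * 'cV[R]_n :=
  if k is j.+1 then
    let: (_, z, y) := spdstm j in
    let yt' := (Acc j.+1)^-1 *: (Acc j *: y + alpha j.+1 *: z) in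
    let z' := z - alpha j.+1 *: batch_grad j.+1 yt' in
    let y' := (Acc j.+1)^-1 *: (Acc j *: y + alpha j.+1 *: z') in
    (yt', z', y')
  else (0, 0, 0).

Definition spdstm_y (N : nat) : 'cV[R]_n := (spdstm N).2.

Definition spdstm_x (N : nat) : 'cV[R]_n :=
  (Acc N)^-1 *: \sum_(k < N.+1) alpha k *: batch_x k (spdstm k).1.1.

End SPDSTM.

(* Lower bound imposed on the size r_k of the batch xi^k, 1 <= k <= N. *)
Definition batch_bound (R : realType) (Lt sigma_psi Chat eps beta : R)
    (N k : nat) : R :=
  Num.max 1 (sigma_psi ^+ 2 * (k.+1%:R / (2 * Lt)) * ln (N%:R / beta)
             / (Chat * eps)).

Definition min_batch (R : realType) (Lt sigma_psi Chat eps beta : R)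
    (N k : nat) : nat :=
  `|Num.ceil (batch_bound Lt sigma_psi Chat eps beta N k)|%N.

Definition oracle_calls (r : nat -> nat) (N : nat) : nat :=
  (\sum_(1 <= k < N.+1) r k)%N.

(* The factor hidden by a soft-O in the positive parameters ps. *)
Definition polylog (R : realType) (ps : seq R) (p : nat) : R :=
  (1 + \sum_(x <- ps) `|ln x|) ^+ p.

(* A logarithm inside an O-bound, kept away from 0: it is ln t once t >= e. *)
Definition soft_ln {R : realType} (t : R) : R := Num.max 1 (ln t).

(* Main.v *)
From HB Require Import structures.
Require Import Defs.
From mathcomp Require Import all_boot all_order all_algebra.
From mathcomp Require Import all_classical all_reals all_analysis.
From mathcomp Require Import measurable_realfun ring lra.
Import Order.TTheory GRing.Theory Num.Theory.
Import numFieldNormedType.Exports.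
Local Open Scope classical_set_scope.
Local Open Scope ring_scope.

(** Why the theorem holds.

    The method is accelerated gradient descent (similar triangles) for the dual
    function [psi], run with the gradients [A *m x_k + A *m nu_k], where [x_k] is the
    exact maximizer [dual_argmax f (A^T *m yt_k)] and [nu_k] the error of its batch
    average. One step ([similar_triangles_step]), summed over the iterations
    ([estimating_sequence]), bounds [Acc m * psi (y m) + |z m - u|^2 / 2] for every
    vector [u] by linearizations of [psi] plus error terms. With [u = ys] this
    controls the distance of [z m] to the dual solution by a sum of error terms, the
    distance budget ([distance_le_budget]). With [u] opposite to the constraint
    violation, and because the linearization of [psi] at [yt_k] has the constant term
    [- f x_k], it bounds the duality gap plus [2 * Ry] times the violation
    ([duality_gap_bound]); weak duality then separates the two
    ([accuracy_of_small_errors]). So it suffices that the distance budgets stay below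
    [4 * |ys|^2] and that the weighted sum of the noise in the [x_k] stays small.

    Both quantities are nonnegative processes of the following kind. When the samples
    are revealed one at a time, the process increases by a linear form in the next
    centred noise vector, whose squared slope is at most a multiple of the process
    itself, plus a multiple of the squared norm of that vector. A sample is
    independent of the past ([sample_integral]) and its noise is sub-Gaussian
    ([quadratic_exp_moment]), so that one sample changes the expectation of
    [expR (lam * process)] as if [lam] had grown slightly. The batch sizes are such
    that over the whole run [lam] grows by a factor [2] at most
    ([process_exp_moment]). Markov's inequality with [lam] of order
    [ln (N / beta) / |ys|^2] makes the probability that a process exceeds its
    threshold at most [beta / N], and a union bound over the iterations ends the
    argument ([high_probability_accuracy]).

    For the complexity, let [N0] be the largest number of iterations with
    [eps <= H * Lt * |ys|^2 / N0 ^+ 2]. If [N0 <= N] and [N] satisfies this condition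
    too, then [eps] is also at least a quarter of the right-hand side, and a large
    [H] makes the error [|ys|^2 / Acc N] of the method smaller than [eps]. The dual
    solution of least norm is orthogonal to the kernel of [A^T], whence
    [lmin * |ys|^2 <= M_f ^+ 2] ([dual_solution_norm]), and this bounds [N0]. The
    batch sizes grow linearly and add up to a multiple of [N0 ^+ 2]
    ([oracle_calls_softO]). *)

(** * Euclidean geometry and extremal eigenvalues *)

Section Euclidean.
Context {R : realType} {n : nat}.
Implicit Types (u v w : 'cV[R]_n) (a : R).

Lemma dotC u v : dot u v = dot v u.
Proof. by apply: eq_bigr => i _; rewrite mulrC. Qed.

Lemma dotDl u v w : dot (u + v) w = dot u w + dot v w.
Proof. by rewrite -big_split; apply: eq_bigr => i _; rewrite mxE mulrDl. Qed.

Lemma dotZl a u v : dot (a *: u) v = a * dot u v.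
Proof. by rewrite mulr_sumr; apply: eq_bigr => i _; rewrite mxE mulrA. Qed.

Lemma dotNl u v : dot (- u) v = - dot u v.
Proof. by rewrite -scaleN1r dotZl mulN1r. Qed.

Lemma dotBl u v w : dot (u - v) w = dot u w - dot v w.
Proof. by rewrite dotDl dotNl. Qed.

Lemma dot0l v : dot 0 v = 0.
Proof. by rewrite -(scale0r 0) dotZl mul0r. Qed.

Lemma dotDr u v w : dot u (v + w) = dot u v + dot u w.
Proof. by rewrite dotC dotDl !(dotC u). Qed.

Lemma dotZr a u v : dot u (a *: v) = a * dot u v.
Proof. by rewrite dotC dotZl dotC. Qed.

Lemma dotNr u v : dot u (- v) = - dot u v.
Proof. by rewrite dotC dotNl dotC. Qed.

Lemma dotBr u v w : dot u (v - w) = dot u v - dot u w.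
Proof. by rewrite dotDr dotNr. Qed.

Lemma dot0r v : dot v 0 = 0.
Proof. by rewrite dotC dot0l. Qed.

Lemma dot_suml (I : Type) (r : seq I) (F : I -> 'cV[R]_n) v :
  dot (\sum_(i <- r) F i) v = \sum_(i <- r) dot (F i) v.
Proof.
by elim/big_ind2: _ => // [|x1 x2 y1 y2 <- <-]; rewrite ?dot0l ?dotDl.
Qed.

Lemma dot_sqE u : dot u u = \sum_(i < n) u i 0 ^+ 2.
Proof. by apply: eq_bigr => i _; rewrite expr2. Qed.

Lemma dot_ge0 u : 0 <= dot u u.
Proof. by rewrite dot_sqE; apply: sumr_ge0 => i _; exact: sqr_ge0. Qed.

Lemma enorm_sq u : enorm u ^+ 2 = dot u u.
Proof. by rewrite dot_sqE sqr_sqrtr// -dot_sqE dot_ge0. Qed.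

Lemma enorm_ge0 u : 0 <= enorm u.
Proof. exact: sqrtr_ge0. Qed.

Lemma dot_eq0 u : (dot u u == 0) = (u == 0).
Proof.
apply/idP/eqP => [|->]; last by rewrite dot0l.
rewrite dot_sqE psumr_eq0 => [/allP u0|i _]; last exact: sqr_ge0.
apply/colP => i; rewrite mxE; apply/eqP; rewrite -sqrf_eq0.
by have /implyP := u0 i (mem_index_enum _); apply.
Qed.

Lemma dot_gt0 u : (0 < dot u u) = (u != 0).
Proof. by rewrite lt0r dot_eq0 dot_ge0 andbT. Qed.

Lemma enorm0 : enorm (0 : 'cV[R]_n) = 0.
Proof. by apply/eqP; rewrite -sqrf_eq0 enorm_sq dot0l. Qed.

Lemma cauchy_schwarz u v : dot u v <= enorm u * enorm v.
Proof.
have [->|u0] := eqVneq u 0; first by rewrite dot0l enorm0 mul0r.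
have pu : 0 < dot u u by rewrite dot_gt0.
have : dot u v ^+ 2 <= (enorm u * enorm v) ^+ 2.
  rewrite exprMn !enorm_sq.
  have := dot_ge0 (dot u u *: v - dot u v *: u).
  rewrite !(dotBl, dotBr, dotZl, dotZr) (dotC v u) => h.
  have {h} : 0 <= dot u u * (dot u u * dot v v - dot u v ^+ 2) by lra.
  by rewrite pmulr_rge0// subr_ge0.
have p : 0 <= enorm u * enorm v by rewrite mulr_ge0 ?enorm_ge0.
have [h _|/ltW h] := leP (dot u v) 0; first exact: le_trans p.
by rewrite ler_sqr.
Qed.

Lemma enormN u : enorm (- u) = enorm u.
Proof. by congr Num.sqrt; apply: eq_bigr => i _; rewrite mxE sqrrN. Qed.

Lemma enormBC u v : enorm (u - v) = enorm (v - u).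
Proof. by rewrite -enormN opprB. Qed.

Lemma normr_dot u v : `|dot u v| <= enorm u * enorm v.
Proof.
by rewrite ler_norml cauchy_schwarz andbT lerNl -dotNl -(enormN u) cauchy_schwarz.
Qed.

Lemma enormD u v : enorm (u + v) <= enorm u + enorm v.
Proof.
rewrite -ler_sqr ?nnegrE ?addr_ge0 ?enorm_ge0// sqrrD !enorm_sq.
rewrite dotDl !dotDr (dotC v u).
by have := cauchy_schwarz u v; lra.
Qed.

Lemma enormZ a u : enorm (a *: u) = `|a| * enorm u.
Proof.
apply/eqP; rewrite -(eqrXn2 (n := 2))// ?mulr_ge0 ?enorm_ge0//.
by rewrite exprMn !enorm_sq dotZl dotZr mulrA -expr2 real_normK// num_real.
Qed.

Lemma enorm_sum (I : Type) (r : seq I) (F : I -> 'cV[R]_n) :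
  enorm (\sum_(i <- r) F i) <= \sum_(i <- r) enorm (F i).
Proof.
elim/big_ind2: _ => // [|x1 x2 y1 y2 h1 h2]; first by rewrite enorm0.
by apply: le_trans (enormD _ _) _; apply: lerD.
Qed.

Lemma enorm_le u a : 0 <= a -> dot u u <= a ^+ 2 -> enorm u <= a.
Proof. by move=> a0; rewrite -enorm_sq ler_sqr// ?nnegrE ?enorm_ge0. Qed.

Lemma coord_le_enorm u i : `|u i 0| <= enorm u.
Proof.
rewrite -ler_sqr ?nnegrE ?enorm_ge0// enorm_sq dot_sqE real_normK ?num_real//.
rewrite (bigD1 i)//= lerDl; apply: sumr_ge0 => j _; exact: sqr_ge0.
Qed.

Lemma enorm_le_mx_norm u : enorm u <= n%:R * `|u|.
Proof.
have coordn i : `|u i 0| <= `|u|.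
  by rewrite [leRHS]/Num.norm/= mx_normrE; apply/bigmax_geP; right; exists (i, 0).
apply: enorm_le; first by rewrite mulr_ge0.
rewrite dot_sqE.
apply: (@le_trans _ _ (\sum_(i < n) `|u| ^+ 2)).
  apply: ler_sum => i _; rewrite -[u i 0 ^+ 2]real_normK ?num_real//.
  by rewrite ler_sqr ?nnegrE.
rewrite sumr_const card_ord -[leLHS]mulr_natl exprMn.
apply: ler_wpM2r; first exact: sqr_ge0.
by rewrite -natrX ler_nat; case: (n) => // m; rewrite -[leqLHS]expn1 leq_pexp2l.
Qed.

End Euclidean.

Lemma dot_mulmxr (R : realType) (m n : nat) (A : 'M[R]_(m, n)) x y :
  dot y (A *m x) = dot (A^T *m y) x.
Proof.
have dotE k (a b : 'cV[R]_k) : dot a b = (a^T *m b) 0 0.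
  by rewrite mxE; apply: eq_bigr => i _; rewrite mxE.
by rewrite !dotE trmx_mul trmxK mulmxA.
Qed.

Section Continuity.
Context {R : realType}.

Lemma cV_continuousP (n : nat) (T : topologicalType) (F : T -> 'cV[R]_n) :
  (forall i, continuous (fun t => F t i 0)) -> continuous F.
Proof.
move=> h t; apply/cvg_ballP => e e0.
have : forall i : 'I_n, \forall s \near t, ball (F t i 0) e (F s i 0).
  by move=> i; have := h i t; move/cvg_ballP => /(_ _ e0).
move=> /filter_forall; apply: filterS => s hs; split => // i j.
by rewrite ord1; exact: hs.
Qed.

Lemma continuous_dot (n : nat) (T : topologicalType) (F G : T -> 'cV[R]_n) :
  continuous F -> continuous G -> continuous (fun t => dot (F t) (G t)).
Proof.
move=> cF cG; rewrite /dot; elim: (index_enum _) => [|i s ih] t.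
  by under eq_fun do rewrite big_nil; exact: cvg_cst.
under eq_fun do rewrite big_cons.
apply: cvgD; last exact: ih.
apply: cvgM.
  exact: (continuous_comp (cF t) (@coord_continuous _ _ _ i 0 _)).
exact: (continuous_comp (cG t) (@coord_continuous _ _ _ i 0 _)).
Qed.

Lemma continuous_mulmx (m n : nat) (A : 'M[R]_(m, n)) :
  continuous (fun x : 'cV[R]_n => A *m x).
Proof.
apply: cV_continuousP => i.
have -> : (fun x : 'cV[R]_n => (A *m x) i 0) = (fun x => dot (row i A)^T x).
  by apply/funext => x; rewrite mxE /dot; apply: eq_bigr => j _; rewrite !mxE.
apply: continuous_dot; first exact: cst_continuous.
by move=> x; exact: cvg_id.
Qed.

Lemma bounded_closed_compact_cV (n : nat) (K : set 'cV[R]_n) (M : R) :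
  closed K -> (forall x, K x -> enorm x <= M) -> compact K.
Proof.
move=> cK bK; pose K' : set 'rV[R]_n := [set x | K x^T].
have trc m k : continuous (@trmx R m k).
  move=> x B /nbhs_ballP[e e0 eB]; apply/nbhs_ballP; exists e => //= y [_ xy].
  apply: eB; split => // i j.
  by rewrite !mxE; exact: xy.
have -> : K = trmx @` K'.
  rewrite eqEsubset; split => [x Kx|_ [x Kx <-]//].
  by exists x^T; [rewrite /K'/= trmxK|exact: trmxK].
apply: continuous_compact; first by apply: continuous_subspaceT; exact: trc.
apply: bounded_closed_compact; last first.
  by apply: (closed_comp _ cK) => x _; exact: trc.
exists M; split; first exact: num_real.
move=> B MB x /bK h; apply/(le_trans _ (ltW MB))/(le_trans _ h).
rewrite [leLHS]/Num.norm/= mx_normrE; apply/bigmax_leP; split => [|[i j] _ /=].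
  exact: enorm_ge0.
by rewrite ord1; have := coord_le_enorm x^T j; rewrite mxE.
Qed.

End Continuity.

Section ExtremalEigenvalues.
Context {R : realType} {n : nat}.

(** Minimizing the quadratic form of [M] over the unit sphere of an invariant
    subspace [V] produces an eigenvector: at a minimizer the first-order
    variation of the form vanishes along every direction of [V], in particular
    along the residual [M *m v - l *: v] itself. *)
Lemma sym_min_eigenvector (M : 'M[R]_n) (V : set 'cV[R]_n) :
  M^T = M -> closed V -> (exists2 v, V v & v != 0) ->
  (forall a u v, V u -> V v -> V (a *: u + v)) ->
  (forall v, V v -> V (M *m v)) ->
  exists v l, [/\ V v, v != 0, M *m v = l *: v &
    forall x, V x -> l * dot x x <= dot (M *m x) x].
Proof.
move=> symM cV [v0 Vv0 v0n0] linV invV.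
have V0 : V 0 by have := linV (-1) _ _ Vv0 Vv0; rewrite scaleN1r addNr.
have VZ a v : V v -> V (a *: v) by move=> Vv; rewrite -[_ *: _]addr0; exact: linV.
pose K : set 'cV[R]_n := V `&` [set x | dot x x = 1].
have cdot : continuous (fun x : 'cV[R]_n => dot x x).
  by apply: continuous_dot => x; exact: cvg_id.
have cq : continuous (fun x : 'cV[R]_n => dot (M *m x) x).
  apply: continuous_dot; first exact: continuous_mulmx.
  by move=> x; exact: cvg_id.
have nrm x : x != 0 -> dot ((enorm x)^-1 *: x) ((enorm x)^-1 *: x) = 1.
  move=> x0; rewrite dotZl dotZr mulrA -invfM -expr2 enorm_sq mulVf//.
  by rewrite dot_eq0.
have K0 : K !=set0.
  by exists ((enorm v0)^-1 *: v0); split; [exact: VZ|exact: nrm].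
have cK : compact K.
  apply: (@bounded_closed_compact_cV R n K 1) => [|x [_ /= x1]]; last first.
    by apply: enorm_le; rewrite ?x1 ?expr1n.
  apply: closedI => //.
  by apply: (closed_comp (f := fun x : 'cV[R]_n => dot x x)) (@closed_eq _ 1) => x _; exact: cdot.
have [v] := compact_EVT_min K0 cK (continuous_subspaceT cq).
rewrite inE => -[Vv /= v1] vmin.
pose l := dot (M *m v) v.
have form_ge x : V x -> l * dot x x <= dot (M *m x) x.
  move=> Vx; have [->|x0] := eqVneq x 0; first by rewrite mulmx0 dot0l mulr0.
  have /vmin : (enorm x)^-1 *: x \in K.
    by rewrite inE; split; [exact: VZ|exact: nrm].
  rewrite -/l.
  rewrite -scalemxAr dotZl dotZr mulrA -invfM -expr2 enorm_sq mulrC.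
  by rewrite ler_pdivlMr// dot_gt0.
exists v, l; split => //; first by rewrite -dot_gt0 v1.
apply/eqP; rewrite -subr_eq0 -dot_eq0; set h := _ - _.
have hE : h = M *m v - l *: v by []; clearbody h.
have Vh : V h by rewrite hE addrC -scaleNr; apply: linV => //; exact: invV.
have key t : 0 <= 2 * t * dot h h + t ^+ 2 * (dot (M *m h) h - l * dot h h).
  have := form_ge (t *: h + v) (linV _ _ _ Vh Vv).
  rewrite mulmxDr -scalemxAr !(dotDl, dotDr, dotZl, dotZr) v1 -/l.
  have -> : dot (M *m h) v = dot h (M *m v) by rewrite dot_mulmxr symM.
  rewrite (dotC (M *m v) h) (dotC v h).
  have -> : dot h h = dot h (M *m v) - l * dot h v by rewrite [in X in dot _ X]hE dotBr dotZr.
  by lra.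
rewrite eq_le dot_ge0 andbT leNgt; apply/negP => hh.
set c := dot (M *m h) h - l * dot h h in key.
pose t := dot h h / (1 + `|c|).
have c1 : 0 < 1 + `|c| by rewrite ltr_pwDl.
have t0 : 0 < t by rewrite divr_gt0.
have tc : t * c < dot h h.
  rewrite /t mulrAC -mulrA gtr_pMr// ltr_pdivrMr// mul1r.
  by rewrite (le_lt_trans (ler_norm c))// ltrDr.
have := key (- t); rewrite -(ltr_pM2l t0) in tc.
by have := mulr_gt0 t0 hh; lra.
Qed.

Lemma eigenvalue_symP (M : 'M[R]_n) (v : 'cV[R]_n) l :
  M^T = M -> v != 0 -> M *m v = l *: v -> eigenvalue M l.
Proof.
move=> symM v0 Mv; apply/eigenvalueP; exists v^T; last by rewrite trmx_eq0.
by rewrite -[M in LHS]symM -trmx_mul Mv linearZ.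
Qed.

Lemma lambda_max_bound (A : 'M[R]_n) lmax x :
  is_lambda_max (A^T *m A) lmax -> dot (A *m x) (A *m x) <= lmax * dot x x.
Proof.
move=> [_ lmaxP]; have symA : (- (A^T *m A))^T = - (A^T *m A).
  by rewrite linearN/= trmx_mul trmxK.
have [->|x0] := eqVneq x 0; first by rewrite mulmx0 !dot0l mulr0.
have [||||v [l [_ v0 Mv /(_ x I)]]] := @sym_min_eigenvector (- (A^T *m A)) setT symA => //.
  by exists x.
rewrite mulNmx dotNl -mulmxA (dotC (A^T *m _)) dot_mulmxr trmxK => h.
have : - l <= lmax.
  apply: lmaxP; apply: (@eigenvalue_symP _ v) => //.
    by rewrite trmx_mul trmxK.
  by rewrite scaleNr -Mv mulNmx opprK.
by move=> /(ler_wpM2r (dot_ge0 x)); lra.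
Qed.

(** [A^T] has the operator norm of [A], by Cauchy-Schwarz. *)
Lemma lambda_max_boundT (A : 'M[R]_n) lmax y :
  is_lambda_max (A^T *m A) lmax ->
  dot (A^T *m y) (A^T *m y) <= lmax * dot y y.
Proof.
move=> hA; have [y0|y0] := eqVneq (A^T *m y) 0.
  rewrite y0 dot0l; have := lambda_max_bound _ _ y hA.
  exact: le_trans (dot_ge0 _).
have pos : 0 < dot (A^T *m y) (A^T *m y) by rewrite dot_gt0.
have h1 : dot (A^T *m y) (A^T *m y) = dot y (A *m (A^T *m y)).
  by rewrite [RHS]dot_mulmxr.
have h2 := lambda_max_bound _ _ (A^T *m y) hA.
have h3 := cauchy_schwarz y (A *m (A^T *m y)); rewrite -h1 in h3.
have : dot (A^T *m y) (A^T *m y) ^+ 2 <= dot y y * (lmax * dot (A^T *m y) (A^T *m y)).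
  apply: (@le_trans _ _ ((enorm y * enorm (A *m (A^T *m y))) ^+ 2)).
    by rewrite ler_sqr// ?nnegrE ?mulr_ge0 ?enorm_ge0// ltW.
  by rewrite exprMn !enorm_sq ler_wpM2l// dot_ge0.
by rewrite expr2 mulrA ler_pM2r// mulrC.
Qed.

(** The least eigenvalue of [A *m A^T] on the orthogonal complement of the
    kernel of [A^T] is positive, and [A^T] turns its eigenvector into one of
    [A^T *m A]. *)
Lemma lambda_min_pos_boundT (A : 'M[R]_n) lmin y :
  is_lambda_min_pos (A^T *m A) lmin ->
  (forall v, A^T *m v = 0 -> dot y v = 0) ->
  lmin * dot y y <= dot (A^T *m y) (A^T *m y).
Proof.
move=> [_ lmin0 lminP] hy.
have [->|y0] := eqVneq y 0; first by rewrite mulmx0 !dot0l mulr0.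
pose V : set 'cV[R]_n := [set x | forall v, A^T *m v = 0 -> dot x v = 0].
have symA : (A *m A^T)^T = A *m A^T by rewrite trmx_mul trmxK.
have cV : closed V.
  have -> : V = \bigcap_(v in [set v | A^T *m v = 0]) [set x | dot x v = 0].
    by apply/seteqP; split.
  apply: closed_bigI => v _.
  apply: (closed_comp (f := fun x : 'cV[R]_n => dot x v)) (@closed_eq _ 0) => x _.
  apply: (@continuous_dot _ n _ id (fun=> v)); last exact: cst_continuous.
  by move=> z; exact: cvg_id.
have [|||v [l [Vv v0 Mv /(_ y hy)]]] := @sym_min_eigenvector (A *m A^T) V symA cV.
- by exists y.
- by move=> a u v Vu Vv w w0; rewrite dotDl dotZl Vu// Vv// mulr0 addr0.
- by move=> v Vv w w0; rewrite -mulmxA dotC dot_mulmxr w0 dot0l.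
rewrite -mulmxA (dotC (A *m _)) dot_mulmxr; apply: le_trans.
apply: ler_wpM2r; first exact: dot_ge0.
have ATv0 : A^T *m v != 0.
  by apply/eqP => /Vv /eqP; rewrite dot_eq0 (negbTE v0).
have lv : l * dot v v = dot (A^T *m v) (A^T *m v).
  by rewrite -dot_mulmxr mulmxA Mv dotZr.
apply: lminP.
  apply: (@eigenvalue_symP _ (A^T *m v)) => //.
    by rewrite trmx_mul trmxK.
  by rewrite -mulmxA [A *m (A^T *m v)]mulmxA Mv -scalemxAr.
by rewrite -(pmulr_lgt0 _ (_ : 0 < dot v v)) ?lv dot_gt0.
Qed.

End ExtremalEigenvalues.

(** The columns of [cokermx A] lie in the kernel of [A], hence [g] annihilates
    them, which is the criterion for [g^T] to be in the row space of [A]. *)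
Lemma orthogonal_kernel_rangeT (R : realType) (n : nat) (A : 'M[R]_n) g :
  (forall v, A *m v = 0 -> dot g v = 0) -> exists y, A^T *m y = g.
Proof.
move=> hg; have /submxP[D gD] : (g^T <= A)%MS.
  rewrite submxE; apply/eqP/rowP => j; rewrite !mxE.
  transitivity (dot g (col j (cokermx A))).
    by apply: eq_bigr => i _; rewrite !mxE.
  by apply: hg; rewrite colE mulmxA mulmx_coker mul0mx.
by exists D^T; rewrite -trmx_mul -gD trmxK.
Qed.

(** * Convex functions and their gradients *)

Definition convex_on_cV (R : realType) (n : nat) (f : 'cV[R]_n -> R) : Prop :=
  forall (x y : 'cV[R]_n) (t : R), 0 <= t <= 1 ->
    f (t *: x + (1 - t) *: y) <= t * f x + (1 - t) * f y.

Section Convexity.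
Context {R : realType} {n : nat}.
Implicit Types (f : 'cV[R]_n -> R) (x y z g v h : 'cV[R]_n).

Lemma strongly_convex_convex f mu :
  0 <= mu -> strongly_convex mu f -> convex_on_cV R n f.
Proof.
move=> mu0 scf x y t t01; apply: le_trans (scf x y t t01) _.
case/andP: t01 => t0 t1; rewrite gerBl.
by rewrite !mulr_ge0 ?invr_ge0 ?subr_ge0 ?sqr_ge0// ?enorm_ge0.
Qed.

Lemma convex_jensen f (T : Type) (w : T -> R) (p : T -> 'cV[R]_n) i (s : seq T) :
  convex_on_cV R n f -> (forall j, 0 < w j) ->
  f ((\sum_(j <- i :: s) w j)^-1 *: \sum_(j <- i :: s) w j *: p j) <=
  (\sum_(j <- i :: s) w j)^-1 * \sum_(j <- i :: s) w j * f (p j).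
Proof.
move=> cf w0; elim: s i => [|j s ih] i.
  by rewrite !big_seq1 scalerA mulrA mulVf ?gt_eqF// scale1r mul1r.
rewrite (big_cons _ _ i) (big_cons _ _ i) (big_cons _ _ i).
set W := \sum_(k <- j :: s) w k; set S := \sum_(k <- j :: s) w k *: p k.
set F := \sum_(k <- j :: s) w k * f (p k); have {}ih : f (W^-1 *: S) <= W^-1 * F by exact: ih.
have W0 : 0 < W.
  rewrite /W big_cons ltr_pwDl//; apply: sumr_ge0 => k _; exact: ltW.
clearbody W S F; have wi := w0 i; have wW : 0 < w i + W by rewrite addr_gt0.
have t01 : 0 <= w i / (w i + W) <= 1.
  by rewrite (divr_ge0 (ltW wi) (ltW wW))/= ler_pdivrMr// mul1r lerDl ltW.
have := cf (p i) (W^-1 *: S) _ t01.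
have -> : 1 - w i / (w i + W) = W / (w i + W) by field; rewrite gt_eqF.
rewrite scalerA [W / _ * W^-1]mulrAC mulfV ?gt_eqF// mul1r scalerDr scalerA.
rewrite [_^-1 * w i]mulrC => /le_trans; apply.
rewrite [leRHS](_ : _ = w i / (w i + W) * f (p i) + W / (w i + W) * (W^-1 * F)).
  rewrite lerD2l.
  by apply: ler_wpM2l => //; rewrite (divr_ge0 (ltW W0) (ltW wW)).
by field; rewrite !gt_eqF.
Qed.

(** A point of a small cube around [x] is an average of points on the coordinate
    lines through [x], where [f] is below its values at [x + e i], [x - e i]. *)
Lemma convex_locally_bounded f x : convex_on_cV R n f ->
  exists M, forall h, (forall i, n%:R * `|h i 0| <= 1) -> f (x + h) <= M.
Proof.
move=> cf; pose e (i : 'I_n) : 'cV[R]_n := delta_mx i 0.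
case: (pselect (exists i0 : 'I_n, True)) => [[i0 _]|n0]; last first.
  exists (f x) => h _; rewrite (_ : h = 0) ?addr0//.
  by apply/colP => i; case: n0; exists i.
pose M := \sum_(i < n) (`|f (x + e i)| + `|f (x - e i)|).
exists M => h hh.
have npos : 0 < n%:R :> R by rewrite ltr0n (leq_ltn_trans _ (ltn_ord i0)).
have seg i s : `|s| <= 1 -> f (x + s *: e i) <= M.
  rewrite ler_norml => /andP[s1 s2].
  have t01 : 0 <= (1 + s) / 2 <= 1 by lra.
  have := cf (x + e i) (x - e i) _ t01.
  have -> : (1 + s) / 2 *: (x + e i) + (1 - (1 + s) / 2) *: (x - e i) = x + s *: e i.
    by apply/colP => j; rewrite !mxE; field.
  move=> /le_trans; apply.
  apply: (@le_trans _ _ (`|f (x + e i)| + `|f (x - e i)|)).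
    have := ler_norm (f (x + e i)); have := ler_norm (f (x - e i)).
    have := normr_ge0 (f (x + e i)); have := normr_ge0 (f (x - e i)).
    move: (f (x + e i)) (f (x - e i)) => a b hb0 ha0 hb ha.
    by move: `|a| `|b| ha hb ha0 hb0 => a' b' ? ? ? ?; nra.
  rewrite /M (bigD1 i)//= lerDl; apply: sumr_ge0 => j _.
  by rewrite addr_ge0.
have [j [s Es]] : exists j s, index_enum 'I_n = j :: s.
  have := mem_index_enum i0; case: (index_enum _) => // j s _.
  by exists j, s.
have := convex_jensen f _ (fun=> 1) (fun i => x + (n%:R * h i 0) *: e i) j s cf (fun=> ltr01).
rewrite -Es sumr_const card_ord.
have -> : n%:R^-1 *: (\sum_(i < n) 1 *: (x + (n%:R * h i 0) *: e i)) = x + h.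
  under eq_bigr do rewrite scale1r.
  rewrite big_split/= sumr_const card_ord scalerDr -[x *+ n]scaler_nat scalerA.
  rewrite mulVf ?gt_eqF// scale1r; congr (_ + _).
  under eq_bigr do rewrite -scalerA; rewrite -scaler_sumr scalerA mulVf ?gt_eqF//.
  rewrite scale1r [RHS]matrix_sum_delta; apply: eq_bigr => i _.
  by rewrite big_ord1.
move=> /le_trans; apply.
rewrite mulrC ler_pdivrMr//.
apply: (@le_trans _ _ (\sum_(i < n) M)).
  apply: ler_sum => i _; rewrite mul1r; apply: seg.
  by rewrite normrM ger0_norm.
by rewrite sumr_const card_ord -mulr_natr.
Qed.

(** A point near [x] lies on a segment that joins [x] to a point where [f] is
    bounded above, and [x] lies between that point and another one of the same
    kind; convexity on these two segments bounds the oscillation of [f]. *)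
Lemma convex_continuous f : convex_on_cV R n f -> continuous f.
Proof.
move=> cf x; have [M hM] := convex_locally_bounded f x cf.
move=> B /nbhs_ballP[e e0 eB].
pose C := `|M - f x| + 1; have C0 : 0 < C by rewrite ltr_wpDl.
have MC : M - f x <= C by rewrite /C (le_trans (ler_norm _))// lerDl.
pose t := Num.min 1 (e / 2 / C).
have t0 : 0 < t by rewrite lt_min ltr01 !divr_gt0.
have t1 : t <= 1 by rewrite ge_min lexx.
have tC : t * C <= e / 2 by rewrite -ler_pdivlMr// ge_min lexx orbT.
apply/nbhs_ballP; exists (t / (n%:R + 1)) => /= [|y [_ xy]].
  by rewrite divr_gt0// ltr_wpDl.
pose h := y - x; have -> : y = x + h by rewrite /h addrC subrK.
have hh i : n%:R * `|t^-1 * h i 0| <= 1.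
  have := xy i 0; rewrite /ball/= distrC => lt1.
  rewrite !mxE normrM normfV (gtr0_norm t0) mulrCA ler_pdivrMl// mulr1.
  apply: (@le_trans _ _ (n%:R * (t / (n%:R + 1)))).
    by apply: ler_wpM2l => //; exact: ltW.
  by rewrite mulrCA (ler_piMr (ltW t0))// ler_pdivrMr ?ltr_wpDl// mul1r lerDl.
have fp : f (x + t^-1 *: h) <= M by apply: hM => i; rewrite mxE.
have fm : f (x - t^-1 *: h) <= M.
  by apply: hM => i; rewrite mxE [(_ *: h) _ _]mxE normrN.
have h1 : f (x + h) <= t * M + (1 - t) * f x.
  have t01 : 0 <= t <= 1 by rewrite t1 ltW.
  have := cf (x + t^-1 *: h) x t t01.
  have -> : t *: (x + t^-1 *: h) + (1 - t) *: x = x + h.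
    by apply/colP => i; rewrite !mxE; field; rewrite gt_eqF.
  by move=> /le_trans; apply; rewrite lerD2r ler_pM2l.
have h2 : (1 + t) * f x <= f (x + h) + t * M.
  have s01 : 0 <= (1 + t)^-1 <= 1.
    by rewrite invr_ge0 (addr_ge0 ler01 (ltW t0))/= invf_le1 ?addr_gt0// lerDl ltW.
  have := cf (x + h) (x - t^-1 *: h) _ s01.
  have tn0 : t != 0 by rewrite gt_eqF.
  have t1n0 : 1 + t != 0 by rewrite gt_eqF// addr_gt0.
  have -> : (1 + t)^-1 *: (x + h) + (1 - (1 + t)^-1) *: (x - t^-1 *: h) = x.
    by apply/colP => i; rewrite !mxE; field; apply/andP.
  have -> : 1 - (1 + t)^-1 = (1 + t)^-1 * t by field.
  rewrite -mulrA -mulrDr [_^-1 * _]mulrC ler_pdivlMr ?addr_gt0// mulrC.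
  by move=> /le_trans; apply; rewrite lerD2l ler_pM2l.
have e2 : e / 2 < e by rewrite ltr_pdivrMr// ltr_pMr// ltr1n.
apply: eB; rewrite /ball/=; apply: le_lt_trans e2.
by apply/ler_normlP; split; nra.
Qed.

Lemma gradient_quotient f x g v e : is_gradient f x g -> 0 < e ->
  exists2 t, 0 < t <= 1 & `|dot g v - t^-1 * (f (x + t *: v) - f x)| <= e.
Proof.
move=> [df dg] e0; have dfv : derivable f x v by exact: diff_derivable.
move/cvgrPdist_le : dfv => /(_ e e0).
rewrite -/(derive f x v) deriveE// dg => /nbhs_ballP[d /= d0 hd].
pose t := Num.min (d / 2) 1.
have t0 : 0 < t by rewrite lt_min divr_gt0//=.
exists t; first by rewrite t0 ge_min lexx orbT.
rewrite [x + _]addrC; apply: hd; last by rewrite gt_eqF.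
rewrite /ball/= sub0r normrN gtr0_norm//.
by rewrite gt_min ltr_pdivrMr// ltr_pMr// ltr1n.
Qed.

Lemma gradient_ge f x g v c : is_gradient f x g ->
  (forall t, 0 < t <= 1 -> t * c <= f (x + t *: v) - f x) -> c <= dot g v.
Proof.
move=> fg hc; apply/ler_addgt0Pr => e e0.
have [t t01] := gradient_quotient f x g v e fg e0.
have := hc t t01; case/andP: t01 => t0 _.
by rewrite -ler_pdivlMl// ler_norml => h1 /andP[h2 _]; lra.
Qed.

Lemma gradient_le f x g v c : is_gradient f x g ->
  (forall t, 0 < t <= 1 -> f (x + t *: v) - f x <= t * c) -> dot g v <= c.
Proof.
move=> fg hc; apply/ler_addgt0Pr => e e0.
have [t t01] := gradient_quotient f x g v e fg e0.
have := hc t t01; case/andP: t01 => t0 _.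
by rewrite -ler_pdivrMl// ler_norml => h1 /andP[_ h2]; lra.
Qed.

Lemma convex_gradient_argmax f x g : convex_on_cV R n f -> is_gradient f x g ->
  is_dual_argmax f g x.
Proof.
move=> cf fg z; suff : dot g (z - x) <= f z - f x by rewrite dotBr; lra.
apply: gradient_le fg _ => t /andP[t0 t1].
have t01 : 0 <= t <= 1 by rewrite t1 ltW.
have := cf z x t t01.
have -> : t *: z + (1 - t) *: x = x + t *: (z - x).
  by apply/colP => i; rewrite !mxE; ring.
by lra.
Qed.

Lemma argmax_gradient f x y g : is_gradient f x g -> is_dual_argmax f y x ->
  y = g.
Proof.
move=> fg yx; have dotle v : dot y v <= dot g v.
  apply: gradient_ge fg _ => t _; have := yx (x + t *: v).
  by rewrite dotDr dotZr; lra.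
apply/eqP; rewrite -subr_eq0 -dot_eq0 eq_le dot_ge0 andbT.
by rewrite dotBl subr_le0 dotle.
Qed.

(** Strong convexity makes the maximized function drop quadratically away from
    its maximizer: let [t] tend to [0] in the inequality at
    [t *: z + (1 - t) *: x]. *)
Lemma argmax_quadratic_growth f mu y x z : strongly_convex mu f ->
  is_dual_argmax f y x ->
  dot y z - f z <= dot y x - f x - mu / 2 * dot (z - x) (z - x).
Proof.
move=> scf yx; set D := dot (z - x) (z - x).
suff h t : 0 < t <= 1 ->
    dot y z - f z <= dot y x - f x - mu / 2 * D + t * (mu / 2 * D).
  apply/ler_addgt0Pr => e e0.
  pose t := Num.min (e / (`|mu / 2 * D| + 1)) 1.
  have d0 : 0 < `|mu / 2 * D| + 1 by rewrite ltr_wpDl.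
  have t0 : 0 < t by rewrite lt_min divr_gt0//=.
  have t01 : 0 < t <= 1 by rewrite t0 ge_min lexx orbT.
  apply: le_trans (h t t01) _; rewrite lerD2l.
  apply: (@le_trans _ _ (t * (`|mu / 2 * D| + 1))).
    rewrite ler_pM2l//; apply: le_trans (ler_norm _) _; by rewrite lerDl.
  by rewrite -ler_pdivlMr// ge_min lexx.
move=> /andP[t0 t1]; have t01 : 0 <= t <= 1 by rewrite t1 ltW.
have := scf z x t t01; rewrite enorm_sq -/D.
have := yx (t *: z + (1 - t) *: x); rewrite dotDr !dotZr => h1 h2.
rewrite -(ler_pM2l t0); lra.
Qed.

Lemma dual_argmax_unique f mu y x z : 0 < mu -> strongly_convex mu f ->
  is_dual_argmax f y x -> is_dual_argmax f y z -> x = z.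
Proof.
move=> mu0 scf yx yz; have h1 := argmax_quadratic_growth _ _ _ _ z scf yx.
have := yz x => h2; apply/esym/eqP; rewrite -subr_eq0 -dot_eq0 eq_le dot_ge0 andbT.
have : mu / 2 * dot (z - x) (z - x) <= 0 by lra.
by rewrite pmulr_rle0// divr_gt0.
Qed.

(** Quadratic growth around one maximizer confines the maximization of any other
    tilt [dot y x - f x] to a compact ball. *)
Lemma dual_argmax_exists f mu g xs y : 0 < mu -> strongly_convex mu f ->
  is_dual_argmax f g xs -> exists x, is_dual_argmax f y x.
Proof.
move=> mu0 scf gxs; pose rho := 2 * enorm (y - g) / mu.
have rho0 : 0 <= rho by rewrite divr_ge0 ?mulr_ge0 ?enorm_ge0// ltW.
pose K : set 'cV[R]_n := [set x | dot (x - xs) (x - xs) <= rho ^+ 2].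
have cf : continuous f.
  by apply: convex_continuous; apply: strongly_convex_convex scf; exact: ltW.
have cid : continuous (fun x : 'cV[R]_n => x) by move=> x; exact: cvg_id.
have csub : continuous (fun x : 'cV[R]_n => x - xs).
  by move=> x; apply: continuousB; [exact: cid|exact: cst_continuous].
have K0 : K !=set0 by exists xs; rewrite /K/= subrr dot0l sqr_ge0.
have cK : compact K.
  apply: (@bounded_closed_compact_cV R n K (rho + enorm xs)) => [|x Kx].
    apply: (closed_comp (f := fun x : 'cV[R]_n => dot (x - xs) (x - xs))
      (D := [set z | z <= rho ^+ 2])) (@closed_le _ _) => x _.
    exact: (@continuous_dot R n _ _ _ csub csub).
  have := enormD (x - xs) xs; rewrite subrK => /le_trans; apply.
  by rewrite lerD2r; exact: enorm_le.
have cG : continuous (fun x => dot y x - f x).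
  move=> x; apply: continuousB; last exact: cf.
  exact: (@continuous_dot R n _ (fun=> y) _ (@cst_continuous _ _ y) cid).
have [x] := compact_EVT_max K0 cK (continuous_subspaceT cG).
rewrite inE => Kx xmax; exists x => z.
have [Kz|Kz] := leP (dot (z - xs) (z - xs)) (rho ^+ 2).
  by apply: xmax; rewrite inE.
have xsx : dot y xs - f xs <= dot y x - f x.
  by apply: xmax; rewrite inE /K/= subrr dot0l sqr_ge0.
apply: le_trans xsx.
have := argmax_quadratic_growth _ _ _ _ z scf gxs.
have := cauchy_schwarz (y - g) (z - xs).
have rz : rho < enorm (z - xs).
  by rewrite -ltr_sqr ?nnegrE ?enorm_ge0// enorm_sq.
have {}rz : enorm (y - g) <= mu / 2 * enorm (z - xs).
  move: rz; rewrite /rho ltr_pdivrMr// => /ltW; lra.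
have := ler_wpM2r (enorm_ge0 (z - xs)) rz.
rewrite -!enorm_sq expr2 dotBl !dotBr; lra.
Qed.

End Convexity.

(** * The conjugate and the dual problem *)

Section Conjugate.
Context {R : realType} {n : nat}.
Implicit Types (f : 'cV[R]_n -> R) (x y z g : 'cV[R]_n).

Lemma dual_argmaxP f y :
  (exists x, is_dual_argmax f y x) -> is_dual_argmax f y (dual_argmax f y).
Proof.
by case=> x hx; rewrite /dual_argmax; case: xgetP => [z _ //|/(_ x)]; case.
Qed.

Lemma phi_argmax f y x : is_dual_argmax f y x -> phi f y = dot y x - f x.
Proof.
move=> yx; apply/eqP; rewrite eq_le; apply/andP; split.
  by apply: sup_le_ub => [|_ [z _ <-]//]; exists (dot y x - f x), x.
by apply: ub_le_sup; [exists (dot y x - f x) => _ [z _ <-]|exists x].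
Qed.

Lemma fenchel_young f y x z : is_dual_argmax f y x -> dot y z - f z <= phi f y.
Proof. by move=> yx; rewrite (phi_argmax _ _ _ yx). Qed.

End Conjugate.

(** The point [xg] of differentiability anchors [f] from below, and this makes
    the maximization that defines [phi] coercive. *)
Section SmoothDual.
Context {R : realType} {n : nat}.
Variables (A : 'M[R]_n) (f : 'cV[R]_n -> R) (mu lmax : R) (xg g : 'cV[R]_n).
Hypotheses (mu0 : 0 < mu) (scf : strongly_convex mu f).
Hypotheses (fg : is_gradient f xg g) (hA : is_lambda_max (A^T *m A) lmax).
Implicit Types (x y z : 'cV[R]_n).

Let x_of y : 'cV[R]_n := dual_argmax f y.
Let xA y : 'cV[R]_n := dual_argmax f (A^T *m y).

Lemma convex_f : convex_on_cV R n f.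
Proof. by apply: strongly_convex_convex scf; exact: ltW. Qed.

Lemma x_ofP y : is_dual_argmax f y (x_of y).
Proof.
apply: dual_argmaxP; apply: (dual_argmax_exists _ _ g xg _ mu0 scf).
by apply: convex_gradient_argmax fg; exact: convex_f.
Qed.

Lemma dual_argmax_eq y x : is_dual_argmax f y x -> dual_argmax f y = x.
Proof. exact: (dual_argmax_unique _ _ _ _ _ mu0 scf (x_ofP y)). Qed.

Lemma psiE y : psi A f y = dot y (A *m xA y) - f (xA y).
Proof. by rewrite /psi (phi_argmax _ _ _ (x_ofP _)) dot_mulmxr. Qed.

Lemma psi_ge y x : dot y (A *m x) - f x <= psi A f y.
Proof.
by rewrite dot_mulmxr; apply: (fenchel_young _ _ (x_of (A^T *m y))); exact: x_ofP.
Qed.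

Lemma psi_subgradient y z :
  psi A f y + dot (A *m xA y) (z - y) <= psi A f z.
Proof.
apply: le_trans (psi_ge z (xA y)).
by rewrite psiE dotBr (dotC z) (dotC y); lra.
Qed.

(** Any [x] falls short of the maximum at [A^T *m y] by a quadratic in its
    distance to [xA y], which absorbs the part of the change of slope that is
    not linear in [z - y]. *)
Lemma psi_smooth y z :
  psi A f z <= psi A f y + dot (A *m xA y) (z - y) +
    lmax / mu / 2 * dot (z - y) (z - y).
Proof.
rewrite (psiE z).
have := argmax_quadratic_growth _ _ _ _ (xA z) scf (x_ofP (A^T *m y)).
rewrite -(phi_argmax _ _ _ (x_ofP _)) -/(psi A f y) -/(xA y) -!dot_mulmxr.
set d := xA z - xA y; set h := z - y => hq.
suff : dot h (A *m d) - mu / 2 * dot d d <= lmax / mu / 2 * dot h h.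
  rewrite /d /h mulmxBr !(dotBl, dotBr) in hq *.
  rewrite (dotC (A *m xA y) z) (dotC (A *m xA y) y) => hs.
  by lra.
clear hq; clearbody d h.
apply: (@le_trans _ _ ((2 * mu)^-1 * dot (A^T *m h) (A^T *m h))).
  rewrite dot_mulmxr; have := dot_ge0 (A^T *m h - mu *: d).
  rewrite !(dotBl, dotBr, dotZl, dotZr) (dotC d) => hs.
  rewrite -(ler_pM2l (_ : 0 < 2 * mu)) ?mulr_gt0// mulrA mulfV ?mul1r; last first.
    by rewrite gt_eqF ?mulr_gt0.
  by lra.
have := lambda_max_boundT _ _ h hA.
rewrite -(ler_pM2l (_ : 0 < (2 * mu)^-1)) ?invr_gt0 ?mulr_gt0//.
move=> /le_trans; apply; rewrite le_eqVlt; apply/orP; left; apply/eqP.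
by field; rewrite gt_eqF.
Qed.

(** Add up the quadratic growth at each of the two maximizers, evaluated at the
    other one. *)
Lemma x_of_lipschitz y z : mu * enorm (x_of y - x_of z) <= enorm (y - z).
Proof.
have h1 := argmax_quadratic_growth _ _ _ _ (x_of z) scf (x_ofP y).
have h2 := argmax_quadratic_growth _ _ _ _ (x_of y) scf (x_ofP z).
have h3 := cauchy_schwarz (y - z) (x_of y - x_of z).
have dd : dot (x_of z - x_of y) (x_of z - x_of y) = enorm (x_of y - x_of z) ^+ 2.
  by rewrite -enorm_sq enormBC.
rewrite dd in h1; rewrite -enorm_sq in h2.
have {h1 h2 h3} : mu * enorm (x_of y - x_of z) ^+ 2 <=
    enorm (y - z) * enorm (x_of y - x_of z).
  by apply: le_trans h3; rewrite dotBl !dotBr; lra.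
rewrite expr2 mulrA; have := enorm_ge0 (x_of y - x_of z).
rewrite le_eqVlt => /orP[/eqP <- _|e0]; last by rewrite ler_pM2r.
by rewrite mulr0 enorm_ge0.
Qed.

Lemma psi_continuous : continuous (psi A f).
Proof.
apply: convex_continuous => y z t /andP[t0 t1].
set w := t *: y + _; rewrite (psiE w).
have := ler_wpM2l t0 (psi_ge y (xA w)).
have t1' : 0 <= 1 - t by rewrite subr_ge0.
have := ler_wpM2l t1' (psi_ge z (xA w)).
have -> : dot w (A *m xA w) = t * dot y (A *m xA w) + (1 - t) * dot z (A *m xA w).
  by rewrite {1}/w dotDl !dotZl.
by lra.
Qed.

End SmoothDual.

Section OptimalDual.
Context {R : realType} {n : nat}.
Variables (A : 'M[R]_n) (f : 'cV[R]_n -> R) (mu lmin : R) (xs ys g : 'cV[R]_n).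
Hypotheses (mu0 : 0 < mu) (scf : strongly_convex mu f).
Hypotheses (fg : is_gradient f xs g) (hxs : is_primal_solution A f xs).
Hypothesis (hys : is_min_norm_dual_solution A f ys).

Lemma psi_ge_primal y : - f xs <= psi A f y.
Proof.
have := psi_ge A f mu xs g mu0 scf fg y xs.
by case: hxs => -> _; rewrite dot0r sub0r.
Qed.

Lemma gradient_orthogonal_kernel v : A *m v = 0 -> dot g v = 0.
Proof.
have ge0 w : A *m w = 0 -> 0 <= dot g w.
  move=> Aw; apply: gradient_ge fg _ => t _; rewrite mulr0 subr_ge0.
  case: hxs => Axs; apply.
  by rewrite mulmxDr Axs -scalemxAr Aw scaler0 addr0.
move=> Av; apply/eqP; rewrite eq_le ge0// andbT.
by have := ge0 (- v); rewrite mulmxN Av oppr0 dotNr oppr_ge0; apply.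
Qed.

Lemma argmax_xs : is_dual_argmax f g xs.
Proof.
by apply: convex_gradient_argmax fg; exact: (convex_f f mu).
Qed.

(** A vector [y] with [A^T *m y = g] is a Lagrange multiplier: the conjugate at
    [g] is attained at [xs], where the constraint kills the linear term. *)
Lemma psi_at_multiplier y : A^T *m y = g -> psi A f y = - f xs.
Proof.
move=> yg; rewrite /psi yg (phi_argmax _ _ _ argmax_xs) -yg -dot_mulmxr.
by case: hxs => -> _; rewrite dot0r sub0r.
Qed.

Lemma dual_solution_value : psi A f ys = - f xs.
Proof.
apply/eqP; rewrite eq_le psi_ge_primal andbT.
have [y yg] := orthogonal_kernel_rangeT R n A g gradient_orthogonal_kernel.
by rewrite -(psi_at_multiplier y yg); case: hys => h _; exact: h.
Qed.

(** The dual optimal value [- f xs] is attained in the conjugate at [xs], and a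
    maximizer at which [f] is differentiable determines the slope. *)
Lemma dual_solution_multiplier : A^T *m ys = g.
Proof.
apply: argmax_gradient fg _ => z.
have := psi_ge A f mu xs g mu0 scf fg ys z.
by rewrite dual_solution_value -!dot_mulmxr; case: hxs => -> _; rewrite dot0r sub0r.
Qed.

Lemma dual_argmax_solution : dual_argmax f (A^T *m ys) = xs.
Proof.
apply: (dual_argmax_eq f mu xs g mu0 scf fg).
by rewrite dual_solution_multiplier; exact: argmax_xs.
Qed.

(** Moving [ys] along the kernel of [A^T] keeps it a dual solution, so the one of
    least norm is orthogonal to that kernel. *)
Lemma dual_solution_orthogonal v : A^T *m v = 0 -> dot ys v = 0.
Proof.
move=> Av; pose c := dot ys v; pose t := - c / (dot v v + 1).
have v1 : 0 < dot v v + 1 by rewrite ltr_wpDl ?dot_ge0.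
have sol : is_dual_solution A f (ys + t *: v).
  move=> z; rewrite psi_at_multiplier ?psi_ge_primal//.
  by rewrite mulmxDr -scalemxAr Av scaler0 addr0 dual_solution_multiplier.
case: hys => _ /(_ _ sol); rewrite -ler_sqr ?nnegrE ?enorm_ge0// !enorm_sq.
rewrite dotDl !dotDr !dotZl !dotZr (dotC v) -/c => h.
have {h} : 0 <= t * (2 * c + t * dot v v) by lra.
have -> : t * (2 * c + t * dot v v) =
    - (c ^+ 2 * (dot v v + 2) / (dot v v + 1) ^+ 2).
  by rewrite /t; field; rewrite gt_eqF.
rewrite oppr_ge0 pmulr_lle0 ?invr_gt0 ?exprn_gt0//.
rewrite pmulr_lle0; last by rewrite ltr_wpDl ?dot_ge0.
by rewrite -/c => h; apply/eqP; rewrite -sqrf_eq0 eq_le h sqr_ge0.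
Qed.

Lemma dual_solution_norm :
  is_lambda_min_pos (A^T *m A) lmin -> lmin * enorm ys ^+ 2 <= enorm g ^+ 2.
Proof.
move=> hl; rewrite !enorm_sq -dual_solution_multiplier.
by apply: lambda_min_pos_boundT => // v; exact: dual_solution_orthogonal.
Qed.

End OptimalDual.

(** * Step sizes and one step of the method *)

Section StepSizes.
Context {R : realType}.
Variables (Lt : R) (alpha Acc : nat -> R).
Hypotheses (Lt0 : 0 < Lt) (hc : spdstm_coefs Lt alpha Acc).

Lemma alphaS_gt0 k : 0 < alpha k.+1.
Proof. by case: hc => _ _ /(_ k)[]. Qed.

Lemma alpha_ge0 k : 0 <= alpha k.
Proof. by case: k => [|k]; [case: hc => ->|rewrite ltW// alphaS_gt0]. Qed.

Lemma AccS k : Acc k.+1 = Acc k + alpha k.+1.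
Proof. by case: hc => _ _ /(_ k)[]. Qed.

Lemma Acc_sum m : Acc m = \sum_(k < m) alpha k.+1.
Proof.
elim: m => [|m ih]; first by rewrite big_ord0; case: hc.
by rewrite big_ord_recr/= -ih AccS.
Qed.

Lemma Acc_ge0 k : 0 <= Acc k.
Proof. by rewrite Acc_sum; apply: sumr_ge0 => i _; exact: alpha_ge0. Qed.

Lemma AccS_gt0 k : 0 < Acc k.+1.
Proof. by rewrite AccS ltr_wpDl ?Acc_ge0 ?alphaS_gt0. Qed.

Lemma Acc_alpha k : Acc k = 2 * Lt * alpha k ^+ 2.
Proof.
case: k => [|k]; first by case: hc => -> -> _; rewrite expr0n mulr0.
by case: hc => _ _ /(_ k)[_ -> ->].
Qed.

(** With [a k = 2 * Lt * alpha k] the recursion for the steps reads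
    [a k.+1 ^+ 2 = a k ^+ 2 + a k.+1], so that [a] increases by an amount
    between [1 / 2] and [1] at each step. *)
Lemma alpha_increment k :
  2 * Lt * alpha k + 1 / 2 <= 2 * Lt * alpha k.+1 <= 2 * Lt * alpha k + 1.
Proof.
pose a j := 2 * Lt * alpha j; rewrite -/(a k) -/(a k.+1).
have a0 j : 0 <= a j by rewrite /a !mulr_ge0 ?alpha_ge0 ?ltW.
have aS : a k.+1 ^+ 2 = a k ^+ 2 + a k.+1.
  have aA j : a j ^+ 2 = 2 * Lt * Acc j by rewrite Acc_alpha /a; ring.
  by rewrite !aA AccS /a mulrDr.
have ap : 0 < a k.+1 by rewrite /a !mulr_gt0 ?alphaS_gt0.
have := a0 k; have {}ap := ap; move: (a k) (a k.+1) aS ap => b c bc c0 b0.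
have c1 : 1 <= c.
  by rewrite leNgt; apply/negP => c1; nra.
apply/andP; split.
  by rewrite leNgt; apply/negP => h; nra.
by rewrite leNgt; apply/negP => h; nra.
Qed.

Lemma alpha_le k : alpha k <= k%:R / (2 * Lt).
Proof.
rewrite ler_pdivlMr ?mulr_gt0// mulrC; elim: k => [|k ih].
  by case: hc => -> _ _; rewrite mulr0.
by have /andP[_ h] := alpha_increment k; rewrite -natr1; lra.
Qed.

Lemma alpha_ge k : k%:R / (4 * Lt) <= alpha k.
Proof.
rewrite ler_pdivrMr ?mulr_gt0// mulrC; elim: k => [|k ih].
  by case: hc => -> _ _; rewrite mulr0.
by have /andP[h _] := alpha_increment k; rewrite -natr1; lra.
Qed.

Lemma Acc_ge N : N%:R ^+ 2 / (8 * Lt) <= Acc N.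
Proof.
rewrite Acc_alpha.
apply: (@le_trans _ _ (2 * Lt * (N%:R / (4 * Lt)) ^+ 2)).
  by rewrite le_eqVlt; apply/orP; left; apply/eqP; field; rewrite gt_eqF.
rewrite ler_pM2l ?mulr_gt0// ler_sqr ?nnegrE ?alpha_ge0 ?alpha_ge//.
by rewrite divr_ge0// mulr_ge0// ltW.
Qed.

Lemma Acc_le N : 4 * Lt * Acc N <= N%:R * N.+1%:R.
Proof.
elim: N => [|N ih]; first by case: hc => _ -> _; rewrite mulr0 mul0r.
have := alpha_le N.+1; rewrite ler_pdivlMr ?mulr_gt0// => h.
rewrite AccS -!natr1 in h ih *; lra.
Qed.

End StepSizes.

(** One step of the method of similar triangles with an inexact gradient [G + e],
    the inexactness being charged to the point [z] known before the step. *)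
Lemma similar_triangles_step (R : realType) (n : nat) (psi : 'cV[R]_n -> R)
    (L a A0 A1 : R) (y z yt z' y' G e u : 'cV[R]_n) :
  0 <= A0 -> 0 < A1 -> A1 = A0 + a -> A1 = 4 * L * a ^+ 2 ->
  yt = A1^-1 *: (A0 *: y + a *: z) -> z' = z - a *: (G + e) ->
  y' = A1^-1 *: (A0 *: y + a *: z') ->
  psi yt + dot G (y - yt) <= psi y ->
  psi y' <= psi yt + dot G (y' - yt) + L / 2 * dot (y' - yt) (y' - yt) ->
  A1 * psi y' + dot (z' - u) (z' - u) / 2 <=
    A0 * psi y + a * (psi yt + dot G (u - yt)) + dot (z - u) (z - u) / 2
    + (- (a * dot e (z - u)) + 2 / 3 * a ^+ 2 * dot e e).
Proof.
move=> A00 A10 A1E A1L ytE z'E y'E low up.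
pose d := - a *: (G + e); have dE : z' = z + d by rewrite z'E /d scaleNr.
have y'yt : y' - yt = (a / A1) *: d.
  rewrite y'E ytE -scalerBr dE [a / A1]mulrC -scalerA; congr (_ *: _).
  by clearbody d; apply/colP => i; rewrite !mxE; ring.
have cmb : A0 * dot G (y - yt) + a * dot G (z - yt) = 0.
  rewrite !dotBr; have : A1 * dot G yt = A0 * dot G y + a * dot G z.
    by rewrite ytE dotZr dotDr !dotZr mulrA mulfV ?gt_eqF// mul1r.
  by rewrite A1E; lra.
have {}low := ler_wpM2l A00 low.
have {}up := ler_wpM2l (ltW A10) up.
have quad : A1 * (L / 2 * dot (y' - yt) (y' - yt)) = dot d d / 8.
  have a0 : a != 0.
    by apply/eqP => a0; move: A10; rewrite A1L a0 expr0n mulr0 ltxx.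
  have L0 : L != 0.
    by apply/eqP => L0; move: A10; rewrite A1L L0 mulr0 mul0r ltxx.
  by rewrite y'yt dotZl dotZr A1L; field; rewrite a0.
have lin : A1 * dot G (y' - yt) = a * dot G d.
  by rewrite y'yt dotZr mulrA mulrCA mulfV ?gt_eqF// mulr1.
have sq := dot_ge0 (d + (4 / 3 * a) *: e).
have dz : dot d (z - u) = - (a * (dot G (z - u) + dot e (z - u))).
  by rewrite /d dotZl dotDl mulNr.
have dd : dot d d = - (a * (dot G d + dot e d)).
  by rewrite {1}/d dotZl dotDl mulNr.
rewrite dE (_ : z + d - u = (z - u) + d); last by rewrite addrAC.
have guz : dot G (u - yt) = dot G (z - yt) - dot G (z - u).
  by rewrite -dotBr; congr (dot _ _); apply/colP => i; rewrite !mxE; ring.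
rewrite guz; clearbody d; move: (z - u) dz => v dz.
rewrite (dotDl v d) (dotDr v v d) (dotDr d v d) (dotC v d) dz.
rewrite dotDl !dotDr (dotC d) !(dotZl, dotZr) (dotC e d) in sq.
rewrite (dotC e d) in dd.
have Apsi : A1 * psi yt = A0 * psi yt + a * psi yt by rewrite A1E mulrDl.
rewrite !mulrDr quad lin Apsi in up; rewrite mulrDr in low.
by lra.
Qed.

(** * The method along one sample path *)

Section Path.
Context {R : realType} {n : nat} {Xi : Type}.
Variables (A : 'M[R]_n) (xt : 'cV[R]_n -> Xi -> 'cV[R]_n).
Variables (alpha Acc : nat -> R) (r : nat -> nat) (s : nat -> nat -> Xi).

Definition path_yt (k : nat) : 'cV[R]_n := (spdstm A xt alpha Acc r s k).1.1.
Definition path_z (k : nat) : 'cV[R]_n := (spdstm A xt alpha Acc r s k).1.2.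
Definition path_y (k : nat) : 'cV[R]_n := (spdstm A xt alpha Acc r s k).2.
Definition path_x (k : nat) : 'cV[R]_n := batch_x A xt r s k (path_yt k).

Lemma path_ytS k :
  path_yt k.+1 = (Acc k.+1)^-1 *: (Acc k *: path_y k + alpha k.+1 *: path_z k).
Proof.
by rewrite /path_yt /path_y /path_z /=; case: (spdstm _ _ _ _ _ _ k) => [[? ?] ?].
Qed.

Lemma batch_gradE k y : batch_grad A xt r s k y = A *m batch_x A xt r s k y.
Proof. by rewrite /batch_grad /batch_x -scalemxAr mulmx_sumr. Qed.

Lemma path_zS k : path_z k.+1 = path_z k - alpha k.+1 *: (A *m path_x k.+1).
Proof.
rewrite /path_x -batch_gradE /path_yt /path_z /=.
by case: (spdstm _ _ _ _ _ _ k) => [[? ?] ?].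
Qed.

Lemma path_yS k :
  path_y k.+1 =
    (Acc k.+1)^-1 *: (Acc k *: path_y k + alpha k.+1 *: path_z k.+1).
Proof.
by rewrite /path_y /path_z /=; case: (spdstm _ _ _ _ _ _ k) => [[? ?] ?].
Qed.

Lemma path_z0 : path_z 0%N = 0. Proof. by []. Qed.
Lemma path_y0 : path_y 0%N = 0. Proof. by []. Qed.

Lemma spdstm_xE N : alpha 0%N = 0 ->
  spdstm_x A xt alpha Acc r s N =
    (Acc N)^-1 *: \sum_(k < N) alpha k.+1 *: path_x k.+1.
Proof.
by move=> a0; rewrite /spdstm_x big_ord_recl/= a0 scale0r add0r.
Qed.

End Path.

Section PathAnalysis.
Context {R : realType} {n : nat} {Xi : Type}.
Variables (A : 'M[R]_n) (f : 'cV[R]_n -> R) (mu lmax : R) (xs g ys : 'cV[R]_n).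
Variables (xt : 'cV[R]_n -> Xi -> 'cV[R]_n) (alpha Acc : nat -> R).
Variables (r : nat -> nat) (s : nat -> nat -> Xi).
Hypotheses (mu0 : 0 < mu) (lmax0 : 0 < lmax) (scf : strongly_convex mu f).
Hypotheses (fg : is_gradient f xs g) (hA : is_lambda_max (A^T *m A) lmax).
Hypotheses (hxs : is_primal_solution A f xs).
Hypotheses (hys : is_min_norm_dual_solution A f ys).

Let Lt : R := 2 * (lmax / mu).
Hypothesis (hc : spdstm_coefs Lt alpha Acc).

Let Lt0 : 0 < Lt. Proof. by rewrite mulr_gt0// divr_gt0. Qed.

Let yt := path_yt A xt alpha Acc r s.
Let z := path_z A xt alpha Acc r s.
Let y := path_y A xt alpha Acc r s.
Let xo := path_x A xt alpha Acc r s.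

Definition exact_point (k : nat) : 'cV[R]_n :=
  dual_argmax f (A^T *m path_yt A xt alpha Acc r s k).
Let x := exact_point.

Definition x_error (k : nat) : 'cV[R]_n :=
  path_x A xt alpha Acc r s k - exact_point k.
Let nu := x_error.
Let e k := A *m x_error k.

(** The error terms of the estimate for [enorm (z m - ys) ^+ 2] that is obtained
    from [similar_triangles_step] at [u = ys]. *)
Definition distance_budget (m : nat) : R :=
  enorm ys ^+ 2 + \sum_(k < m)
    (- (2 * alpha k.+1 * dot (A *m x_error k.+1)
          (path_z A xt alpha Acc r s k - ys))
     + 4 / 3 * alpha k.+1 ^+ 2 * dot (A *m x_error k.+1) (A *m x_error k.+1)).
Let W := distance_budget.

Lemma estimating_sequence m u :
  Acc m * psi A f (y m) + dot (z m - u) (z m - u) / 2 <=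
    \sum_(k < m) alpha k.+1 *
      (psi A f (yt k.+1) + dot (A *m x k.+1) (u - yt k.+1))
    + dot u u / 2
    + \sum_(k < m) (- (alpha k.+1 * dot (e k.+1) (z k - u))
                    + 2 / 3 * alpha k.+1 ^+ 2 * dot (e k.+1) (e k.+1)).
Proof.
elim: m => [|m ih].
  rewrite !big_ord0; case: hc => _ -> _.
  by rewrite /z path_z0 sub0r dotNl dotNr opprK mul0r !add0r addr0.
rewrite !big_ord_recr/=.
have step := similar_triangles_step R n (psi A f) (lmax / mu) (alpha m.+1)
  (Acc m) (Acc m.+1) (y m) (z m) (yt m.+1) (z m.+1) (y m.+1)
  (A *m x m.+1) (e m.+1) u.
have {step} := step (Acc_ge0 _ _ _ hc _) (AccS_gt0 _ _ _ hc _) (AccS _ _ _ hc _).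
have h1 : Acc m.+1 = 4 * (lmax / mu) * alpha m.+1 ^+ 2.
  by rewrite (Acc_alpha _ _ _ hc) /Lt; ring.
have h2 : z m.+1 = z m - alpha m.+1 *: (A *m x m.+1 + e m.+1).
  by rewrite /e -mulmxDr /x_error [x _ + _]addrC subrK; exact: path_zS.
move=> /(_ h1 (path_ytS _ _ _ _ _ _ _) h2 (path_yS _ _ _ _ _ _ _)).
move=> /(_ (psi_subgradient A f mu xs g mu0 scf fg _ _)).
move=> /(_ (psi_smooth A f mu lmax xs g mu0 scf fg hA _ _)).
move: ih; lra.
Qed.

(** At [u = ys] the linearized dual values are at most the dual optimum, hence at
    most [psi A f (y m)], and cancel. *)
Lemma distance_le_budget m : dot (z m - ys) (z m - ys) <= W m.
Proof.
have := estimating_sequence m ys.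
have lin : \sum_(k < m) alpha k.+1 *
    (psi A f (yt k.+1) + dot (A *m x k.+1) (ys - yt k.+1)) <= Acc m * psi A f (y m).
  rewrite (Acc_sum _ _ _ hc) mulr_suml; apply: ler_sum => k _.
  apply: ler_wpM2l; first exact: (alpha_ge0 _ _ _ hc).
  apply: le_trans (psi_subgradient A f mu xs g mu0 scf fg _ _) _.
  by case: hys => + _; apply.
have -> : W m = dot ys ys + 2 * \sum_(k < m)
    (- (alpha k.+1 * dot (e k.+1) (z k - ys))
     + 2 / 3 * alpha k.+1 ^+ 2 * dot (e k.+1) (e k.+1)).
  rewrite /W /distance_budget enorm_sq mulr_sumr; congr (_ + _).
  by apply: eq_bigr => k _; rewrite /e /z; ring.
by lra.
Qed.

(** Minimizing the upper bound of [estimating_sequence] over the ball of radius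
    [2 * Ry] produces the norm of the constraint violation. *)
Lemma duality_gap_bound N Ry xbar xN : (0 < N)%N -> 0 <= Ry ->
  xbar = (Acc N)^-1 *: \sum_(k < N) alpha k.+1 *: x k.+1 ->
  xN = spdstm_x A xt alpha Acc r s N ->
  Acc N * (psi A f (y N) + f xbar + 2 * Ry * enorm (A *m xN)) <=
    2 * Ry ^+ 2 + (W N - enorm ys ^+ 2) / 2
    - dot (A *m \sum_(k < N) alpha k.+1 *: nu k.+1) ys.
Proof.
move=> N0 Ry0 xbarE xNE'; have a0 : alpha 0%N = 0 by case: hc.
have AN : 0 < Acc N by case: N N0 {xbarE xNE'} => // N _; exact: (AccS_gt0 _ _ _ hc).
pose u : 'cV[R]_n := - (2 * Ry / enorm (A *m xN)) *: (A *m xN).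
have uN : dot (A *m xN) u = - (2 * Ry * enorm (A *m xN)).
  rewrite /u dotZr -enorm_sq; have [->|e0] := eqVneq (enorm (A *m xN)) 0.
    by rewrite expr0n !mulr0 oppr0.
  by rewrite expr2 mulNr mulrA divfK.
have uu : dot u u <= 4 * Ry ^+ 2.
  rewrite /u dotZl dotZr -enorm_sq; have [->|e0] := eqVneq (enorm (A *m xN)) 0.
    by rewrite expr0n !mulr0 mulr_ge0 ?sqr_ge0.
  by rewrite le_eqVlt; apply/orP; left; apply/eqP; field.
have := estimating_sequence N u.
have -> : \sum_(k < N) alpha k.+1 *
      (psi A f (yt k.+1) + dot (A *m x k.+1) (u - yt k.+1)) =
    - (\sum_(k < N) alpha k.+1 * f (x k.+1))
    + dot (A *m \sum_(k < N) alpha k.+1 *: x k.+1) u.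
  rewrite mulmx_sumr dot_suml -sumrN -big_split/=; apply: eq_bigr => k _.
  rewrite -scalemxAr dotZl dotBr (psiE A f mu xs g mu0 scf fg).
  by rewrite (dotC (yt _)) /x /exact_point -/(yt k.+1); ring.
have -> : \sum_(k < N) (- (alpha k.+1 * dot (e k.+1) (z k - u))
      + 2 / 3 * alpha k.+1 ^+ 2 * dot (e k.+1) (e k.+1)) =
    (W N - enorm ys ^+ 2) / 2 + dot (A *m \sum_(k < N) alpha k.+1 *: nu k.+1) u
    - dot (A *m \sum_(k < N) alpha k.+1 *: nu k.+1) ys.
  rewrite /W /distance_budget [enorm ys ^+ 2 + _]addrC addrK mulr_suml mulmx_sumr.
  rewrite !dot_suml -addrA -sumrB -big_split/=; apply: eq_bigr => k _.
  rewrite -scalemxAr !dotZl /e /nu /z !dotBr.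
  by field.
have jen : Acc N * f xbar <= \sum_(k < N) alpha k.+1 * f (x k.+1).
  rewrite -ler_pdivlMl// xbarE (Acc_sum _ _ _ hc).
  case: N N0 {xbarE xNE' u uN uu AN} => // N _.
  have [j [t Et]] : exists j t, index_enum 'I_N.+1 = j :: t.
    by have := mem_index_enum (@ord0 N); case: (index_enum _) => // j t _; exists j, t.
  rewrite Et; apply: convex_jensen => [|k]; first exact: (convex_f f mu).
  exact: (alphaS_gt0 _ _ _ hc).
have xNE : dot (A *m \sum_(k < N) alpha k.+1 *: x k.+1) u +
    dot (A *m \sum_(k < N) alpha k.+1 *: nu k.+1) u = Acc N * dot (A *m xN) u.
  rewrite -dotDl -mulmxDr -big_split/= xNE' spdstm_xE// -dotZl scalemxAr scalerA.
  rewrite mulfV ?gt_eqF// scale1r; congr (dot (A *m _) _); apply: eq_bigr => k _.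
  by rewrite -scalerDr /nu /x_error addrC subrK.
have zz := dot_ge0 (z N - u).
rewrite uN in xNE; move=> h.
rewrite !mulrDr; move: xNE; rewrite mulrN; move: h jen uu zz; lra.
Qed.

(** The points of the method are convex combinations of the [z k]. *)
Lemma path_y_ball (c : R) m : (forall k, (k <= m)%N -> enorm (z k - ys) <= c) ->
  forall k, (k < m)%N -> enorm (yt k.+1 - ys) <= c.
Proof.
move=> hz.
have comb k (a b : 'cV[R]_n) : enorm (a - ys) <= c -> enorm (b - ys) <= c ->
    enorm ((Acc k.+1)^-1 *: (Acc k *: a + alpha k.+1 *: b) - ys) <= c.
  move=> ac bc; have A0 := AccS_gt0 _ _ _ hc k.
  have -> : (Acc k.+1)^-1 *: (Acc k *: a + alpha k.+1 *: b) - ys =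
      (Acc k.+1)^-1 *: (Acc k *: (a - ys) + alpha k.+1 *: (b - ys)).
    apply/colP => i; rewrite !mxE; move: A0; rewrite (AccS _ _ _ hc) => A0.
    by field; rewrite gt_eqF.
  rewrite enormZ gtr0_norm ?invr_gt0// ler_pdivrMl//.
  apply: le_trans (enormD _ _) _; rewrite !enormZ.
  rewrite !ger0_norm ?(Acc_ge0 _ _ _ hc) ?(alpha_ge0 _ _ _ hc)//.
  rewrite (AccS _ _ _ hc) mulrDl; apply: lerD; apply: ler_wpM2l => //.
    exact: (Acc_ge0 _ _ _ hc).
  exact: (alpha_ge0 _ _ _ hc).
have hy k : (k <= m)%N -> enorm (y k - ys) <= c.
  elim: k => [|k ih] km; first by rewrite /y path_y0; exact: hz 0%N km.
  by rewrite /y path_yS; apply: comb; [exact: ih (ltnW km)|exact: hz].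
move=> k km; rewrite /yt path_ytS; apply: comb; first exact: hy (ltnW km).
exact: hz (ltnW km).
Qed.

(** Weak duality bounds the duality gap below by [- (Ry * enorm (A *m xN))], so that
    the bound on the gap plus twice [Ry * enorm (A *m xN)] controls both. The
    Lipschitz constant transfers the value of [f] from the exact average to the
    noisy one, and all these points stay in the ball of radius [R_f] because
    the [z k] stay near [ys]. *)
Lemma accuracy_of_small_errors N Ry eps kl L_f R_f :
  (0 < N)%N -> 0 < Ry -> 1 <= kl -> enorm ys <= Ry ->
  L_f <= kl * (Num.sqrt lmax * Ry) ->
  4 * Num.max (Ry / (Acc N * Num.sqrt lmax))
        (Num.max (Num.sqrt lmax * Ry / mu) (enorm xs)) <= R_f ->
  lipschitz_on_ball L_f R_f f ->
  11 / 2 * Ry ^+ 2 <= Acc N * eps ->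
  (forall k, (k <= N)%N -> W k <= 4 * enorm ys ^+ 2) ->
  Num.sqrt lmax * enorm (\sum_(k < N) alpha k.+1 *: nu k.+1) <= enorm ys / kl ->
  let xN := spdstm_x A xt alpha Acc r s N in
  let yN := spdstm_y A xt alpha Acc r s N in
  [/\ f xN - f xs <= f xN + psi A f yN, f xN + psi A f yN <= eps
    & enorm (A *m xN) <= eps / Ry].
Proof.
move=> N0 Ry0 kl1 ysRy Lf hRf lipf hN hW hS xN yN.
have a0 : alpha 0%N = 0 by case: hc.
have AN : 0 < Acc N by case: N N0 {xN yN hRf hN hW hS} => // N _; exact: (AccS_gt0 _ _ _ hc).
set sl := Num.sqrt lmax in Lf hRf hS.
have sl0 : 0 < sl by rewrite sqrtr_gt0.
set S := \sum_(k < N) _ in hS.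
have R00 := enorm_ge0 ys.
have kl0 : 0 < kl by apply: lt_le_trans kl1.
have hS1 : sl * enorm S <= enorm ys.
  by apply: le_trans hS _; rewrite ler_pdivrMr// ler_peMr.
pose xbar := (Acc N)^-1 *: \sum_(k < N) alpha k.+1 *: x k.+1.
have xNbar : xN - xbar = (Acc N)^-1 *: S.
  rewrite /xN spdstm_xE// -scalerBr -sumrB; congr (_ *: _).
  by apply: eq_bigr => k _; rewrite -scalerBr.
have hz k : (k <= N)%N -> enorm (z k - ys) <= 2 * enorm ys.
  move=> kN; apply: enorm_le; first by rewrite mulr_ge0.
  by apply: le_trans (distance_le_budget k) _; have := hW k kN; lra.
set M := Num.max _ _ in hRf.
have M1 : Ry / (Acc N * sl) <= M by rewrite le_max lexx.
have M2 : sl * Ry / mu <= M by rewrite !le_max lexx !orbT.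
have M3 : enorm xs <= M by rewrite !le_max lexx !orbT.
have xk k : (k < N)%N -> enorm (x k.+1) <= 3 * M.
  move=> kN; have := enormD (x k.+1 - xs) xs; rewrite subrK => /le_trans; apply.
  suff : enorm (x k.+1 - xs) <= 2 * M by lra.
  apply: le_trans (_ : 2 * (sl * Ry / mu) <= _); last by rewrite ler_pM2l.
  rewrite mulrA ler_pdivlMr// mulrC.
  rewrite -(dual_argmax_solution A f mu xs ys g mu0 scf fg hxs hys).
  apply: le_trans (x_of_lipschitz f mu xs g mu0 scf fg _ _) _.
  rewrite -mulmxBr; apply: enorm_le; first by rewrite !mulr_ge0 ?ltW.
  apply: le_trans (lambda_max_boundT _ _ _ hA) _.
  have hy := path_y_ball _ _ hz _ kN.
  rewrite mulrCA exprMn sqr_sqrtr ?(ltW lmax0)// ler_pM2l//.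
  rewrite -enorm_sq ler_sqr ?nnegrE ?enorm_ge0 ?mulr_ge0 ?(ltW Ry0)//.
  by apply: le_trans hy _; rewrite ler_pM2l.
have M0 : 0 <= M by apply: le_trans M3; exact: enorm_ge0.
have xbarM : enorm xbar <= 3 * M.
  rewrite enormZ gtr0_norm ?invr_gt0// ler_pdivrMl//.
  apply: le_trans (enorm_sum _ _ _) _; rewrite (Acc_sum _ _ _ hc) mulr_suml.
  apply: ler_sum => k _; rewrite enormZ ger0_norm ?(alpha_ge0 _ _ _ hc)//.
  by apply: ler_wpM2l; [exact: (alpha_ge0 _ _ _ hc)|exact: xk].
have dS : enorm (xN - xbar) = enorm S / Acc N.
  by rewrite xNbar enormZ gtr0_norm ?invr_gt0// mulrC.
have dM : enorm (xN - xbar) <= M.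
  apply: le_trans M1; rewrite dS [X in _ <= X](_ : _ = Ry / sl / Acc N); last first.
    by field; rewrite !gt_eqF.
  by rewrite ler_pM2r ?invr_gt0// ler_pdivlMr// mulrC; exact: le_trans hS1 _.
have xNM : enorm xN <= 4 * M.
  have := enormD (xN - xbar) xbar; rewrite subrK => /le_trans; apply; lra.
have lip : Acc N * (f xN - f xbar) <= Ry ^+ 2.
  have h : f xN - f xbar <= L_f * (enorm S / Acc N).
    rewrite -dS; apply: le_trans (ler_norm _) _; apply: lipf.
      exact: le_trans xNM hRf.
    by apply: le_trans hRf; apply: le_trans xbarM _; rewrite ler_wpM2r//; lra.
  have S0 := enorm_ge0 S.
  rewrite mulrC -ler_pdivlMr//; apply: le_trans h _.
  rewrite mulrA ler_pM2r ?invr_gt0//.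
  apply: le_trans (ler_wpM2r S0 Lf) _.
  rewrite ler_pdivlMr// in hS.
  have := ler_wpM2l (ltW Ry0) hS; have := ler_wpM2l (ltW Ry0) ysRy.
  rewrite expr2; lra.
have gap := duality_gap_bound N Ry xbar xN N0 (ltW Ry0) erefl erefl.
have hWN := hW N (leqnn N).
have cross : - dot (A *m S) ys <= enorm ys ^+ 2.
  rewrite -dotNl; apply: le_trans (cauchy_schwarz _ _) _.
  rewrite enormN expr2 ler_wpM2r//; apply: le_trans hS1.
  apply: enorm_le; first by rewrite (mulr_ge0 (ltW sl0) (enorm_ge0 _)).
  by rewrite exprMn sqr_sqrtr ?(ltW lmax0)// enorm_sq; exact: lambda_max_bound.
have ys2 : enorm ys ^+ 2 <= Ry ^+ 2.
  by rewrite ler_sqr// nnegrE (ltW Ry0).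
have total : f xN + psi A f yN + 2 * Ry * enorm (A *m xN) <= eps.
  rewrite -(ler_pM2l AN); apply: le_trans hN.
  rewrite -/S -/(path_y A xt alpha Acc r s N) in gap.
  rewrite -[psi A f yN]/(psi A f (y N)).
  by rewrite !mulrDr in gap *; rewrite mulrBr in lip; lra.
have Ax0 := enorm_ge0 (A *m xN).
have RA : 0 <= Ry * enorm (A *m xN) := mulr_ge0 (ltW Ry0) Ax0.
have lowgap : - (Ry * enorm (A *m xN)) <= f xN + psi A f yN.
  have h1 := psi_ge A f mu xs g mu0 scf fg ys xN.
  have h2 : psi A f ys <= psi A f yN by case: hys => + _; apply.
  have h3 := cauchy_schwarz (- ys) (A *m xN); rewrite dotNl enormN in h3.
  have h4 := ler_wpM2r Ax0 ysRy.
  by lra.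
split.
- by rewrite lerD2l; exact: (psi_ge_primal A f mu xs g mu0 scf fg hxs).
- by lra.
- by rewrite ler_pdivlMr// mulrC; lra.
Qed.

End PathAnalysis.

(** * Independence of a fresh sample from the past *)

Section IndependentIntegral.
Local Open Scope ereal_scope.
Context {d d1 d2 : measure_display} {Omega : measurableType d}
  {T1 : measurableType d1} {T2 : measurableType d2} {R : realType}.
Variables (P : probability Omega R) (D : probability T2 R).
Variables (X : Omega -> T1) (Y : Omega -> T2).
Hypotheses (mX : measurable_fun setT X) (mY : measurable_fun setT Y).
Hypothesis XY : forall B C, measurable B -> measurable C ->
  P (X @^-1` B `&` Y @^-1` C) = P (X @^-1` B) * D C.

(** The joint law of [X] and [Y] is the product of the law of [X] with [D], and
    Tonelli's theorem integrates [Y] out first. *)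
Lemma independent_integral (Phi : T1 * T2 -> \bar R) :
  measurable_fun setT Phi -> (forall p, 0 <= Phi p) ->
  \int[P]_w Phi (X w, Y w) = \int[P]_w \int[D]_y Phi (X w, y).
Proof.
move=> mPhi Phi0.
have mXY : measurable_fun setT (fun w => (X w, Y w)) by exact: measurable_fun_pair.
pose Xm : {mfun Omega >-> T1} := HB.pack X (isMeasurableFun.Build _ _ _ _ X mX).
pose XYm : {mfun Omega >-> (T1 * T2)%type} :=
  HB.pack (fun w => (X w, Y w)) (isMeasurableFun.Build _ _ _ _ _ mXY).
have prodE S : measurable S -> (distribution P Xm \x D) S = distribution P XYm S.
  apply: product_measure_unique => B C mB mC /=.
  by rewrite /distribution/= /pushforward -XY//.
transitivity (\int[distribution P XYm]_p Phi p).
  by rewrite ge0_integral_distribution.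
rewrite (eq_measure_integral (distribution P Xm \x D)); last first.
  by move=> S mS _; exact/esym/prodE.
rewrite fubini_tonelli1// ge0_integral_distribution//.
  exact: measurable_fun_fubini_tonelli_F.
by move=> t; exact: integral_ge0.
Qed.

End IndependentIntegral.

Section SampleFiltration.
Local Open Scope ereal_scope.
Context {R : realType} {d d' : measure_display} {Omega : measurableType d'}
  {Xi : measurableType d}.
Variables (P : probability Omega R) (D : probability Xi R).
Variables (used : pred (nat * nat)) (xi : nat -> nat -> Omega -> Xi).
Hypothesis iid : iid_samples P D used xi.
Implicit Types (U V : pred (nat * nat)) (j : nat * nat).

Definition sample_event (J : seq (nat * nat)) (B : nat * nat -> set Xi) :
    set Omega := [set w | forall j, j \in J -> B j (xi j.1 j.2 w)].

(** The events decided by finitely many samples indexed in [U]; they are stable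
    under intersection and generate the history of these samples. *)
Definition sample_events U : set (set Omega) := [set E | exists J B,
  [/\ uniq J, all U J, forall j, measurable (B j) & E = sample_event J B]].

Definition history U : Type := g_sigma_algebraType (sample_events U).

Lemma measurable_sample j : used j -> measurable_fun setT (xi j.1 j.2).
Proof. by case: iid => + _; apply. Qed.

Lemma sample_event_cons i J B :
  sample_event (i :: J) B = xi i.1 i.2 @^-1` (B i) `&` sample_event J B.
Proof.
apply/seteqP; split => [w h|w [h1 h2] j].
  by split=> [|j jJ]; apply: h; rewrite inE ?eqxx ?jJ ?orbT.
by rewrite inE => /predU1P[->|]; [exact: h1|exact: h2].
Qed.

Lemma sample_events_measurable U : {subset U <= used} ->
  sample_events U `<=` measurable.
Proof.
move=> Uu _ [J [B [_ UJ mB ->]]]; elim: J UJ => [_|i J ih /= /andP[Ui UJ]].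
  rewrite (_ : sample_event _ _ = setT) ?measurableT//.
  by apply/seteqP; split.
rewrite sample_event_cons; apply: measurableI; last exact: ih.
by rewrite -[X in measurable X]setTI; apply: measurable_sample => //; exact: Uu.
Qed.

Lemma sample_events_setI U : setI_closed (sample_events U).
Proof.
move=> _ _ [J [B [uJ UJ mB ->]]] [K [C [uK UK mC ->]]].
exists (undup (J ++ K)), (fun j => (if j \in J then B j else setT) `&`
  (if j \in K then C j else setT)); split => [||j|].
- exact: undup_uniq.
- by apply/allP => j; rewrite mem_undup mem_cat => /orP[/(allP UJ)|/(allP UK)].
- by apply: measurableI; case: ifP.
- apply/seteqP; split => [w [hJ hK] j _|w h].
    by split; case: ifPn => // jm; [exact: hJ|exact: hK].
  split=> j jm; have := h j; rewrite mem_undup mem_cat jm ?orbT => /(_ isT)[].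
    by [].
  by [].
Qed.

Lemma sample_events_setT U : sample_events U setT.
Proof.
exists [::], (fun=> setT); split => //.
by apply/seteqP; split.
Qed.

Lemma measurable_history U (E : set Omega) : {subset U <= used} ->
  <<s sample_events U >> E -> measurable E.
Proof.
move=> Uu; apply: smallest_sub; first exact: sigma_algebra_measurable.
exact: sample_events_measurable.
Qed.

Lemma measurable_history_id U : {subset U <= used} ->
  measurable_fun setT (id : Omega -> history U).
Proof. by move=> Uu _ E mE; rewrite setTI; exact: (measurable_history U). Qed.

Lemma measurable_from_history U d1 (T : measurableType d1) (X : history U -> T) :
  {subset U <= used} -> measurable_fun setT X ->
  measurable_fun setT (X : Omega -> T).
Proof. by move=> Uu mX; apply: (measurableT_comp mX); exact: measurable_history_id. Qed.

Lemma measurable_history_mono U V d1 (T : measurableType d1) (X : Omega -> T) :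
  {subset U <= V} -> measurable_fun setT (X : history U -> T) ->
  measurable_fun setT (X : history V -> T).
Proof.
move=> UV mX _ E mE; have := mX measurableT E mE.
apply: sub_sigma_algebra2 => _ [J [B [uJ UJ mB ->]]].
exists J, B; split => //; apply/allP => j /(allP UJ); exact: UV.
Qed.

Lemma measurable_history_sample U j : U j ->
  measurable_fun setT (xi j.1 j.2 : history U -> Xi).
Proof.
move=> Uj _ B mB; rewrite setTI; apply: sub_sigma_algebra.
exists [:: j], (fun=> B); split => //=; first by rewrite Uj.
by rewrite sample_event_cons; apply/seteqP; split => [w h|w []].
Qed.

(** As functions of [B] both sides are finite measures, and they agree on the
    sample events, which are a generating pi-system. *)
Lemma history_independent U j B C : {subset U <= used} -> used j -> ~~ U j ->
  <<s sample_events U >> B -> measurable C ->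
  P (B `&` xi j.1 j.2 @^-1` C) = P B * D C.
Proof.
move=> Uu uj Uj sB mC.
have mjC : measurable (xi j.1 j.2 @^-1` C).
  by rewrite -[X in measurable X]setTI; exact: measurable_sample.
have DC0 : (0 <= fine (D C))%R by rewrite fine_ge0// measure_ge0.
have DCE : D C = (fine (D C))%:E by rewrite fineK// fin_num_measure.
pose m1 : {measure set Omega -> \bar R} := mrestr P mjC.
pose m2 : {measure set Omega -> \bar R} := mscale (NngNum DC0) P.
suff : m1 B = m2 B.
  by rewrite /m1 /m2 /= /mrestr /mscale /= -DCE muleC.
apply: (g_sigma_algebra_measure_unique (sample_events U)
  (sample_events_measurable U Uu) (fun=> setT)) => //.
- by move=> _; exact: sample_events_setT.
- by apply/seteqP; split => // w _; exists 0%N.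
- exact: sample_events_setI.
- move=> _ [J [B' [uJ UJ mB' ->]]]; rewrite /m1 /m2 /= /mrestr /mscale /= -DCE.
  case: iid => _ iidP.
  have jJ : j \notin J by apply: contra Uj => /(allP UJ).
  have usedJ : all used J by apply/allP => i /(allP UJ); exact: Uu.
  pose B2 i := if i == j then C else B' i.
  have mB2 i : measurable (B2 i) by rewrite /B2; case: ifP.
  have B2J : sample_event J B2 = sample_event J B'.
    apply/seteqP; split => w h i iJ; have := h i iJ; rewrite /B2;
      case: eqP => // ij; by rewrite -ij iJ in jJ.
  have := iidP (j :: J) B2; rewrite /= jJ uj uJ usedJ => /(_ isT isT mB2).
  rewrite -/(sample_event (j :: J) B2) sample_event_cons big_cons B2J.
  rewrite /B2 eqxx setIC => ->; congr (_ * _).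
  rewrite (iidP J B')//; apply: eq_big_seq => i iJ.
  by case: eqP => // ij; rewrite -ij iJ in jJ.
- move=> k; rewrite /m1 /= /mrestr setTI.
  by rewrite (le_lt_trans (probability_le1 P mjC))// ltry.
Qed.

Lemma sample_integral U j (Phi : history U * Xi -> \bar R) :
  {subset U <= used} -> used j -> ~~ U j ->
  measurable_fun setT Phi -> (forall p, 0 <= Phi p) ->
  \int[P]_w Phi (w, xi j.1 j.2 w) = \int[P]_w \int[D]_y Phi (w, y).
Proof.
move=> Uu uj Uj mPhi Phi0.
apply: (independent_integral P D (id : Omega -> history U) (xi j.1 j.2)) => //.
- exact: measurable_history_id.
- exact: measurable_sample.
- by move=> B C mB mC; exact: (history_independent U).
Qed.

End SampleFiltration.

(** * Measurability of random vectors *)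

Section VectorMeasurability.
Context {R : realType} {n : nat} {d : measure_display} {T : measurableType d}.
Implicit Types (F G : T -> 'cV[R]_n) (f g : T -> R).

Definition measurable_coords F : Prop :=
  forall i, measurable_fun setT (fun t => F t i 0).

(** The open sets are countable unions of boxes with rational centres. *)
Lemma measurable_coords_borel F : measurable_coords F ->
  measurable_fun setT (F : T -> borel_cV R n).
Proof.
move=> mF.
apply: (@measurability _ _ T (borel_cV R n) setT F (@open 'cV[R]_n)) => // _ [U oU <-].
rewrite setTI.
pose box (p : 'cV[rat]_n * nat) : set 'cV[R]_n :=
  [set x | forall i, `|x i 0 - ratr (p.1 i 0)| < p.2.+1%:R^-1].
pose B p := if `[< box p `<=` U >] then box p else set0.
have -> : F @^-1` U = \bigcup_p F @^-1` (B p).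
  apply/seteqP; split => [t /= Ut|t [p _]]; last first.
    by rewrite /= /B; case: asboolP => // pU /pU.
  have [e e0 eU] : exists2 e, 0 < e & ball (F t) e `<=` U.
    exact/nbhs_ballP/oU.
  have [k ke] : exists k : nat, 2 * k.+1%:R^-1 < e.
    have /cvgrPdist_lt /(_ (e / 2)) := @cvg_harmonic R.
    rewrite divr_gt0// => /(_ isT)[k _ /(_ k (leqnn _))] /=.
    rewrite sub0r normrN /harmonic gtr0_norm// ltr_pdivlMr// mulrC.
    by exists k.
  have k0 : 0 < k.+1%:R^-1 :> R by rewrite invr_gt0.
  have q i : {q : rat | `|F t i 0 - ratr q| < k.+1%:R^-1}.
    apply: cid; have := @dense_rat R (ball (F t i 0) k.+1%:R^-1).
    case=> [||x [+ [q _ qx]]]; last by rewrite -qx; exists q.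
      by exists (F t i 0); exact: ballxx.
    exact: ball_open.
  exists (\col_i sval (q i), k) => //; rewrite /B/=.
  have tb : box (\col_i sval (q i), k) (F t).
    by move=> i; rewrite /= mxE; case: (q i).
  case: asboolP => // -[] x bx; apply: eU; split => // i j; rewrite ord1.
  rewrite /ball/=; apply: le_lt_trans ke; rewrite mulr_natl mulr2n.
  apply: le_trans (ler_distD (ratr (sval (q i))) _ _) _.
  apply: lerD; first by case: (q i) => a /= /ltW.
  by have := bx i; rewrite /= mxE distrC => /ltW.
apply: countable_bigcupT_measurable; first exact: countableP.
move=> p; rewrite /B; case: asboolP => _; last by rewrite preimage_set0.
have -> : F @^-1` box p =
    \bigcap_(i in setT) [set t | `|F t i 0 - ratr (p.1 i 0)| < p.2.+1%:R^-1].
  by apply/seteqP; split => t /= h i; [move=> _|]; exact: h.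
apply: fin_bigcap_measurable => // i _.
have mlt : measurable_fun setT
    (fun t => `|F t i 0 - ratr (p.1 i 0)| < p.2.+1%:R^-1 :> R).
  apply: measurable_fun_ltr => //.
  by apply: measurableT_comp => //; exact: measurable_funB.
by have := mlt measurableT [set true] I; rewrite setTI.
Qed.

Lemma measurable_coords_cst (c : 'cV[R]_n) : measurable_coords (fun=> c).
Proof. by move=> i; exact: measurable_cst. Qed.

Lemma measurable_coordsD F G : measurable_coords F -> measurable_coords G ->
  measurable_coords (fun t => F t + G t).
Proof.
by move=> mF mG i; under eq_fun do rewrite mxE; exact: measurable_funD.
Qed.

Lemma measurable_coordsZ f F : measurable_fun setT f -> measurable_coords F ->
  measurable_coords (fun t => f t *: F t).
Proof.
by move=> mf mF i; under eq_fun do rewrite mxE; exact: measurable_funM.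
Qed.

Lemma measurable_coordsB F G : measurable_coords F -> measurable_coords G ->
  measurable_coords (fun t => F t - G t).
Proof.
by move=> mF mG i; under eq_fun do rewrite !mxE; exact: measurable_funB.
Qed.

Lemma measurable_coords_sum (I : Type) (s : seq I) (H : I -> T -> 'cV[R]_n) :
  (forall i, measurable_coords (H i)) ->
  measurable_coords (fun t => \sum_(i <- s) H i t).
Proof.
move=> mH j; under eq_fun do rewrite summxE.
by apply: measurable_sum => i; exact: mH.
Qed.

Lemma measurable_dot F G : measurable_coords F -> measurable_coords G ->
  measurable_fun setT (fun t => dot (F t) (G t)).
Proof. by move=> mF mG; apply: measurable_sum => i; exact: measurable_funM. Qed.

Lemma measurable_coordsMl (A : 'M[R]_n) F : measurable_coords F ->
  measurable_coords (fun t => A *m F t).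
Proof.
move=> mF i; under eq_fun do rewrite mxE.
by apply: measurable_sum => j; exact: measurable_funM.
Qed.

Lemma measurable_continuous_comp (h : 'cV[R]_n -> R) F : continuous h ->
  measurable_coords F -> measurable_fun setT (fun t => h (F t)).
Proof.
move=> ch mF; have mh : measurable_fun setT (h : borel_cV R n -> R).
  apply: (measurability _ (RGenOpens.measurableE R)) => _ [_ [a [b ->] <-]].
  rewrite setTI; apply: sub_sigma_algebra.
  by move/continuousP : ch; apply; exact: interval_open.
exact: (measurableT_comp mh (measurable_coords_borel F mF)).
Qed.

End VectorMeasurability.

(** * Exponential moments of light-tailed vectors *)

Section ScalarExponentials.
Context {R : realType}.
Implicit Types (x u t : R).

Lemma expR_le_addr x : expR x <= x + expR (2 * x ^+ 2).
Proof.
have lo := expR_ge1Dx (2 * x ^+ 2); have x2 := sqr_ge0 x.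
have [xs|xs] := ltP (1 / 2) x.
  apply: le_trans (_ : expR (2 * x ^+ 2) <= _); last by lra.
  by rewrite ler_expR expr2; nra.
have y0 : 0 < 1 - x by lra.
have inv : expR x <= (1 - x)^-1.
  rewrite -[x in leLHS]opprK expRN lef_pV2 ?posrE ?expR_gt0//.
  exact: expR_ge1Dx.
have [xm|xm] := ltP x (- (1 / 2)).
  apply: (@le_trans _ _ 1); first by rewrite -expR0 ler_expR; lra.
  by rewrite expr2 in lo *; nra.
apply: le_trans inv _; rewrite -(ler_pM2r y0) mulVf ?gt_eqF//.
by rewrite expr2 in lo *; nra.
Qed.

(** Weighted sum of the tangent inequalities of [expR] at [t * u], evaluated at
    [u] and at [0]. *)
Lemma expR_convex t u : 0 <= t <= 1 -> expR (t * u) <= 1 - t + t * expR u.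
Proof.
move=> /andP[t0 t1]; set a := expR (t * u).
have a0 : 0 < a by exact: expR_gt0.
have h1 : a * (1 + (1 - t) * u) <= expR u.
  rewrite [X in _ <= expR X](_ : u = t * u + (1 - t) * u); last by ring.
  by rewrite expRD ler_pM2l// expR_ge1Dx.
have h2 : a * (1 - t * u) <= 1.
  rewrite -[leRHS](mulfV (lt0r_neq0 a0)) ler_pM2l// -expRN -mulNr.
  by rewrite (le_trans _ (expR_ge1Dx _))// mulNr.
have t1' : 0 <= 1 - t by lra.
have := ler_wpM2l t0 h1; have := ler_wpM2l t1' h2.
by rewrite !(mulrDl, mulrDr, mulrBl, mulrBr); lra.
Qed.

Lemma expR_half_add x u : expR (x + u) <= (expR (2 * x) + expR (2 * u)) / 2.
Proof.
have e2 v : expR (2 * v) = expR v * expR v by rewrite -expRD; congr expR; ring.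
rewrite !e2 expRD.
by have := sqr_ge0 (expR x - expR u); rewrite expr2; lra.
Qed.

End ScalarExponentials.

Section SubGaussian.
Local Open Scope ereal_scope.
Context {R : realType} {d : measure_display} {T : measurableType d}.
Variable D : probability T R.

(** [expR_convex] at [s x - 1]: the power [t] is concave. *)
Lemma expR_moment_interpolation (s : T -> R) (t : R) :
  measurable_fun setT s -> \int[D]_x (expR (s x))%:E <= (expR 1)%:E ->
  (0 <= t <= 1)%R -> \int[D]_x (expR (t * s x))%:E <= (expR t)%:E.
Proof.
move=> ms hs t01; have /andP[t0 t1] := t01.
have me : measurable_fun setT (fun x => (expR (s x))%:E).
  by apply/measurable_EFinP; exact: measurableT_comp.
pose c := (expR t * (t * expR (- 1)))%R; pose b := (expR t * (1 - t))%R.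
have c0 : (0 <= c)%R by rewrite !mulr_ge0 ?expR_ge0.
have b0 : (0 <= b)%R by rewrite mulr_ge0 ?expR_ge0 ?subr_ge0.
apply: (@le_trans _ _ (\int[D]_x (b%:E + c%:E * (expR (s x))%:E))).
  apply: ge0_le_integral => //.
  - by apply/measurable_EFinP; apply: measurableT_comp => //; exact: measurable_funM.
  - by apply: emeasurable_funD => //; exact: measurable_funeM.
  move=> x _; rewrite -EFinM -EFinD lee_fin /b /c.
  have := ler_wpM2l (expR_ge0 t) (expR_convex t (s x - 1) t01).
  rewrite -expRD (_ : t + t * (s x - 1) = t * s x)%R; last by ring.
  move=> h; apply: le_trans h _; rewrite expRD le_eqVlt; apply/orP; left.
  by apply/eqP; ring.
rewrite ge0_integralD//; last 2 first.
- by move=> x _; rewrite mule_ge0// lee_fin ?expR_ge0.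
- exact: measurable_funeM.
rewrite integral_cst//= probability_setT mule1 ge0_integralZl//.
apply: le_trans (leeD2l _ (lee_wpmul2l _ hs)) _; first by rewrite lee_fin.
rewrite -EFinM -EFinD lee_fin /b /c -mulrA -mulrA -expRD addNr expR0 mulr1.
by rewrite -mulrDr subrK mulr1.
Qed.

Context {n : nat}.
Variables (Z : T -> 'cV[R]_n) (sigma : R).
Hypotheses (sigma0 : (0 < sigma)%R) (mZ : measurable_coords Z).
Hypothesis Z_int : forall i, D.-integrable setT (fun x => (Z x i 0%R)%:E).
Hypothesis Z_mean : forall i, \int[D]_x (Z x i 0%R)%:E = 0.
Hypothesis Z_tail :
  \int[D]_x (expR (enorm (Z x) ^+ 2 / sigma ^+ 2))%:E <= (expR 1)%:E.

Let dotE v : (fun x => (dot v (Z x))%:E) =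
  (fun x => \sum_(i < n) (v i 0%R)%:E * (Z x i 0%R)%:E).
Proof.
by apply/funext => x; rewrite -sumEFin; apply: eq_bigr => i _; rewrite EFinM.
Qed.

Lemma dot_integrable v : D.-integrable setT (fun x => (dot v (Z x))%:E).
Proof.
rewrite dotE; apply: integrable_sum => // i _.
exact: integrableZl.
Qed.

Lemma dot_integral0 v : \int[D]_x (dot v (Z x))%:E = 0.
Proof.
rewrite (_ : (fun x => _) = (fun x => \sum_(i < n) (v i 0%R)%:E * (Z x i 0%R)%:E)).
  rewrite integral_sum// => [|i]; last exact: integrableZl.
  by apply: big1 => i _; rewrite integralZl// Z_mean mule0.
exact: dotE.
Qed.

Let mnorm : measurable_fun setT (fun x => enorm (Z x) ^+ 2 / sigma ^+ 2)%R.
Proof.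
under eq_fun do rewrite enorm_sq.
by apply: measurable_funM => //; exact: measurable_dot.
Qed.

Lemma square_exp_moment q : (0 <= q * sigma ^+ 2 <= 1)%R ->
  \int[D]_x (expR (q * dot (Z x) (Z x)))%:E <= (expR (q * sigma ^+ 2))%:E.
Proof.
move=> hq; have := expR_moment_interpolation _ _ mnorm Z_tail hq.
apply: le_trans; rewrite le_eqVlt; apply/orP; left; apply/eqP.
apply: eq_integral => x _; rewrite enorm_sq; congr (expR _)%:E.
by field; rewrite gt_eqF.
Qed.

(** For small [v], [expR_le_addr] reduces the claim to the moment of the square
    since the linear term has mean zero; for large [v], the linear term is
    itself bounded by squares. *)
Lemma linear_exp_moment v :
  \int[D]_x (expR (dot v (Z x)))%:E <= (expR (2 * dot v v * sigma ^+ 2))%:E.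
Proof.
set t := (2 * dot v v * sigma ^+ 2)%R.
have s2 : (0 < sigma ^+ 2)%R by rewrite exprn_gt0.
have t0 : (0 <= t)%R by rewrite !mulr_ge0 ?dot_ge0// ltW.
have cs x : (dot v (Z x) ^+ 2 <= dot v v * dot (Z x) (Z x))%R.
  rewrite -!enorm_sq -exprMn -[leLHS]real_normK ?num_real// ler_sqr ?nnegrE//.
    exact: normr_dot.
  by rewrite mulr_ge0 ?enorm_ge0.
have mv : measurable_fun setT (fun x => dot v (Z x)).
  by apply: measurable_dot => //; exact: measurable_coords_cst.
have mZZ : measurable_fun setT (fun x => dot (Z x) (Z x)) by exact: measurable_dot.
have mlin : measurable_fun setT (fun x => (expR (dot v (Z x)))%:E).
  by apply/measurable_EFinP; exact: measurableT_comp.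
have [t1|t1] := leP t 1%R.
  pose E x : \bar R := (expR (2 * dot v v * dot (Z x) (Z x)))%:E.
  have mE : measurable_fun setT E.
    by apply/measurable_EFinP; apply: measurableT_comp => //; exact: measurable_funM.
  have E0 x : 0 <= E x by rewrite lee_fin expR_ge0.
  have Ele : \int[D]_x E x <= (expR t)%:E.
    by apply: square_exp_moment; rewrite -/t t0.
  have Eint : D.-integrable setT E.
    apply/integrableP; split => //.
    under eq_integral do rewrite gee0_abs//.
    exact: le_lt_trans Ele (ltry _).
  apply: (@le_trans _ _ (\int[D]_x ((dot v (Z x))%:E + E x))).
    have pw x : (expR (dot v (Z x)) <= dot v (Z x) + expR (2 * dot v v * dot (Z x) (Z x)))%R.
      apply: le_trans (expR_le_addr _) _; rewrite lerD2l ler_expR -mulrA.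
      by rewrite ler_pM2l.
    apply: ge0_le_integral => //.
    - by apply: emeasurable_funD => //; exact/measurable_EFinP.
    - by move=> x _; rewrite -EFinD lee_fin.
  rewrite integralD//; last exact: dot_integrable.
  by rewrite dot_integral0 add0e.
pose q := (2^-1 / sigma ^+ 2)%R.
have qs : (q * sigma ^+ 2 = 2^-1)%R by rewrite /q; field; rewrite gt_eqF.
have hq : \int[D]_x (expR (q * dot (Z x) (Z x)))%:E <= (expR 2^-1)%:E.
  by rewrite -qs; apply: square_exp_moment; rewrite qs; lra.
pose c := (dot v v * sigma ^+ 2 / 2)%R.
have c0 : (0 <= c)%R by rewrite !mulr_ge0 ?dot_ge0// ltW.
apply: (@le_trans _ _ (\int[D]_x ((expR c)%:E * (expR (q * dot (Z x) (Z x)))%:E))).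
  apply: ge0_le_integral => //.
  - apply: measurable_funeM; apply/measurable_EFinP; apply: measurableT_comp => //.
    exact: measurable_funM.
  move=> x _; rewrite -EFinM lee_fin -expRD ler_expR.
  have := dot_ge0 ((sigma ^+ 2) *: v - Z x).
  rewrite !(dotBl, dotBr, dotZl, dotZr) (dotC (Z x) v) => h.
  rewrite -(ler_pM2l s2) /c /q.
  rewrite [leRHS](_ : _ = (sigma ^+ 2 * (sigma ^+ 2 * dot v v) + dot (Z x) (Z x)) / 2)%R.
    lra.
  by field; rewrite gt_eqF.
rewrite ge0_integralZl//; last first.
  by apply/measurable_EFinP; apply: measurableT_comp => //; exact: measurable_funM.
apply: le_trans (lee_wpmul2l _ hq) _; first by rewrite lee_fin expR_ge0.
by rewrite -EFinM lee_fin -expRD ler_expR /c; move: t1; rewrite /t; lra.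
Qed.

(** The inequality between the geometric and the arithmetic mean separates the
    linear exponent from the quadratic one, at the price of doubling both. *)
Lemma quadratic_exp_moment h q : (0 <= q)%R -> (2 * q * sigma ^+ 2 <= 1)%R ->
  \int[D]_x (expR (dot h (Z x) + q * dot (Z x) (Z x)))%:E <=
    (expR (8 * dot h h * sigma ^+ 2 + 2 * q * sigma ^+ 2))%:E.
Proof.
move=> q0 q1; set a := (8 * dot h h * sigma ^+ 2)%R; set b := (2 * q * sigma ^+ 2)%R.
have b0 : (0 <= b)%R by rewrite !mulr_ge0 ?exprn_ge0// ltW.
have a0 : (0 <= a)%R by rewrite !mulr_ge0 ?exprn_ge0 ?dot_ge0// ltW.
have mv v : measurable_fun setT (fun x => dot v (Z x)).
  by apply: measurable_dot => //; exact: measurable_coords_cst.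
have mZZ : measurable_fun setT (fun x => dot (Z x) (Z x)) by exact: measurable_dot.
pose E1 x : \bar R := (expR (dot (2 *: h) (Z x)))%:E.
pose E2 x : \bar R := (expR (2 * q * dot (Z x) (Z x)))%:E.
have mE1 : measurable_fun setT E1.
  by apply/measurable_EFinP; exact: measurableT_comp.
have mE2 : measurable_fun setT E2.
  by apply/measurable_EFinP; apply: measurableT_comp => //; exact: measurable_funM.
have E10 x : 0 <= E1 x by rewrite lee_fin expR_ge0.
have E20 x : 0 <= E2 x by rewrite lee_fin expR_ge0.
apply: (@le_trans _ _ (\int[D]_x (2^-1%:E * (E1 x + E2 x)))).
  apply: ge0_le_integral => //.
  - apply/measurable_EFinP; apply: measurableT_comp => //.
    by apply: measurable_funD => //; exact: measurable_funM.
  - by apply: measurable_funeM; exact: emeasurable_funD.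
  move=> x _; rewrite -EFinD -EFinM lee_fin; apply: le_trans (expR_half_add _ _) _.
  by rewrite dotZl mulrA [leRHS]mulrC.
rewrite ge0_integralZl//; last 2 first.
  - exact: emeasurable_funD.
  - by move=> x _; exact: adde_ge0.
rewrite ge0_integralD//.
have h1 : \int[D]_x E1 x <= (expR a)%:E.
  apply: le_trans (linear_exp_moment _) _; rewrite lee_fin ler_expR dotZl dotZr /a.
  lra.
have h2 : \int[D]_x E2 x <= (expR b)%:E.
  by apply: square_exp_moment; rewrite -/b b0.
apply: le_trans (lee_wpmul2l _ (leeD h1 h2)) _; first by rewrite lee_fin.
rewrite -EFinD -EFinM lee_fin.
have : (expR a <= expR (a + b))%R by rewrite ler_expR lerDl.
have : (expR b <= expR (a + b))%R by rewrite ler_expR lerDr.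
lra.
Qed.

End SubGaussian.

(** * The stochastic oracle *)

Section Oracle.
Context {R : realType} {n : nat} {d : measure_display} {Xi : measurableType d}.
Variables (D : probability Xi R) (f : 'cV[R]_n -> R) (F : Xi -> 'cV[R]_n -> R).
Variables (err : 'cV[R]_n -> Xi -> 'cV[R]_n) (delta_y sigma_x : R).
Hypothesis oracle : stochastic_dual_oracle D f F err delta_y sigma_x.
Hypothesis sigma0 : 0 < sigma_x.

Let noisy : 'cV[R]_n -> Xi -> 'cV[R]_n := noisy_x F err.

Definition noisy_mean (y : 'cV[R]_n) : 'cV[R]_n :=
  vec_expectation D (noisy_x F err y).

Definition centred_noise (y : 'cV[R]_n) (x : Xi) : 'cV[R]_n :=
  noisy_x F err y x - noisy_mean y.

Lemma noisy_integrable y i : D.-integrable setT (fun x => (noisy y x i 0)%:E).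
Proof.
rewrite (_ : (fun x => _) =
    (fun x => (exact_x F y x i 0)%:E + (err y x i 0)%:E)%E); last first.
  by apply/funext => x; rewrite /noisy /noisy_x mxE EFinD.
by apply: integrableD => //; [exact: (so_x_int oracle)|exact: (so_err_int oracle)].
Qed.

Lemma noisy_meanE y i : (noisy_mean y i 0)%:E = (\int[D]_x (noisy y x i 0)%:E)%E.
Proof.
by rewrite mxE unlock fineK// integrable_fin_num//; exact: noisy_integrable.
Qed.

Lemma noisy_mean_bias y : enorm (noisy_mean y - dual_argmax f y) <= delta_y.
Proof.
rewrite -(so_x oracle) (_ : _ - _ = vec_expectation D (err y)).
  exact: (so_bias oracle).
apply/eqP; rewrite subr_eq addrC; apply/eqP/colP => i; apply: EFin_inj.
have ix := so_x_int oracle y i; have ie := so_err_int oracle y i.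
rewrite noisy_meanE [in RHS]mxE /vec_expectation !mxE !unlock EFinD.
rewrite !fineK ?integrable_fin_num// -integralD//.
by apply: eq_integral => x _; rewrite /noisy /noisy_x mxE EFinD.
Qed.

Lemma centred_noiseE y x i :
  centred_noise y x i 0 = noisy y x i 0 - noisy_mean y i 0.
Proof.
rewrite /centred_noise -/(noisy y x); move: (noisy y x) (noisy_mean y) => v m.
by rewrite !mxE.
Qed.

Lemma centred_noise_integrable y i :
  D.-integrable setT (fun x => (centred_noise y x i 0)%:E).
Proof.
rewrite (_ : (fun x => _) =
    (fun x => (noisy y x i 0)%:E - (noisy_mean y i 0)%:E)%E); last first.
  by apply/funext => x; rewrite centred_noiseE EFinB.
apply: integrableB => //; first exact: noisy_integrable.
exact: finite_measure_integrable_cst.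
Qed.

Lemma centred_noise_mean y i : (\int[D]_x (centred_noise y x i 0)%:E)%E = 0%E.
Proof.
rewrite (_ : (\int[D]_x _)%E =
  (\int[D]_x ((noisy y x i 0)%:E - (noisy_mean y i 0)%:E))%E).
  rewrite integralB//; last 2 first.
  - exact: noisy_integrable.
  - exact: finite_measure_integrable_cst.
  by rewrite integral_cst//= probability_setT mule1 -noisy_meanE subee.
by apply: eq_integral => x _; rewrite centred_noiseE EFinB.
Qed.

Lemma measurable_noisy_joint :
  measurable_coords (fun p : borel_cV R n * Xi => noisy p.1 p.2).
Proof. exact: (so_meas oracle). Qed.

(** The mean is a difference of two integrals to which Tonelli's theorem applies. *)
Lemma measurable_noisy_mean : measurable_coords (noisy_mean : borel_cV R n -> _).
Proof.
move=> i; pose g (p : borel_cV R n * Xi) : \bar R := (noisy p.1 p.2 i 0)%:E.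
have mg : measurable_fun setT g by apply/measurable_EFinP; exact: measurable_noisy_joint.
rewrite (_ : (fun y => noisy_mean y i 0) = fun y : borel_cV R n =>
   fine ((\int[D]_x (g^\+ (y, x))) - (\int[D]_x (g^\- (y, x))))%E).
  apply: measurableT_comp; first exact: fine_measurable.
  apply: emeasurable_funB.
    apply: (measurable_fun_fubini_tonelli_F (m2 := D) (g^\+)%E) => //.
    exact: measurable_funepos.
  apply: (measurable_fun_fubini_tonelli_F (m2 := D) (g^\-)%E) => //.
  exact: measurable_funeneg.
apply/funext => y.
have hE : (noisy_mean y i 0)%:E =
    ((\int[D]_x (g^\+ (y, x))) - (\int[D]_x (g^\- (y, x))))%E.
  by rewrite noisy_meanE integralE; congr (_ - _)%E; apply: eq_integral => x _;
    rewrite !(funeposE, funenegE).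
by rewrite -hE.
Qed.

Lemma measurable_centred_noise :
  measurable_coords (fun p : borel_cV R n * Xi => centred_noise p.1 p.2).
Proof.
apply: measurable_coordsB; first exact: measurable_noisy_joint.
move=> i; exact: (measurableT_comp (measurable_noisy_mean i)).
Qed.

Section OracleProcesses.
Context {d' : measure_display} {Omega : measurableType d'}.
Variables (P : probability Omega R) (used : pred (nat * nat)).
Variable xi : nat -> nat -> Omega -> Xi.
Hypothesis iid : iid_samples P D used xi.
Local Open Scope ereal_scope.

Lemma measurable_noisy_comp {d1 : measure_display} {T : measurableType d1}
    (y : T -> 'cV[R]_n) (x : T -> Xi) :
  measurable_coords y -> measurable_fun setT x ->
  measurable_coords (fun t => noisy_x F err (y t) (x t)).
Proof.
move=> my mx i; have my' := measurable_coords_borel y my.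
exact: (measurableT_comp (measurable_noisy_joint i) (measurable_fun_pair my' mx)).
Qed.

Lemma measurable_centred_comp {d1 : measure_display} {T : measurableType d1}
    (y : T -> 'cV[R]_n) (x : T -> Xi) :
  measurable_coords y -> measurable_fun setT x ->
  measurable_coords (fun t => centred_noise (y t) (x t)).
Proof.
move=> my mx i; have my' := measurable_coords_borel y my.
exact: (measurableT_comp (measurable_centred_noise i) (measurable_fun_pair my' mx)).
Qed.

(** One fresh sample [j], drawn after the quantities [Q], [h] and [y] have been
    fixed by the samples indexed in [U]. *)
Lemma sample_exp_moment (U : pred (nat * nat)) j (Q : Omega -> R)
    (h y X : Omega -> 'cV[R]_n) (q : R) :
  (forall w, X w = centred_noise (y w) (xi j.1 j.2 w)) ->
  {subset U <= used} -> used j -> ~~ U j ->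
  measurable_fun setT (Q : history xi U -> R) ->
  measurable_coords (h : history xi U -> _) ->
  measurable_coords (y : history xi U -> _) ->
  (0 <= q)%R -> (2 * q * sigma_x ^+ 2 <= 1)%R ->
  \int[P]_w (expR (Q w + (dot (h w) (X w) + q * dot (X w) (X w))))%:E <=
  \int[P]_w (expR (Q w + (8 * dot (h w) (h w) * sigma_x ^+ 2
                          + 2 * q * sigma_x ^+ 2)))%:E.
Proof.
move=> /funext -> Uu uj Uj mQ mh my q0 q1.
pose Phi (p : history xi U * Xi) : \bar R :=
  (expR (Q p.1 + (dot (h p.1) (centred_noise (y p.1) p.2)
     + q * dot (centred_noise (y p.1) p.2) (centred_noise (y p.1) p.2))))%:E.
have m1 : measurable_fun setT (fst : history xi U * Xi -> history xi U).
  exact: measurable_fst.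
have mX : measurable_coords
    (fun p : history xi U * Xi => centred_noise (y p.1) p.2).
  apply: measurable_centred_comp; last exact: measurable_snd.
  by move=> i; exact: (measurableT_comp (my i) m1).
have mhp : measurable_coords (fun p : history xi U * Xi => h p.1).
  by move=> i; exact: (measurableT_comp (mh i) m1).
have mPhi : measurable_fun setT Phi.
  apply/measurable_EFinP; apply: measurableT_comp => //.
  apply: measurable_funD; first exact: (measurableT_comp mQ m1).
  apply: measurable_funD; first exact: measurable_dot.
  by apply: measurable_funM => //; exact: measurable_dot.
have Phi0 p : 0 <= Phi p by rewrite lee_fin expR_ge0.
have := sample_integral P D used xi iid U j Phi Uu uj Uj mPhi Phi0.
rewrite /Phi /= => ->.
apply: ge0_le_integral => //.
- by move=> w _; apply: integral_ge0 => t _; rewrite lee_fin expR_ge0.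
- have mF := measurable_fun_fubini_tonelli_F (m2 := D) Phi mPhi Phi0.
  exact: (measurable_from_history P D used xi iid U _ _ _ Uu mF).
- apply/measurable_EFinP; apply: measurableT_comp => //.
  have mQ' := measurable_from_history P D used xi iid U _ _ _ Uu mQ.
  have mh' : measurable_coords h.
    by move=> i; exact: (measurable_from_history P D used xi iid U _ _ _ Uu (mh i)).
  apply: measurable_funD => //; apply: measurable_funD => //.
  apply: measurable_funM => //; apply: measurable_funM => //.
  exact: measurable_dot.
move=> w _; rewrite expRD EFinM.
under eq_integral do rewrite expRD EFinM.
have mXw : measurable_coords (centred_noise (y w)).
  by apply: measurable_centred_comp => //; exact: measurable_coords_cst.
rewrite ge0_integralZl//; last first.
  apply/measurable_EFinP; apply: measurableT_comp => //.
  apply: measurable_funD; last first.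
    by apply: measurable_funM => //; exact: measurable_dot.
  by apply: measurable_dot => //; exact: measurable_coords_cst.
apply: lee_wpmul2l; first by rewrite lee_fin expR_ge0.
apply: quadratic_exp_moment => //.
- by move=> i; exact: centred_noise_integrable.
- by move=> i; exact: centred_noise_mean.
- exact: (so_light_tail oracle).
Qed.
End OracleProcesses.
End Oracle.

(** * Exponential moments of nonnegative processes *)

Section ExponentialMoments.
Local Open Scope ereal_scope.
Context {R : realType} {d : measure_display} {T : measurableType d}.
Variable P : probability T R.
Implicit Types (f g : T -> R).

Lemma measurable_EFin_expR f : measurable_fun setT f ->
  measurable_fun setT (fun w => (expR (f w))%:E).
Proof. by move=> mf; apply/measurable_EFinP; exact: measurableT_comp. Qed.

Lemma le_exp_moment f g : measurable_fun setT f -> measurable_fun setT g ->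
  (forall w, (f w <= g w)%R) ->
  \int[P]_w (expR (f w))%:E <= \int[P]_w (expR (g w))%:E.
Proof.
move=> mf mg fg; apply: ge0_le_integral => //.
- exact: measurable_EFin_expR.
- exact: measurable_EFin_expR.
by move=> w _; rewrite lee_fin ler_expR.
Qed.

Lemma exp_momentD (c : R) f : measurable_fun setT f ->
  \int[P]_w (expR (c + f w))%:E = (expR c)%:E * \int[P]_w (expR (f w))%:E.
Proof.
move=> mf; under eq_integral do rewrite expRD EFinM.
by rewrite ge0_integralZl//; exact: measurable_EFin_expR.
Qed.

(** Markov's inequality for the exponential of [l * f]. *)
Lemma exp_moment_tail (l t b : R) f : (0 < l)%R -> measurable_fun setT f ->
  \int[P]_w (expR (l * f w))%:E <= (expR b)%:E ->
  P [set w | (t < f w)%R] <= (expR (b - l * t))%:E.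
Proof.
move=> l0 mf hf.
have mlf : measurable_fun setT (fun w => (expR (l * f w))%:E).
  by apply: measurable_EFin_expR; exact: measurable_funM.
pose E := [set w | (expR (l * t))%:E <= `|(expR (l * f w))%:E|].
have mE : measurable E.
  by rewrite -[E]setTI; apply: emeasurable_fun_c_infty => //; exact: measurableT_comp.
have sub : P [set w | (t < f w)%R] <= P E.
  apply: le_measure; rewrite ?inE//.
    have mlt := measurable_fun_ltr (measurable_cst t) mf.
    by have := mlt measurableT [set true] I; rewrite setTI.
  move=> w /= tw; rewrite /E/= lee_fin ger0_norm ?expR_ge0// ler_expR.
  by rewrite ler_pM2l// ltW.
apply: (le_trans sub).
have := @le_integral_comp_abse _ _ _ P _ measurableT
  (fun w => (expR (l * f w))%:E) (expR (l * t)) id _ _ _ mlf (expR_gt0 _).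
rewrite setTI -/E => /(_ _ _ _)/= h.
have {}h : (expR (l * t))%:E * P E <= (expR b)%:E.
  apply: le_trans hf; apply: le_trans (h _ _ _) _ => //.
  rewrite le_eqVlt; apply/orP; left; apply/eqP; apply: eq_integral => w _.
  by rewrite ger0_norm ?expR_ge0.
rewrite expRD expRN EFinM -(fineK (fin_num_measure P E mE)) -EFinM lee_fin.
rewrite -(fineK (fin_num_measure P E mE)) -EFinM lee_fin in h.
by rewrite ler_pdivlMr ?expR_gt0// mulrC.
Qed.

End ExponentialMoments.

(** The samples drawn before sample [l] of batch [k]. *)
Definition past (N : nat) (r : nat -> nat) (k l : nat) : pred (nat * nat) :=
  fun j => [&& (1 <= j.1 <= N)%N, (j.2 < r j.1)%N &
    (j.1 < k)%N || (j.1 == k) && (j.2 < l)%N].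

Section Process.
Context {R : realType} {n : nat} {d : measure_display} {Xi : measurableType d}.
Variables (D : probability Xi R) (f : 'cV[R]_n -> R) (F : Xi -> 'cV[R]_n -> R).
Variables (err : 'cV[R]_n -> Xi -> 'cV[R]_n) (delta_y sigma_x : R).
Hypothesis oracle : stochastic_dual_oracle D f F err delta_y sigma_x.
Hypothesis sigma0 : 0 < sigma_x.
Context {d' : measure_display} {Omega : measurableType d'}.
Variables (P : probability Omega R) (N : nat) (r : nat -> nat).
Variable xi : nat -> nat -> Omega -> Xi.
Let used : pred (nat * nat) := fun j => (1 <= j.1 <= N)%N && (j.2 < r j.1)%N.
Hypothesis iid : iid_samples P D used xi.
Hypothesis r_gt0 : forall k, (1 <= k <= N)%N -> (0 < r k)%N.

Lemma past_used k l : {subset past N r k l <= used}.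
Proof. by move=> j /and3P[h1 h2 _]; apply/andP. Qed.

Lemma past_mono k l k' l' : (k < k')%N || (k == k') && (l <= l')%N ->
  {subset past N r k l <= past N r k' l'}.
Proof.
move=> kk j /and3P[h1 h2 h3]; apply/and3P; split => //; move: h3 kk.
move=> /orP[jk|/andP[/eqP jk jl]] /orP[kk|/andP[/eqP <- ll]].
- by rewrite (ltn_trans jk kk).
- by rewrite jk.
- by rewrite jk kk.
- by rewrite jk ltnn eqxx (leq_trans jl ll).
Qed.

(** The data of [process_exp_moment]: [Q k l] is the value reached after [l]
    samples of batch [k], and [W k] the value at the end of that batch. *)
Variables (W : nat -> Omega -> R) (Q : nat -> nat -> Omega -> R).
Variables (h : nat -> nat -> Omega -> 'cV[R]_n) (y : nat -> Omega -> 'cV[R]_n).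
Variables (tau a p : nat -> R) (R2 lam c : R).
Let X k l w : 'cV[R]_n := centred_noise D F err (y k w) (xi k l w).
Hypothesis lam0 : 0 < lam.
Hypothesis R20 : 0 <= R2.
Hypothesis mW : forall k, (k <= N)%N -> measurable_fun setT (W k).
Hypothesis mQ : forall k l, (1 <= k <= N)%N -> (l <= r k)%N ->
  measurable_fun setT (Q k l : history xi (past N r k l) -> R).
Hypothesis mh : forall k l, (1 <= k <= N)%N -> (l < r k)%N ->
  measurable_coords (h k l : history xi (past N r k l) -> _).
Hypothesis my : forall k, (1 <= k <= N)%N ->
  measurable_coords (y k : history xi (past N r k 0) -> _).
Hypothesis W0 : forall w, W 0%N w <= c.
Hypothesis W_ge0 : forall k w, (k <= N)%N -> 0 <= W k w.
Hypothesis Q_ge0 : forall k l w, (1 <= k <= N)%N -> 0 <= Q k l w.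
Hypothesis Q_start : forall k w, (k < N)%N ->
  Q k.+1 0%N w <= (1 + tau k.+1) * W k w + 2 * tau k.+1 * R2.
Hypothesis Q_step : forall k l w, (1 <= k <= N)%N -> (l < r k)%N ->
  Q k l.+1 w <= Q k l w + (dot (h k l w) (X k l w)
                           + 4 / 3 * a k * dot (X k l w) (X k l w)).
Hypothesis Q_end : forall k w, (1 <= k <= N)%N -> W k w <= Q k (r k) w.
Hypothesis h_bound : forall k l w, (1 <= k <= N)%N -> (l < r k)%N ->
  dot (h k l w) (h k l w) <= 8 * a k * Q k l w.
Hypothesis a_ge0 : forall k, 0 <= a k.
Hypothesis tau_ge0 : forall k, 0 <= tau k.
Hypothesis tau_p : forall k, 4 * tau k <= p k.
Hypothesis a_p : forall k, (1 <= k <= N)%N ->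
  512 * lam * ((r k)%:R * (a k * sigma_x ^+ 2)) <= p k.
Hypothesis p_sum : \sum_(k < N) p k.+1 <= 1.

Local Open Scope ereal_scope.
Let EE (g : Omega -> R) := \int[P]_w (expR (g w))%:E.

Let mQo k l : (1 <= k <= N)%N -> (l <= r k)%N -> measurable_fun setT (Q k l).
Proof.
move=> kN lr; have := mQ k l kN lr.
by apply: (measurable_from_history P D used xi iid); exact: past_used.
Qed.

Let p_ge0 k : (0 <= p k)%R.
Proof. by apply: le_trans (tau_p k); rewrite mulr_ge0. Qed.

(** In each sample step the quadratic term adds a constant to the exponent and the
    linear term raises the multiplier of [Q k l]; the linear decrease of the
    multiplier in [l] makes room for the latter. *)
Lemma batch_exp_moment k (B : R) l : (1 <= k <= N)%N -> (l <= r k)%N ->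
  (p k <= 1)%R -> (lam * (1 + p k / 2) <= B <= 2 * lam)%R ->
  EE (fun w => (B - lam * (p k / 2) * (l%:R / (r k)%:R)) * Q k l w)%R <=
  (expR (l%:R * (6 * lam * (a k * sigma_x ^+ 2))))%:E *
    EE (fun w => B * Q k 0%N w)%R.
Proof.
move=> kN + p1 /andP[B1 B2]; have rk : (0 < (r k)%:R :> R)%R.
  by rewrite ltr0n; exact: r_gt0.
set as2 := (a k * sigma_x ^+ 2)%R; pose b i := (B - lam * (p k / 2) * (i%:R / (r k)%:R))%R.
have as0 : (0 <= as2)%R by rewrite mulr_ge0 ?sqr_ge0.
elim: l => [_|l ih lr].
  by rewrite !mul0r mulr0 subr0 expR0 mul1e.
have {}ih := ih (ltnW lr); rewrite -/(b l) in ih; rewrite -/(b l.+1).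
have bS : b l = (b l.+1 + lam * (p k / 2) / (r k)%:R)%R.
  by rewrite /b -natr1; field; rewrite gt_eqF.
have lpk : (0 <= lam * (p k / 2))%R by rewrite mulr_ge0 ?divr_ge0// ltW.
have b1 : (lam <= b l.+1)%R.
  have : (lam * (p k / 2) * (l.+1%:R / (r k)%:R) <= lam * (p k / 2))%R.
    by rewrite ler_piMr// ler_pdivrMr// mul1r ler_nat.
  by rewrite /b; lra.
have b2 : (b l.+1 <= 2 * lam)%R.
  have : (0 <= lam * (p k / 2) * (l.+1%:R / (r k)%:R))%R.
    by rewrite mulr_ge0// divr_ge0.
  by rewrite /b; lra.
have b0 : (0 <= b l.+1)%R by lra.
have ap : (512 * lam * as2 <= p k / (r k)%:R)%R.
  by rewrite ler_pdivlMr//; have := a_p k kN; rewrite -/as2; lra.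
have pr : (p k / (r k)%:R <= 1)%R.
  rewrite ler_pdivrMr// mul1r (le_trans p1)//.
  by rewrite ler1n; exact: r_gt0.
have las : (0 <= lam * as2)%R by rewrite mulr_ge0// ltW.
have bas : (b l.+1 * as2 <= 2 * lam * as2)%R by rewrite ler_wpM2r.
have mhl : measurable_coords ((fun w => b l.+1 *: h k l w) : history xi (past N r k l) -> _).
  by apply: measurable_coordsZ => //; exact: mh.
have mQl : measurable_fun setT (Q k l : history xi (past N r k l) -> R).
  by apply: mQ => //; exact: ltnW.
have myl : measurable_coords (y k : history xi (past N r k l) -> _).
  move=> i; apply: (measurable_history_mono xi (past N r k 0) _ _ _ _ _ (my k kN i)).
  by apply: past_mono; rewrite eqxx orbT.
have mQlo := mQo k l kN (ltnW lr).
have mho : measurable_coords (h k l).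
  move=> i; apply: (measurable_from_history P D used xi iid _ _ _ _ _ (mh k l kN lr i)).
  exact: past_used.
have myo : measurable_coords (y k).
  move=> i; apply: (measurable_from_history P D used xi iid _ _ _ _ _ (my k kN i)).
  exact: past_used.
have ukl : used (k, l) by rewrite /used/= kN.
have mX : measurable_coords (X k l).
  apply: (measurable_centred_comp D f F err delta_y sigma_x oracle) => //.
  exact: (measurable_sample P D used xi iid (k, l) ukl).
have mhX : measurable_fun setT (fun w => dot (h k l w) (X k l w)) by exact: measurable_dot.
have mXX : measurable_fun setT (fun w => dot (X k l w) (X k l w)) by exact: measurable_dot.
have mhh : measurable_fun setT (fun w => dot (h k l w) (h k l w)) by exact: measurable_dot.
apply: (@le_trans _ _ (EE (fun w => b l.+1 * Q k l w
    + (dot (b l.+1 *: h k l w) (X k l w)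
       + (b l.+1 * (4 / 3 * a k)) * dot (X k l w) (X k l w)))%R)).
  apply: le_exp_moment => [||w].
  - by apply: measurable_funM => //; exact: mQo.
  - apply: measurable_funD; first exact: measurable_funM.
    apply: measurable_funD; last exact: measurable_funM.
    by under eq_fun do rewrite dotZl; exact: measurable_funM.
  have := ler_wpM2l b0 (Q_step k l w kN lr).
  by rewrite dotZl !mulrDr !mulrA.
apply: le_trans (sample_exp_moment D f F err delta_y sigma_x oracle sigma0 P used xi
  iid (past N r k l) (k, l) (fun w => b l.+1 * Q k l w)%R
  (fun w => b l.+1 *: h k l w) (y k) (X k l) _ _ _ _ _ _ _ _ _ _) _ => //.
- exact: past_used.
- by rewrite /past/= !ltnn eqxx !andbF.
- by apply: measurable_funM => //; exact: mQl.
- by rewrite !mulr_ge0 ?divr_ge0.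
- have : (b l.+1 * as2 <= 1 / 256)%R by lra.
  by rewrite /as2; lra.
apply: le_trans (_ : EE (fun w => 6 * lam * as2 + b l * Q k l w)%R <= _).
  apply: le_exp_moment => [||w].
  - apply: measurable_funD; first exact: measurable_funM.
    apply: measurable_funD => //; apply: measurable_funM => //.
    apply: measurable_funM => //.
    under eq_fun do rewrite dotZl dotZr.
    by do 2 apply: measurable_funM => //.
  - by apply: measurable_funD => //; exact: measurable_funM.
  have Q0 := Q_ge0 k l w kN.
  have hb := h_bound k l w kN lr.
  have s2 : (0 <= sigma_x ^+ 2)%R := sqr_ge0 _.
  have hb' : (dot (h k l w) (h k l w) * sigma_x ^+ 2 <= 8 * as2 * Q k l w)%R.
    by have := ler_wpM2r s2 hb; rewrite /as2; lra.
  have bb : (b l.+1 * b l.+1 <= 4 * lam * lam)%R by nra.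
  have hb2 : (8 * (b l.+1 * b l.+1) * (dot (h k l w) (h k l w) * sigma_x ^+ 2)
      <= 256 * lam * (lam * as2) * Q k l w)%R.
    have := ler_pM (mulr_ge0 b0 b0) (mulr_ge0 (dot_ge0 _) s2) bb hb'; lra.
  have hb3 : (256 * lam * (lam * as2) * Q k l w <=
      lam * (p k / 2) / (r k)%:R * Q k l w)%R.
    rewrite ler_wpM2r//; have := ler_wpM2l (ltW lam0) ap; lra.
  have bS' : (b l * Q k l w = b l.+1 * Q k l w + lam * (p k / 2) / (r k)%:R * Q k l w)%R.
    by rewrite bS mulrDl.
  have lin : (2 * (b l.+1 * (4 / 3 * a k)) * sigma_x ^+ 2 <= 6 * lam * as2)%R.
    rewrite (_ : (2 * _ * _ = 8 / 3 * (b l.+1 * as2))%R); last by rewrite /as2; field.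
    by lra.
  rewrite dotZl dotZr bS'.
  have -> : (8 * (b l.+1 * (b l.+1 * dot (h k l w) (h k l w))) * sigma_x ^+ 2 =
    8 * (b l.+1 * b l.+1) * (dot (h k l w) (h k l w) * sigma_x ^+ 2))%R by ring.
  by lra.
rewrite /EE exp_momentD; last exact: measurable_funM.
apply: le_trans (lee_wpmul2l _ ih) _; first by rewrite lee_fin expR_ge0.
rewrite muleA -EFinM -expRD; apply: lee_wpmul2r.
  by apply: integral_ge0 => w _; rewrite lee_fin expR_ge0.
by rewrite lee_fin ler_expR -natr1; lra.
Qed.

(** The multiplier of [W k] decreases from [2 * lam] to [lam] in proportion to
    [p]: what the multiplier loses during a batch pays for the factor by which
    the exponential moments of [Q] grow. *)
Theorem process_exp_moment m : (m <= N)%N ->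
  EE (fun w => lam * W m w)%R <= (expR (2 * lam * c + (lam * R2 + 1 / 64)))%:E.
Proof.
move=> mN; pose S k := (\sum_(i < k) p i.+1)%R.
have S0 k : (0 <= S k)%R by apply: sumr_ge0 => i _; exact: p_ge0.
have S1 k : (k <= N)%N -> (S k <= 1)%R.
  move=> kN; apply: le_trans p_sum; rewrite /S.
  rewrite -(big_mkord xpredT (fun i => p i.+1)) -(big_mkord xpredT (fun i => p i.+1)).
  by rewrite [leRHS](big_cat_nat _ kN)//= lerDl; apply: sumr_ge0.
have claim k : (k <= N)%N -> EE (fun w => lam * (2 - S k) * W k w)%R <=
    (expR (2 * lam * c + (lam * R2 + 1 / 64) * S k))%:E.
  elim: k => [_|k ih kN].
    have -> : S 0%N = 0%R by rewrite /S big_ord0.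
    rewrite subr0 mulr0 addr0.
    have -> : (expR (2 * lam * c))%:E = EE (fun=> 2 * lam * c)%R.
      by rewrite /EE integral_cst//= probability_setT mule1.
    apply: le_exp_moment => // [|w].
      by apply: measurable_funM => //; exact: mW.
    by have := ler_wpM2l (ltW lam0) (W0 w); lra.
  have kN' : (1 <= k.+1 <= N)%N by [].
  have SS : S k.+1 = (S k + p k.+1)%R by rewrite /S big_ord_recr.
  have Sk1 := S1 _ kN; have Sk0 := S0 k; have pk0 := p_ge0 k.+1.
  rewrite SS in Sk1; pose B := (lam * (2 - S k) - lam * (p k.+1 / 2))%R.
  have B1 : (lam * (1 + p k.+1 / 2) <= B)%R.
    have := ler_wpM2l (ltW lam0) Sk1; rewrite /B; lra.
  have B2 : (B <= 2 * lam)%R.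
    have := mulr_ge0 (ltW lam0) Sk0; have := mulr_ge0 (ltW lam0) pk0; rewrite /B; lra.
  have rk : (0 < (r k.+1)%:R :> R)%R by rewrite ltr0n; exact: r_gt0.
  have mWk := mW k (ltnW kN); have mWk1 := mW k.+1 kN.
  have mQ0 := mQo k.+1 0%N kN' (leq0n _).
  have mQr := mQo k.+1 (r k.+1) kN' (leqnn _).
  have lpk := mulr_ge0 (ltW lam0) pk0.
  apply: le_trans (_ : EE (fun w => (B - lam * (p k.+1 / 2)
      * ((r k.+1)%:R / (r k.+1)%:R)) * Q k.+1 (r k.+1) w)%R <= _).
    apply: le_exp_moment => [||w]; [exact: measurable_funM|exact: measurable_funM|].
    have := Q_end k.+1 w kN'.
    rewrite mulfV ?gt_eqF// SS /B => hW.
    have b0 : (0 <= lam * (2 - S k - p k.+1))%R by rewrite mulr_ge0 ?(ltW lam0)//; lra.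
    by have := ler_wpM2l b0 hW; lra.
  have B12 : (lam * (1 + p k.+1 / 2) <= B <= 2 * lam)%R by rewrite B1.
  have p1 : (p k.+1 <= 1)%R by lra.
  apply: le_trans (batch_exp_moment k.+1 B (r k.+1) kN' (leqnn _) p1 B12) _.
  have tk := tau_ge0 k.+1; have tp := tau_p k.+1.
  have start : EE (fun w => B * Q k.+1 0%N w)%R <=
      (expR (lam * R2 * p k.+1))%:E * EE (fun w => lam * (2 - S k) * W k w)%R.
    rewrite /EE -exp_momentD; last exact: measurable_funM.
    apply: le_exp_moment => [||w]; first exact: measurable_funM.
      by apply: measurable_funD => //; exact: measurable_funM.
    have B0 : (0 <= B)%R by apply: le_trans B1; rewrite mulr_ge0 ?(ltW lam0)//; lra.
    have := ler_wpM2l B0 (Q_start k w kN).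
    have Wk := W_ge0 k w (ltnW kN).
    have Bt : (B * tau k.+1 <= lam * (p k.+1 / 2))%R.
      have := ler_wpM2r tk B2; have := ler_wpM2l (ltW lam0) tp; lra.
    have := ler_wpM2r Wk Bt; have := ler_wpM2r R20 Bt.
    have BW : (B * W k w = lam * (2 - S k) * W k w - lam * (p k.+1 / 2) * W k w)%R.
      by rewrite /B mulrBl.
    by clearbody B; lra.
  apply: le_trans (lee_wpmul2l _ start) _; first by rewrite lee_fin expR_ge0.
  rewrite muleA -EFinM -expRD.
  apply: le_trans (lee_wpmul2l _ (ih (ltnW kN))) _; first by rewrite lee_fin expR_ge0.
  rewrite -EFinM -expRD lee_fin ler_expR SS.
  by have := a_p k.+1 kN'; lra.
apply: le_trans (_ : EE (fun w => lam * (2 - S m) * W m w)%R <= _).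
  apply: le_exp_moment => [||w].
  - by apply: measurable_funM => //; exact: mW.
  - by apply: measurable_funM => //; exact: mW.
  have lW := mulr_ge0 (ltW lam0) (W_ge0 m w mN).
  have S1' : (0 <= 1 - S m)%R by rewrite subr_ge0 S1.
  by have := mulr_ge0 S1' lW; lra.
apply: le_trans (claim m mN) _; rewrite lee_fin ler_expR lerD2l.
by rewrite ler_piMr ?S1// addr_ge0// mulr_ge0// ltW.
Qed.

End Process.

(** * The random errors of the method *)

Section StochasticPath.
Context {R : realType} {n : nat} {d : measure_display} {Xi : measurableType d}.
Variables (D : probability Xi R) (f : 'cV[R]_n -> R) (F : Xi -> 'cV[R]_n -> R).
Variables (err : 'cV[R]_n -> Xi -> 'cV[R]_n) (delta_y sigma_x : R).
Hypothesis oracle : stochastic_dual_oracle D f F err delta_y sigma_x.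
Hypothesis sigma0 : 0 < sigma_x.
Context {d' : measure_display} {Omega : measurableType d'}.
Variables (P : probability Omega R) (N : nat) (r : nat -> nat).
Variable xi : nat -> nat -> Omega -> Xi.
Let used : pred (nat * nat) := fun j => (1 <= j.1 <= N)%N && (j.2 < r j.1)%N.
Hypothesis iid : iid_samples P D used xi.
Hypothesis r_gt0 : forall k, (1 <= k <= N)%N -> (0 < r k)%N.

Variables (A : 'M[R]_n) (mu lmax : R) (xs g ys : 'cV[R]_n) (alpha Acc : nat -> R).
Hypotheses (mu0 : 0 < mu) (lmax0 : 0 < lmax) (scf : strongly_convex mu f).
Hypotheses (fg : is_gradient f xs g) (hA : is_lambda_max (A^T *m A) lmax).
Hypotheses (hxs : is_primal_solution A f xs).
Hypotheses (hys : is_min_norm_dual_solution A f ys).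
Let Lt : R := 2 * (lmax / mu).
Hypothesis (hc : spdstm_coefs Lt alpha Acc).
Let Lt0 : 0 < Lt. Proof. by rewrite mulr_gt0// divr_gt0. Qed.

Let xt := noisy_x F err.
Let samples (w : Omega) k l : Xi := xi k l w.
Let yt k w := path_yt A xt alpha Acc r (samples w) k.
Let z k w := path_z A xt alpha Acc r (samples w) k.
Let y k w := path_y A xt alpha Acc r (samples w) k.
Let xo k w := path_x A xt alpha Acc r (samples w) k.
Let W m w := distance_budget A f ys xt alpha Acc r (samples w) m.

Definition bias_part k w : 'cV[R]_n :=
  noisy_mean D F err (A^T *m yt k w) - dual_argmax f (A^T *m yt k w).
Definition noise k l w : 'cV[R]_n :=
  centred_noise D F err (A^T *m yt k w) (xi k l w).
Definition noise_mean k l w : 'cV[R]_n :=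
  (r k)%:R^-1 *: \sum_(i < l) noise k i w.

Lemma x_error_split k w : (1 <= k <= N)%N ->
  x_error A f xt alpha Acc r (samples w) k = bias_part k w + noise_mean k (r k) w.
Proof.
move=> kN; rewrite /noise_mean /noise /centred_noise sumrB sumr_const card_ord.
rewrite scalerBr -[X in _ - _ *: X]scaler_nat scalerA mulVf ?scale1r; last first.
  by rewrite pnatr_eq0 -lt0n; exact: r_gt0.
by rewrite /bias_part /x_error /path_x /batch_x /exact_point [RHS]addrC addrA subrK.
Qed.

Lemma measurable_dual_argmax {d1 : measure_display} {T : measurableType d1}
    (v : T -> 'cV[R]_n) : measurable_coords v ->
  measurable_coords (fun t => dual_argmax f (v t)).
Proof.
move=> mv i; apply: (measurable_continuous_comp (fun u => dual_argmax f u i 0)) => //.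
move=> u B /nbhs_ballP[e e0 eB].
apply/nbhs_ballP; exists (mu * e / (n%:R + 1)) => /= [|t].
  by rewrite divr_gt0 ?mulr_gt0// ltr_wpDl.
rewrite mx_norm_ball /ball_/= => ut; apply: eB; rewrite /ball/=.
have := coord_le_enorm (dual_argmax f u - dual_argmax f t) i; rewrite !mxE.
move=> /le_lt_trans; apply; rewrite -(ltr_pM2l mu0).
apply: le_lt_trans (x_of_lipschitz f mu xs g mu0 scf fg u t) _.
apply: le_lt_trans (enorm_le_mx_norm _) _.
move: ut; rewrite ltr_pdivlMr ?ltr_wpDl// => /(le_lt_trans _); apply.
by rewrite mulrDr mulr1 mulrC lerDl.
Qed.

Lemma measurable_path k : (k <= N)%N ->
  measurable_coords (z k : history xi (past N r k.+1 0) -> _) /\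
  measurable_coords (y k : history xi (past N r k.+1 0) -> _).
Proof.
elim: k => [|k ih] kN; first by split; exact: measurable_coords_cst.
have [mz my] := ih (ltnW kN).
have sub : {subset past N r k.+1 0 <= past N r k.+2 0} by apply: past_mono; rewrite ltnS leqnn.
have mono (v : Omega -> 'cV[R]_n) :
    measurable_coords (v : history xi (past N r k.+1 0) -> _) ->
    measurable_coords (v : history xi (past N r k.+2 0) -> _).
  by move=> mv i; exact: (measurable_history_mono xi _ _ _ _ _ sub (mv i)).
have myt : measurable_coords (yt k.+1 : history xi (past N r k.+2 0) -> _).
  rewrite (_ : yt k.+1 = fun w => (Acc k.+1)^-1 *: (Acc k *: y k w + alpha k.+1 *: z k w)).
    apply: measurable_coordsZ => //; apply: measurable_coordsD;
      by apply: measurable_coordsZ => //; exact: mono.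
  by apply/funext => w; exact: path_ytS.
have mxo : measurable_coords (xo k.+1 : history xi (past N r k.+2 0) -> _).
  apply: measurable_coordsZ => //; apply: measurable_coords_sum => l.
  apply: (measurable_noisy_comp D f F err delta_y sigma_x oracle).
    exact: measurable_coordsMl.
  apply: (measurable_history_sample xi _ (k.+1, nat_of_ord l)).
  by apply/and3P; split => //=; rewrite ltnSn.
have mz' : measurable_coords (z k.+1 : history xi (past N r k.+2 0) -> _).
  rewrite (_ : z k.+1 = fun w => z k w - alpha k.+1 *: (A *m xo k.+1 w)).
    apply: measurable_coordsB; first exact: mono.
    by apply: measurable_coordsZ => //; exact: measurable_coordsMl.
  by apply/funext => w; exact: path_zS.
split=> //.
rewrite (_ : y k.+1 = fun w => (Acc k.+1)^-1 *: (Acc k *: y k w + alpha k.+1 *: z k.+1 w)).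
  apply: measurable_coordsZ => //; apply: measurable_coordsD;
    by apply: measurable_coordsZ => //; exact: mono.
by apply/funext => w; exact: path_yS.
Qed.

Lemma measurable_yt k : (k < N)%N ->
  measurable_coords (yt k.+1 : history xi (past N r k.+1 0) -> _).
Proof.
move=> kN; have [mz my] := measurable_path k (ltnW kN).
rewrite (_ : yt k.+1 = fun w => (Acc k.+1)^-1 *: (Acc k *: y k w + alpha k.+1 *: z k w)).
  by apply: measurable_coordsZ => //; apply: measurable_coordsD;
    exact: measurable_coordsZ.
by apply/funext => w; exact: path_ytS.
Qed.

Lemma measurable_noise k l k' l' : (k < N)%N -> (l < r k.+1)%N ->
  (k.+1 < k')%N || (k.+1 == k') && (l < l')%N ->
  measurable_coords (noise k.+1 l : history xi (past N r k' l') -> _).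
Proof.
move=> kN lr lt.
apply: (measurable_centred_comp D f F err delta_y sigma_x oracle).
  apply: measurable_coordsMl => i.
  apply: (measurable_history_mono xi (past N r k.+1 0) _ _ _ _ _ (measurable_yt k kN i)).
  by apply: past_mono; case/orP: lt => [->|/andP[-> _]]//; rewrite orbT.
apply: (measurable_history_sample xi _ (k.+1, l)).
by apply/and3P; split => //=.
Qed.

Lemma measurable_bias k : (k < N)%N ->
  measurable_coords (bias_part k.+1 : history xi (past N r k.+1 0) -> _).
Proof.
move=> kN; have mv := measurable_coordsMl A^T _ (measurable_yt k kN).
apply: measurable_coordsB; last exact: measurable_dual_argmax.
move=> i.
exact: (measurableT_comp (measurable_noisy_mean D f F err delta_y sigma_x oracle i)
  (measurable_coords_borel _ mv)).
Qed.

Lemma measurable_noise_mean k l k' l' : (k < N)%N -> (l <= r k.+1)%N ->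
  (k.+1 < k')%N || (k.+1 == k') && (l <= l')%N ->
  measurable_coords (noise_mean k.+1 l : history xi (past N r k' l') -> _).
Proof.
move=> kN lr lt; apply: measurable_coordsZ => //; apply: measurable_coords_sum => i.
apply: measurable_noise => //; first exact: leq_trans lr.
by case/orP: lt => [->//|/andP[-> ll]]; rewrite (leq_trans _ ll)// orbT.
Qed.

Lemma measurable_x_error k : (k < N)%N ->
  measurable_coords ((fun w => x_error A f xt alpha Acc r (samples w) k.+1)
    : history xi (past N r k.+2 0) -> _).
Proof.
move=> kN; rewrite (_ : (fun w => _) =
    fun w => bias_part k.+1 w + noise_mean k.+1 (r k.+1) w); last first.
  by apply/funext => w; exact: x_error_split.
apply: measurable_coordsD; last by apply: measurable_noise_mean => //; rewrite ltnSn.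
move=> i; apply: (measurable_history_mono xi (past N r k.+1 0) _ _ _ _ _ (measurable_bias k kN i)).
by apply: past_mono; rewrite ltnSn.
Qed.

Lemma measurable_budget m : (m <= N)%N ->
  measurable_fun setT (W m : history xi (past N r m.+1 0) -> R).
Proof.
move=> mN; apply: measurable_funD => //; elim: m mN => [|m ih] mN.
  by under eq_fun do rewrite big_ord0; exact: measurable_cst.
under eq_fun do rewrite big_ord_recr/=.
have mono (v : Omega -> 'cV[R]_n) :
    measurable_coords (v : history xi (past N r m.+1 0) -> _) ->
    measurable_coords (v : history xi (past N r m.+2 0) -> _).
  move=> mv i; apply: (measurable_history_mono xi _ _ _ _ _ _ (mv i)).
  by apply: past_mono; rewrite ltnSn.
apply: measurable_funD.
  apply: (measurable_history_mono xi (past N r m.+1 0) _ _ _ _ _ (ih (ltnW mN))).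
  by apply: past_mono; rewrite ltnSn.
have me := measurable_coordsMl A _ (measurable_x_error m mN).
have [mz _] := measurable_path m (ltnW mN).
apply: measurable_funD.
  apply: measurableT_comp => //; apply: measurable_funM => //.
  apply: measurable_dot => //; apply: measurable_coordsB; first exact: mono.
  exact: measurable_coords_cst.
by apply: measurable_funM => //; exact: measurable_dot.
Qed.

(** Batch [k] is revealed one sample at a time: these are the gradient error and
    the distance budget that the first [l] samples would produce alone, with the
    divisor [r k] of the full batch. *)
Definition partial_error k l w : 'cV[R]_n :=
  A *m (bias_part k w + noise_mean k l w).

Definition partial_budget k l w : R :=
  W k.-1 w - 2 * alpha k * dot (partial_error k l w) (z k.-1 w - ys)
  + 4 / 3 * alpha k ^+ 2 * dot (partial_error k l w) (partial_error k l w).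

(** The derivative of [partial_budget] in the direction of the next noise vector. *)
Definition budget_slope k l w : 'cV[R]_n :=
  (r k)%:R^-1 *: (A^T *m ((8 / 3 * alpha k ^+ 2) *: partial_error k l w
                          - (2 * alpha k) *: (z k.-1 w - ys))).

Definition sample_weight k : R := lmax * (alpha k / (r k)%:R) ^+ 2.

Let dist_le_W m w : dot (z m w - ys) (z m w - ys) <= W m w.
Proof.
exact: (distance_le_budget A f mu lmax xs g ys xt alpha Acc r (samples w)
  mu0 scf fg hA hys hc).
Qed.

Lemma noise_meanS k l w :
  noise_mean k l.+1 w = noise_mean k l w + (r k)%:R^-1 *: noise k l w.
Proof. by rewrite /noise_mean big_ord_recr/= scalerDr. Qed.

Lemma partial_errorS k l w :
  partial_error k l.+1 w = partial_error k l w + (r k)%:R^-1 *: (A *m noise k l w).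
Proof. by rewrite /partial_error noise_meanS addrA mulmxDr scalemxAr. Qed.

Lemma partial_budget_end k w : (k < N)%N ->
  partial_budget k.+1 (r k.+1) w = W k.+1 w.
Proof.
move=> kN; rewrite /partial_budget /partial_error -x_error_split//.
by rewrite /W /distance_budget big_ord_recr/= addrA addrA.
Qed.

(** Completing a square shows that the partial budget is nonnegative and that it
    controls the size of its own slope. *)
Lemma partial_budget_ge k l w :
  dot (z k.-1 w - ys - alpha k *: partial_error k l w)
      (z k.-1 w - ys - alpha k *: partial_error k l w)
  + alpha k ^+ 2 / 3 * dot (partial_error k l w) (partial_error k l w)
  <= partial_budget k l w.
Proof.
have := dist_le_W k.-1 w; rewrite /partial_budget.
move: (z k.-1 w - ys) (partial_error k l w) (W k.-1 w) => u e b ub.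
by rewrite !(dotBl, dotBr, dotZl, dotZr) (dotC u e); lra.
Qed.

Lemma partial_budget_ge0 k l w : 0 <= partial_budget k l w.
Proof.
apply: le_trans (partial_budget_ge k l w).
by rewrite addr_ge0 ?dot_ge0// mulr_ge0 ?dot_ge0// divr_ge0 ?sqr_ge0.
Qed.

Lemma budget_slope_bound k l w : (0 < r k)%N ->
  dot (budget_slope k l w) (budget_slope k l w) <=
    8 * sample_weight k * partial_budget k l w.
Proof.
move=> rk; have r0 : 0 < (r k)%:R :> R by rewrite ltr0n.
have := partial_budget_ge k l w; rewrite /budget_slope dotZl dotZr.
set v := (8 / 3 * _) *: _ - _; set u := z k.-1 w - ys; set e := partial_error k l w.
set q := partial_budget k l w => hq.
have hv : dot v v <= 8 * alpha k ^+ 2 * q.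
  have -> : v = (- (2 * alpha k)) *: (u - alpha k *: e) + (2 / 3 * alpha k ^+ 2) *: e.
    by rewrite /v; apply/colP => i; rewrite !mxE; field.
  move: hq; rewrite -/e; move: (u - alpha k *: e) => s hq.
  have sq := dot_ge0 ((2 * alpha k) *: s + (2 / 3 * alpha k ^+ 2) *: e).
  have a2 := sqr_ge0 (alpha k).
  have := ler_wpM2l a2 hq.
  have e0 := mulr_ge0 a2 (mulr_ge0 a2 (dot_ge0 e)).
  rewrite !(dotDl, dotDr, dotZl, dotZr) (dotC e s) in sq *.
  rewrite !expr2 in e0 *; rewrite !expr2 in sq; lra.
have r2 : 0 <= (r k)%:R^-1 * (r k)%:R^-1 :> R by rewrite mulr_ge0 ?invr_ge0.
rewrite mulrA; apply: le_trans (ler_wpM2l r2 (lambda_max_boundT _ _ v hA)) _.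
apply: le_trans (ler_wpM2l r2 (ler_wpM2l (ltW lmax0) hv)) _.
rewrite /sample_weight le_eqVlt; apply/orP; left; apply/eqP; field.
by rewrite gt_eqF.
Qed.

Lemma partial_budget_step k l w : (0 < r k)%N ->
  partial_budget k l.+1 w <= partial_budget k l w
    + (dot (budget_slope k l w) (noise k l w)
       + 4 / 3 * sample_weight k * dot (noise k l w) (noise k l w)).
Proof.
move=> rk; have r0 : 0 < (r k)%:R :> R by rewrite ltr0n.
rewrite /partial_budget partial_errorS /budget_slope.
set u := z k.-1 w - ys; set e := partial_error k l w; set x := noise k l w.
have slope : dot ((r k)%:R^-1 *: (A^T *m ((8 / 3 * alpha k ^+ 2) *: e - (2 * alpha k) *: u))) x
    = (r k)%:R^-1 * (8 / 3 * alpha k ^+ 2 * dot e (A *m x) - 2 * alpha k * dot u (A *m x)).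
  by rewrite dotZl -dot_mulmxr dotBl !dotZl.
rewrite slope; clearbody u e x.
have hx := lambda_max_bound A lmax x hA.
have w0 : 0 <= 4 / 3 * (alpha k / (r k)%:R) ^+ 2 by rewrite mulr_ge0 ?sqr_ge0.
have := ler_wpM2l w0 hx; rewrite /sample_weight.
rewrite !(dotDl, dotDr, dotZl, dotZr) (dotC (A *m x) u) (dotC (A *m x) e).
rewrite !expr2 /=; move: (dot (A *m x) (A *m x)) => xx hxx.
set t := (r k)%:R^-1 in hxx *; clearbody t.
lra.
Qed.

Lemma bias_bound k w : dot (bias_part k w) (bias_part k w) <= delta_y ^+ 2.
Proof.
have h := noisy_mean_bias D f F err delta_y sigma_x oracle (A^T *m yt k w).
have d0 : 0 <= delta_y by apply: le_trans h; exact: enorm_ge0.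
by rewrite -enorm_sq ler_sqr ?nnegrE ?enorm_ge0.
Qed.

Lemma partial_budget_start k w (tau R0 : R) : 0 < R0 -> 4 * tau <= 1 ->
  tau = alpha k.+1 * (Num.sqrt lmax * delta_y) / R0 ->
  partial_budget k.+1 0 w <= (1 + tau) * W k w + 2 * tau * R0 ^+ 2.
Proof.
move=> R00 tau1 tauE; have d0 : 0 <= delta_y.
  apply: le_trans (noisy_mean_bias D f F err delta_y sigma_x oracle 0).
  exact: enorm_ge0.
have t0 : 0 <= tau.
  rewrite tauE divr_ge0 ?(ltW R00)// mulr_ge0 ?(alpha_ge0 _ _ _ hc)//.
  by rewrite mulr_ge0// sqrtr_ge0.
have ta : alpha k.+1 * (Num.sqrt lmax * delta_y) = tau * R0.
  by rewrite tauE divfK ?gt_eqF.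
rewrite /partial_budget /=; set e := partial_error _ _ _; set u := z k w - ys.
have ub : dot u u <= W k w by exact: dist_le_W.
have eb : dot e e <= lmax * delta_y ^+ 2.
  apply: le_trans (lambda_max_bound _ _ _ hA) _; rewrite ler_pM2l//.
  by rewrite /noise_mean big_ord0 scaler0 addr0; exact: bias_bound.
have ae : alpha k.+1 ^+ 2 * dot e e <= tau ^+ 2 * R0 ^+ 2.
  rewrite -exprMn -ta !exprMn sqr_sqrtr ?(ltW lmax0)//.
  by apply: ler_wpM2l => //; exact: sqr_ge0.
have cross : - (2 * alpha k.+1 * dot e u) <= tau * (W k w + R0 ^+ 2).
  have h1 : - (alpha k.+1 * dot e u) <= tau * R0 * enorm u.
    rewrite -mulrN -dotNl.
    have := ler_wpM2l (alpha_ge0 _ _ _ hc k.+1) (cauchy_schwarz (- e) u).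
    move=> /le_trans; apply; rewrite mulrA enormN; apply: ler_wpM2r; first exact: enorm_ge0.
    rewrite -ler_sqr ?nnegrE; last 2 first.
    - by rewrite mulr_ge0 ?enorm_ge0 ?(alpha_ge0 _ _ _ hc).
    - by rewrite mulr_ge0 ?(ltW R00).
    by rewrite !exprMn enorm_sq.
  have h2 : 2 * R0 * enorm u <= W k w + R0 ^+ 2.
    have := sqr_ge0 (R0 - enorm u); rewrite sqrrB enorm_sq; lra.
  have := ler_wpM2l t0 h2; lra.
have t2 : 4 / 3 * (tau ^+ 2 * R0 ^+ 2) <= tau * R0 ^+ 2.
  have R2 : 0 <= R0 ^+ 2 by exact: sqr_ge0.
  rewrite mulrA; apply: ler_wpM2r => //; rewrite expr2; nra.
by lra.
Qed.

Lemma measurable_partial_error k l : (k < N)%N -> (l <= r k.+1)%N ->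
  measurable_coords (partial_error k.+1 l : history xi (past N r k.+1 l) -> _).
Proof.
move=> kN lr; apply: measurable_coordsMl; apply: measurable_coordsD.
  move=> i; apply: (measurable_history_mono xi (past N r k.+1 0) _ _ _ _ _ (measurable_bias k kN i)).
  by apply: past_mono; rewrite eqxx orbT.
by apply: measurable_noise_mean => //; rewrite eqxx leqnn orbT.
Qed.

Lemma measurable_displacement k l : (k < N)%N ->
  measurable_coords ((fun w => z k w - ys) : history xi (past N r k.+1 l) -> _).
Proof.
move=> kN; have [mz _] := measurable_path k (ltnW kN).
apply: measurable_coordsB; last exact: measurable_coords_cst.
move=> i; apply: (measurable_history_mono xi (past N r k.+1 0) _ _ _ _ _ (mz i)).
by apply: past_mono; rewrite eqxx orbT.
Qed.

Lemma measurable_partial_budget k l : (1 <= k <= N)%N -> (l <= r k)%N ->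
  measurable_fun setT (partial_budget k l : history xi (past N r k l) -> R).
Proof.
case: k => // k kN lr.
have me := measurable_partial_error k l kN lr.
have mu' := measurable_displacement k l kN.
apply: measurable_funD; last by apply: measurable_funM => //; exact: measurable_dot.
apply: measurable_funB; last by apply: measurable_funM => //; exact: measurable_dot.
apply: (measurable_history_mono xi (past N r k.+1 0) _ _ _ _ _ (measurable_budget k (ltnW kN))).
by apply: past_mono; rewrite eqxx orbT.
Qed.

Lemma measurable_budget_slope k l : (1 <= k <= N)%N -> (l < r k)%N ->
  measurable_coords (budget_slope k l : history xi (past N r k l) -> _).
Proof.
case: k => // k kN lr; apply: measurable_coordsZ => //; apply: measurable_coordsMl.
apply: measurable_coordsB; apply: measurable_coordsZ => //.
  by apply: measurable_partial_error => //; exact: ltnW.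
exact: measurable_displacement.
Qed.

Lemma measurable_query k : (1 <= k <= N)%N ->
  measurable_coords ((fun w => A^T *m yt k w) : history xi (past N r k 0) -> _).
Proof. by case: k => // k kN; apply: measurable_coordsMl; exact: measurable_yt. Qed.

Let outer k l (T : measure_display) (U : measurableType T) (v : Omega -> U) :
  measurable_fun setT (v : history xi (past N r k l) -> U) -> measurable_fun setT v.
Proof.
by apply: (measurable_from_history P D used xi iid); exact: past_used.
Qed.

Definition noise_sum m w : 'cV[R]_n :=
  \sum_(k < m) alpha k.+1 *: noise_mean k.+1 (r k.+1) w.

Definition partial_noise_sum k l w : 'cV[R]_n :=
  noise_sum k.-1 w + alpha k *: noise_mean k l w.

Lemma partial_noise_sum_end k w :
  partial_noise_sum k.+1 (r k.+1) w = noise_sum k.+1 w.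
Proof. by rewrite /noise_sum big_ord_recr. Qed.

Lemma measurable_noise_sum m k l : (m <= N)%N -> (m < k)%N ->
  measurable_coords (noise_sum m : history xi (past N r k l) -> _).
Proof.
move=> mN mk; apply: measurable_coords_sum => i; apply: measurable_coordsZ => //.
apply: measurable_noise_mean => //; first exact: leq_trans (ltn_ord i) mN.
by rewrite (leq_ltn_trans (ltn_ord i) mk).
Qed.

Lemma measurable_partial_noise_sum k l : (1 <= k <= N)%N -> (l <= r k)%N ->
  measurable_coords (partial_noise_sum k l : history xi (past N r k l) -> _).
Proof.
case: k => // k kN lr; apply: measurable_coordsD.
  by apply: measurable_noise_sum => //; exact: ltnW.
apply: measurable_coordsZ => //; apply: measurable_noise_mean => //.
by rewrite eqxx leqnn orbT.
Qed.

Section Tails.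
Variables (ell rad : R).
Hypotheses (N_gt0 : (0 < N)%N) (ell1 : 1 <= ell) (rad0 : 0 < rad).
Hypothesis batch_large : forall k, (1 <= k <= N)%N ->
  1024 * ell * (Acc N * alpha k * (lmax * sigma_x ^+ 2)) <= rad * (r k)%:R.

Let AN : 0 < Acc N.
Proof. by case: N N_gt0 => // M _; exact: (AccS_gt0 _ _ _ hc). Qed.

Let lam : R := 2 * ell / rad.
Let lam0 : 0 < lam.
Proof. by rewrite divr_gt0// mulr_gt0// (lt_le_trans ltr01). Qed.

Let progress k : R := alpha k / Acc N.

Let progress_sum : \sum_(k < N) progress k.+1 <= 1.
Proof. by rewrite -mulr_suml -(Acc_sum _ _ _ hc) mulfV ?gt_eqF. Qed.

Let progress_ge0 k : 0 <= progress k.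
Proof. by rewrite divr_ge0 ?(alpha_ge0 _ _ _ hc)// ltW. Qed.

Let weight_ge0 k : 0 <= sample_weight k.
Proof. by rewrite mulr_ge0 ?sqr_ge0// ltW. Qed.

Let weight_small k : (1 <= k <= N)%N ->
  512 * lam * ((r k)%:R * (sample_weight k * sigma_x ^+ 2)) <= progress k.
Proof.
move=> kN; have rk : 0 < (r k)%:R :> R by rewrite ltr0n; exact: r_gt0.
have c0 : 0 <= alpha k / (Acc N * rad * (r k)%:R).
  by rewrite divr_ge0 ?(alpha_ge0 _ _ _ hc)// !mulr_ge0// ltW.
have := ler_wpM2l c0 (batch_large k kN).
rewrite [leRHS](_ : _ = progress k); last first.
  by rewrite /progress; field; rewrite !gt_eqF.
apply: le_trans; rewrite le_eqVlt; apply/orP; left; apply/eqP.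
by rewrite /lam /sample_weight; field; rewrite !gt_eqF.
Qed.

Let tail_exponent : 1 / 64 - 2 * ell <= - ell.
Proof. by have := ell1; lra. Qed.

(** The threshold [4 * enorm ys ^+ 2] exceeds the exponent [3 * enorm ys ^+ 2] that
    [process_exp_moment] allows, and [lam] turns the difference into [2 * ell]. *)
Lemma budget_tail m : (m <= N)%N -> rad = enorm ys ^+ 2 ->
  0 < enorm ys -> 4 * (Num.sqrt lmax * delta_y) * Acc N <= enorm ys ->
  (P [set w | (4 * enorm ys ^+ 2 < W m w)%R] <= (expR (- ell))%:E)%E.
Proof.
move=> mN radE R00 hd; have d0 : 0 <= delta_y.
  apply: le_trans (noisy_mean_bias D f F err delta_y sigma_x oracle 0).
  exact: enorm_ge0.
pose tau k := alpha k * (Num.sqrt lmax * delta_y) / enorm ys.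
have tau0 k : 0 <= tau k.
  rewrite divr_ge0 ?(ltW R00)// mulr_ge0 ?(alpha_ge0 _ _ _ hc)//.
  by rewrite mulr_ge0// sqrtr_ge0.
have tau_p k : 4 * tau k <= progress k.
  have c0 : 0 <= alpha k / (enorm ys * Acc N).
    by rewrite divr_ge0 ?(alpha_ge0 _ _ _ hc)// mulr_ge0// ltW.
  have := ler_wpM2l c0 hd.
  rewrite [leRHS](_ : _ = progress k); last first.
    by rewrite /progress; field; rewrite !gt_eqF.
  apply: le_trans; rewrite le_eqVlt; apply/orP; left; apply/eqP.
  by rewrite /tau; field; rewrite !gt_eqF.
have mW' k : (k <= N)%N -> measurable_fun setT (W k).
  by move=> kN; apply: (outer k.+1 0); exact: measurable_budget.
have moment : (\int[P]_w (expR (lam * W m w))%:E <=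
    (expR (2 * lam * enorm ys ^+ 2 + (lam * enorm ys ^+ 2 + 1 / 64)))%:E)%E.
  apply: (process_exp_moment D f F err delta_y sigma_x oracle sigma0 P N r xi iid
    r_gt0 W partial_budget budget_slope (fun k w => A^T *m yt k w)
    tau sample_weight progress) => //.
  - exact: sqr_ge0.
  - exact: measurable_partial_budget.
  - exact: measurable_budget_slope.
  - exact: measurable_query.
  - by move=> w; rewrite /W /distance_budget big_ord0 addr0.
  - by move=> k w _; apply: le_trans (dist_le_W k w); exact: dot_ge0.
  - by move=> k l w _; exact: partial_budget_ge0.
  - move=> k w kN; apply: partial_budget_start => //.
    apply: le_trans (tau_p k.+1) _; apply: le_trans _ progress_sum.
    rewrite (bigD1 (Ordinal kN))//= lerDl; apply: sumr_ge0 => i _.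
    exact: progress_ge0.
  - by move=> k l w kN lr; apply: partial_budget_step; exact: r_gt0.
  - by case=> // k w kN; rewrite partial_budget_end.
  - by move=> k l w kN lr; apply: budget_slope_bound; exact: r_gt0.
apply: le_trans (exp_moment_tail P lam _ _ (W m) lam0 (mW' m mN) moment) _.
rewrite lee_fin ler_expR -radE.
have lr : lam * rad = 2 * ell by rewrite /lam divfK ?gt_eqF.
by have := ell1; lra.
Qed.

(** The squared norm of the noise sum obeys the same recursion as the distance
    budget, without bias and starting from [0]. *)
Lemma noise_tail :
  (P [set w | (rad < lmax * dot (noise_sum N w) (noise_sum N w))%R]
     <= (expR (- ell))%:E)%E.
Proof.
have d0 : 0 <= delta_y.
  apply: le_trans (noisy_mean_bias D f F err delta_y sigma_x oracle 0).
  exact: enorm_ge0.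
pose WV m w := lmax * dot (noise_sum m w) (noise_sum m w).
pose QV k l w := lmax * dot (partial_noise_sum k l w) (partial_noise_sum k l w).
pose hV k l w := (2 * lmax * (alpha k / (r k)%:R)) *: partial_noise_sum k l w.
have mWV m : (m <= N)%N -> measurable_fun setT (WV m).
  move=> mN; apply: measurable_funM => //; apply: (outer m.+1 0).
  by apply: measurable_dot; apply: measurable_noise_sum.
have moment : (\int[P]_w (expR (lam * WV N w))%:E <=
    (expR (2 * lam * 0 + (lam * 0 + 1 / 64)))%:E)%E.
  apply: (process_exp_moment D f F err delta_y sigma_x oracle sigma0 P N r xi iid
    r_gt0 WV QV hV (fun k w => A^T *m yt k w) (fun=> 0) sample_weight progress) => //.
  - move=> k l kN lr; apply: measurable_funM => //.
    by apply: measurable_dot; exact: measurable_partial_noise_sum.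
  - move=> k l kN lr; apply: measurable_coordsZ => //.
    by apply: measurable_partial_noise_sum => //; exact: ltnW.
  - exact: measurable_query.
  - by move=> w; rewrite /WV /noise_sum big_ord0 dot0l mulr0.
  - by move=> k w _; rewrite mulr_ge0 ?dot_ge0// ltW.
  - by move=> k l w _; rewrite mulr_ge0 ?dot_ge0// ltW.
  - move=> k w kN; rewrite /QV /partial_noise_sum /= /noise_mean big_ord0.
    by rewrite !scaler0 !addr0 mul1r !mulr0 addr0.
  - move=> k l w kN lr; rewrite /QV /hV.
    have -> : partial_noise_sum k l.+1 w =
        partial_noise_sum k l w + (alpha k / (r k)%:R) *: noise k l w.
      by rewrite /partial_noise_sum noise_meanS scalerDr addrA -[alpha k / _ *: _]scalerA.
    rewrite -/(noise k l w); move: (partial_noise_sum k l w) (noise k l w) => v x.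
    rewrite !(dotDl, dotDr, dotZl, dotZr) (dotC x v).
    have := mulr_ge0 (weight_ge0 k) (dot_ge0 x); rewrite /sample_weight expr2; lra.
  - by case=> // k w kN; rewrite /WV /QV partial_noise_sum_end.
  - move=> k l w kN lr; rewrite /hV dotZl dotZr /QV.
    have := mulr_ge0 (mulr_ge0 (weight_ge0 k) (ltW lmax0)) (dot_ge0 (partial_noise_sum k l w)).
    by rewrite /sample_weight expr2; lra.
  - by move=> k; rewrite mulr0.
apply: le_trans (exp_moment_tail P lam rad _ (WV N) lam0 (mWV N (leqnn N)) moment) _.
rewrite lee_fin ler_expR mulr0 add0r mulr0 add0r.
by rewrite {1}/lam divfK ?gt_eqF.
Qed.

End Tails.

Lemma x_error_sum w :
  enorm (\sum_(k < N) alpha k.+1 *: x_error A f xt alpha Acc r (samples w) k.+1)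
    <= enorm (noise_sum N w) + Acc N * delta_y.
Proof.
have -> : \sum_(k < N) alpha k.+1 *: x_error A f xt alpha Acc r (samples w) k.+1 =
    noise_sum N w + \sum_(k < N) alpha k.+1 *: bias_part k.+1 w.
  rewrite /noise_sum -big_split/=; apply: eq_bigr => k _.
  by rewrite x_error_split ?ltn_ord// -scalerDr addrC.
apply: le_trans (enormD _ _) _; rewrite lerD2l.
apply: le_trans (enorm_sum _ _ _) _; rewrite (Acc_sum _ _ _ hc) mulr_suml.
apply: ler_sum => k _; rewrite enormZ ger0_norm ?(alpha_ge0 _ _ _ hc)//.
apply: ler_wpM2l; first exact: (alpha_ge0 _ _ _ hc).
exact: (noisy_mean_bias D f F err delta_y sigma_x oracle).
Qed.

Lemma measurable_path_x k : (k < N)%N -> measurable_coords (xo k.+1).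
Proof.
move=> kN.
have me : measurable_coords (fun w => x_error A f xt alpha Acc r (samples w) k.+1).
  by move=> i; apply: (outer k.+2 0); exact: measurable_x_error.
have my : measurable_coords (yt k.+1).
  by move=> i; apply: (outer k.+1 0); exact: measurable_yt.
rewrite (_ : xo k.+1 = fun w => x_error A f xt alpha Acc r (samples w) k.+1
   + dual_argmax f (A^T *m yt k.+1 w)).
  apply: measurable_coordsD => //; apply: measurable_dual_argmax.
  exact: measurable_coordsMl.
by apply/funext => w; rewrite /x_error /exact_point subrK.
Qed.

Definition accurate_outputs (eps rho : R) : set Omega :=
  [set w | let xN := spdstm_x A xt alpha Acc r (samples w) N in
           let yN := spdstm_y A xt alpha Acc r (samples w) N in
    [/\ f xN - f xs <= f xN + psi A f yN, f xN + psi A f yN <= eps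
      & enorm (A *m xN) <= rho]].

Lemma measurable_accurate_outputs (eps rho : R) :
  measurable (accurate_outputs eps rho).
Proof.
pose xN w := spdstm_x A xt alpha Acc r (samples w) N.
pose yN w := spdstm_y A xt alpha Acc r (samples w) N.
have a0 : alpha 0%N = 0 by case: hc.
have mx : measurable_coords xN.
  rewrite (_ : xN = fun w => (Acc N)^-1 *: \sum_(k < N) alpha k.+1 *: xo k.+1 w).
    apply: measurable_coordsZ => //; apply: measurable_coords_sum => k.
    by apply: measurable_coordsZ => //; exact: measurable_path_x.
  by apply/funext => w; exact: spdstm_xE.
have my : measurable_coords yN.
  have [_ my] := measurable_path N (leqnn N).
  by move=> i; apply: (outer N.+1 0); exact: my.
have mfx : measurable_fun setT (fun w => f (xN w)).
  apply: measurable_continuous_comp => //; apply: convex_continuous.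
  exact: (convex_f f mu).
have mpsi : measurable_fun setT (fun w => psi A f (yN w)).
  apply: measurable_continuous_comp => //.
  exact: (psi_continuous A f mu xs g mu0 scf fg).
have mAx : measurable_fun setT (fun w => enorm (A *m xN w)).
  rewrite (_ : (fun w => _) = fun w => Num.sqrt (dot (A *m xN w) (A *m xN w))).
    apply: measurableT_comp; first by apply: continuous_measurable_fun; exact: sqrt_continuous.
    by apply: measurable_dot; exact: measurable_coordsMl.
  by apply/funext => w; rewrite /enorm dot_sqE.
have le_set (u v : Omega -> R) : measurable_fun setT u -> measurable_fun setT v ->
    measurable [set w | u w <= v w].
  move=> mu' mv; have mle := measurable_fun_ler mu' mv.
  by have := mle measurableT [set true] I; rewrite setTI.
rewrite (_ : accurate_outputs _ _ = [set w | f (xN w) - f xs <= f (xN w) + psi A f (yN w)]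
    `&` ([set w | f (xN w) + psi A f (yN w) <= eps]
    `&` [set w | enorm (A *m xN w) <= rho])).
  apply: measurableI; first by apply: le_set; [exact: measurable_funB|exact: measurable_funD].
  apply: measurableI; apply: le_set => //; exact: measurable_funD.
by apply/seteqP; split => w /=; [case|move=> [? []]].
Qed.

(** The union bound over the distance budgets of all iterations and the final
    noise, each of which fails with probability at most [expR (- ell)]. *)
Theorem high_probability_accuracy (Ry eps kl L_f R_f ell beta : R) :
  (0 < N)%N -> 0 < enorm ys -> 1 <= kl -> enorm ys <= Ry ->
  L_f <= kl * (Num.sqrt lmax * Ry) ->
  4 * Num.max (Ry / (Acc N * Num.sqrt lmax))
        (Num.max (Num.sqrt lmax * Ry / mu) (enorm xs)) <= R_f ->
  lipschitz_on_ball L_f R_f f ->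
  11 / 2 * Ry ^+ 2 <= Acc N * eps ->
  1 <= ell -> N%:R * expR (- ell) <= beta ->
  (forall k, (1 <= k <= N)%N ->
    1024 * ell * (Acc N * alpha k * (lmax * sigma_x ^+ 2)) <=
      (enorm ys / (2 * kl)) ^+ 2 * (r k)%:R) ->
  4 * (Num.sqrt lmax * delta_y) * Acc N <= enorm ys / kl ->
  ((1 - 2 * beta)%:E <= P (accurate_outputs eps (eps / Ry)))%E.
Proof.
move=> N0 R00 kl1 ysRy Lf hRf lipf hN ell1 hbeta hbatch hd.
have mgood := measurable_accurate_outputs eps (eps / Ry).
have kl0 : 0 < kl by apply: lt_le_trans kl1.
set rad := (enorm ys / (2 * kl)) ^+ 2 in hbatch.
have rad0 : 0 < rad by rewrite exprn_gt0// divr_gt0// mulr_gt0.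
have R02 : 0 < enorm ys ^+ 2 by rewrite exprn_gt0.
have ys_kl : enorm ys / kl <= enorm ys.
  by rewrite ler_pdivrMr// ler_peMr// ltW.
have rad_le : rad <= enorm ys ^+ 2.
  rewrite /rad ler_sqr ?nnegrE ?divr_ge0 ?mulr_ge0 ?(ltW R00) ?(ltW kl0)//.
  by rewrite ler_pdivrMr ?mulr_gt0// ler_peMr ?(ltW R00)//; lra.
have hbatch' k : (1 <= k <= N)%N ->
    1024 * ell * (Acc N * alpha k * (lmax * sigma_x ^+ 2)) <= enorm ys ^+ 2 * (r k)%:R.
  by move=> kN; apply: le_trans (hbatch k kN) _; exact: ler_wpM2r.
pose bad1 k := [set w | 4 * enorm ys ^+ 2 < W k.+1 w].
pose bad2 := [set w | rad < lmax * dot (noise_sum N w) (noise_sum N w)].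
have lt_set (u v : Omega -> R) : measurable_fun setT u -> measurable_fun setT v ->
    measurable [set w | u w < v w].
  move=> mu' mv; have mlt := measurable_fun_ltr mu' mv.
  by have := mlt measurableT [set true] I; rewrite setTI.
have mbad1 k : (k < N)%N -> measurable (bad1 k).
  move=> kN; apply: lt_set => //.
  by apply: (outer k.+2 0); exact: measurable_budget.
have mbad2 : measurable bad2.
  apply: lt_set => //; apply: measurable_funM => //; apply: (outer N.+1 0).
  by apply: measurable_dot; apply: measurable_noise_sum.
pose Bad1 := \big[setU/set0]_(k < N) bad1 k.
have mBad1 : measurable Bad1 by apply: bigsetU_measurable => k _; exact: mbad1.
have PBad1 : (P Bad1 <= (N%:R * expR (- ell))%:E)%E.
  apply: le_trans (_ : \sum_(k < N) P (bad1 k) <= _)%E.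
    exact: Boole_inequality.
  apply: (@le_trans _ _ (\sum_(k < N) (expR (- ell))%:E)%E).
    apply: lee_sum => k _; apply: (budget_tail ell (enorm ys ^+ 2)) => //.
    by apply: le_trans hd _.
  by rewrite sumEFin lee_fin sumr_const card_ord mulr_natl.
have PBad2 : (P bad2 <= (expR (- ell))%:E)%E by exact: noise_tail.
have sub : ~` (Bad1 `|` bad2) `<=` accurate_outputs eps (eps / Ry).
  move=> w; rewrite setCU => -[nb1 nb2].
  apply: (accuracy_of_small_errors A f mu lmax xs g ys xt alpha Acc r (samples w)
    mu0 lmax0 scf fg hA hxs hys hc N Ry eps kl L_f R_f) => //.
  - exact: lt_le_trans ysRy.
  - case=> [_|k kN].
      by rewrite /distance_budget big_ord0 addr0; lra.
    rewrite leNgt; apply/negP => kbad; apply: nb1.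
    by rewrite /Bad1 -bigcup_mkord; exists k.
  - have noise_le : Num.sqrt lmax * enorm (noise_sum N w) <= enorm ys / (2 * kl).
      rewrite -ler_sqr ?nnegrE ?mulr_ge0 ?sqrtr_ge0 ?enorm_ge0//; last first.
        by rewrite invr_ge0 mulr_ge0 ?(ltW kl0).
      rewrite exprMn sqr_sqrtr ?(ltW lmax0)// enorm_sq leNgt.
      by apply/negP => h; exact: nb2.
    have := ler_wpM2l (sqrtr_ge0 lmax) (x_error_sum w).
    have klE : enorm ys / kl = 2 * (enorm ys / (2 * kl)).
      by field; rewrite gt_eqF.
    have := mulr_ge0 (sqrtr_ge0 lmax) (enorm_ge0 (noise_sum N w)).
    by lra.
have PBad : (P (Bad1 `|` bad2) <= (2 * beta)%:E)%E.
  apply: le_trans (measureU2 _ mBad1 mbad2) _.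
  apply: le_trans (leeD PBad1 PBad2) _; rewrite -EFinD lee_fin.
  have : expR (- ell) <= N%:R * expR (- ell).
    by rewrite ler_peMl ?expR_ge0// ler1n.
  by lra.
have mB : measurable (Bad1 `|` bad2) by exact: measurableU.
apply: (@le_trans _ _ (P (~` (Bad1 `|` bad2)))).
  rewrite probability_setC//; rewrite -(fineK (fin_num_measure P _ mB)) in PBad *.
  by rewrite -EFinB lee_fin lerD2l lerN2 -lee_fin.
by apply: le_measure => //; rewrite inE//; exact: measurableC.
Qed.

End StochasticPath.

(** * Iteration and sample complexity *)

(** [expR (1 / 2) <= 2], because [1 - 1 / 2 <= expR (- (1 / 2))]. *)
Lemma ln_ge1 (R : realType) (t : R) : 4 <= t -> 1 <= ln t.
Proof.
move=> t4; have t0 : 0 < t by lra.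
rewrite -ler_expR lnK ?posrE//; apply: le_trans t4.
have -> : 1 = 1 / 2 + 1 / 2 :> R by field.
have h := expR_ge1Dx (- (1 / 2) : R); rewrite expRN in h.
have e0 := expR_gt0 (1 / 2 : R).
have {h} : expR (1 / 2) <= 2 :> R.
  have := ler_wpM2l (ltW e0) h; rewrite mulfV ?gt_eqF//; lra.
by rewrite expRD => h; nra.
Qed.

Lemma oracle_calls_min_batch_le (R : realType) (Lt s Chat eps beta : R) (N : nat) :
  (0 < N)%N -> 0 < Lt -> 0 < Chat -> 0 < eps -> 0 <= ln (N%:R / beta) ->
  (oracle_calls (min_batch Lt s Chat eps beta N) N)%:R <=
    2 * N%:R + s ^+ 2 / (Lt * Chat * eps) * ln (N%:R / beta) * N%:R ^+ 2.
Proof.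
move=> N0 Lt0 C0 e0 l0; set l := ln _ in l0 *.
pose c := s ^+ 2 / (2 * Lt * Chat * eps) * l.
have d0 : 0 < 2 * Lt * Chat * eps by rewrite !mulr_gt0.
have c0 : 0 <= c := mulr_ge0 (divr_ge0 (sqr_ge0 _) (ltW d0)) l0.
have one k : (min_batch Lt s Chat eps beta N k)%:R <= 2 + c * k.+1%:R.
  rewrite /min_batch natr_absz.
  have bE : batch_bound Lt s Chat eps beta N k = Num.max 1 (c * k.+1%:R).
    rewrite /batch_bound -/l; congr Num.max; rewrite /c; field.
    by rewrite !gt_eqF.
  rewrite bE; set b := Num.max _ _.
  have b1 : 1 <= b by rewrite le_max lexx.
  have cb : 0 <= Num.ceil b by rewrite ceil_ge0 (lt_le_trans _ b1)// ltrN10.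
  rewrite ger0_norm//; have := ceilB1_lt b.
  have : b <= 1 + c * k.+1%:R.
    have ck : 0 <= c * k.+1%:R by rewrite mulr_ge0.
    by rewrite ge_max lerDl ck lerDr ler01.
  by rewrite intrD; lra.
rewrite /oracle_calls natr_sum.
apply: (@le_trans _ _ (\sum_(1 <= k < N.+1) (2 + c * k.+1%:R))).
  by apply: ler_sum => k _; exact: one.
have -> : \sum_(1 <= k < N.+1) (2 + c * k.+1%:R) =
    2 * N%:R + c * (N%:R * (N%:R + 3) / 2).
  elim: (N) => [|M ih]; first by rewrite big_geq// !mul0r !mulr0 addr0.
  by rewrite big_nat_recr//= ih -!natr1; field.
rewrite lerD2l.
have -> : s ^+ 2 / (Lt * Chat * eps) * l * N%:R ^+ 2 = c * (2 * N%:R ^+ 2).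
  by rewrite /c; field; rewrite !gt_eqF.
apply: ler_wpM2l => //; rewrite expr2.
have : 1 <= N%:R :> R by rewrite ler1n.
by nra.
Qed.

Lemma natM_natS_le (R : realType) (N : nat) : (0 < N)%N ->
  N%:R * N.+1%:R <= 2 * N%:R ^+ 2 :> R.
Proof.
move=> N1; have : 1 <= N%:R :> R by rewrite ler1n.
by rewrite -natr1 expr2; nra.
Qed.

Lemma sqr_natS_le (R : realType) (N : nat) : (0 < N)%N ->
  N.+1%:R ^+ 2 <= 4 * N%:R ^+ 2 :> R.
Proof.
move=> N1; have : 1 <= N%:R :> R by rewrite ler1n.
by rewrite -natr1 !expr2; nra.
Qed.

(** The batch sizes grow linearly in [k], so that they add up to a multiple of
    [N ^+ 2], that is, of [Z ^+ 2]; rounding up contributes at most [2 * N]. *)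
Lemma oracle_calls_softO (R : realType) (H S Chat eps beta mu M_f lmax lmin
    sigma_x : R) (N : nat) :
  0 < H -> 0 < S -> S ^+ 2 = 2 * H -> 0 < Chat -> 0 < eps -> 0 < beta ->
  0 < mu -> 0 < lmax -> 0 < lmin -> (0 < N)%N -> 0 <= ln (N%:R / beta) ->
  let Z := Num.sqrt (M_f ^+ 2 / (mu * eps) * (lmax / lmin)) in
  N%:R <= S * Z ->
  (oracle_calls (min_batch (2 * (lmax / mu)) (Num.sqrt lmax * sigma_x) Chat eps
     beta N) N)%:R <=
  (2 * S + H / Chat * (1 + `|ln S|)) *
    Num.max (sigma_x ^+ 2 * M_f ^+ 2 / eps ^+ 2 * (lmax / lmin)
               * soft_ln (1 / beta * Z)) Z.
Proof.
move=> H0 S0 S2 C0 eps0 beta0 mu0 lmax0 lmin0 N0 l0 Z NSZ.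
have Lt0 : 0 < 2 * (lmax / mu) by rewrite mulr_gt0// divr_gt0.
have Z2 : Z ^+ 2 = M_f ^+ 2 / (mu * eps) * (lmax / lmin).
  by rewrite sqr_sqrtr// mulr_ge0 ?divr_ge0 ?sqr_ge0 ?mulr_ge0// ltW.
have NR : 0 < N%:R :> R by rewrite ltr0n.
have Z0 : 0 < Z by rewrite -(pmulr_rgt0 _ S0); exact: lt_le_trans NSZ.
apply: le_trans (oracle_calls_min_batch_le _ _ _ _ _ _ _ N0 Lt0 C0 eps0 l0) _.
set M := Num.max _ _; have MZ : Z <= M by rewrite le_max lexx orbT.
have lnle : ln (N%:R / beta) <= (1 + `|ln S|) * soft_ln (1 / beta * Z).
  have bZ : 0 < 1 / beta * Z by rewrite mulr_gt0// divr_gt0.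
  have Nb0 : 0 < N%:R / beta by rewrite divr_gt0.
  apply: (@le_trans _ _ (ln (S * (1 / beta * Z)))).
    have SZb : N%:R / beta <= S * (1 / beta * Z).
      rewrite [leRHS](_ : _ = S * Z / beta); last by ring.
      by rewrite ler_pM2r ?invr_gt0.
    by rewrite ler_ln// posrE// mulr_gt0.
  rewrite lnM ?posrE//.
  have s1 : 1 <= soft_ln (1 / beta * Z) by rewrite le_max lexx.
  have s2 : ln (1 / beta * Z) <= soft_ln (1 / beta * Z).
    by rewrite le_max lexx orbT.
  rewrite mulrDl [1 * soft_ln _]mul1r [leRHS]addrC; apply: lerD => //.
  by apply: le_trans (ler_norm (ln S)) _; rewrite ler_peMr.
have cs : 0 <= (Num.sqrt lmax * sigma_x) ^+ 2 / (2 * (lmax / mu) * Chat * eps).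
  exact: divr_ge0 (sqr_ge0 _) (ltW (mulr_gt0 (mulr_gt0 Lt0 C0) eps0)).
have second : (Num.sqrt lmax * sigma_x) ^+ 2 / (2 * (lmax / mu) * Chat * eps)
    * ln (N%:R / beta) * N%:R ^+ 2 <= H / Chat * (1 + `|ln S|) * M.
  apply: (@le_trans _ _ ((Num.sqrt lmax * sigma_x) ^+ 2
      / (2 * (lmax / mu) * Chat * eps)
      * ((1 + `|ln S|) * soft_ln (1 / beta * Z)) * (2 * H * Z ^+ 2))).
    apply: (ler_pM (mulr_ge0 cs l0) (sqr_ge0 _)); first exact: (ler_wpM2l cs lnle).
    by rewrite -S2 -exprMn ler_sqr ?nnegrE// mulr_ge0// ltW.
  rewrite Z2 [leLHS](_ : _ = H / Chat * (1 + `|ln S|) *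
    (sigma_x ^+ 2 * M_f ^+ 2 / eps ^+ 2 * (lmax / lmin)
       * soft_ln (1 / beta * Z))).
    have c0 : 0 <= H / Chat * (1 + `|ln S|).
      by apply: mulr_ge0; [rewrite divr_ge0// ltW|exact: addr_ge0].
    by apply: ler_wpM2l => //; rewrite le_max lexx.
  rewrite exprMn sqr_sqrtr ?(ltW lmax0)//.
  by field; rewrite !gt_eqF.
have first' : 2 * N%:R <= 2 * S * M.
  by rewrite -mulrA ler_pM2l//; apply: le_trans NSZ _; rewrite ler_pM2l.
by apply: le_trans (lerD first' second) _; rewrite -mulrDl.
Qed.

Section ParameterChoice.
Context {R : realType}.
Variables (Lt : R) (alpha Acc : nat -> R) (H R0 eps : R) (N : nat).
Hypotheses (Lt0 : 0 < Lt) (hc : spdstm_coefs Lt alpha Acc).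
Hypotheses (N1 : (0 < N)%N) (eps0 : 0 < eps) (R00 : 0 < R0).

Let NR : 0 < N%:R :> R. Proof. by rewrite ltr0n. Qed.

Lemma Acc_eps_le : eps <= H * Lt * R0 ^+ 2 / N%:R ^+ 2 ->
  Acc N * eps <= H * R0 ^+ 2 / 2.
Proof.
rewrite ler_pdivlMr ?exprn_gt0// => epsN.
have L4 : 0 < 4 * Lt by rewrite mulr_gt0.
rewrite -(ler_pM2l L4).
have h1 := ler_wpM2r (ltW eps0) (Acc_le Lt alpha Acc Lt0 hc N).
have h3 := ler_wpM2r (ltW eps0) (natM_natS_le R N N1).
by lra.
Qed.

(** For the largest admissible number of iterations, the accuracy [eps] is
    comparable to the rate [Lt * R0 ^+ 2 / N ^+ 2] of the noiseless method. *)
Lemma Acc_eps_ge : H * Lt * R0 ^+ 2 < eps * N.+1%:R ^+ 2 ->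
  H * R0 ^+ 2 / 32 <= Acc N * eps.
Proof.
move=> epsX.
have h2 := ler_wpM2r (ltW eps0) (Acc_ge Lt alpha Acc Lt0 hc N).
apply: le_trans h2; rewrite [leRHS]mulrAC ler_pdivlMr ?mulr_gt0//.
have := ler_wpM2l (ltW eps0) (sqr_natS_le R N N1); lra.
Qed.

(** The batch bound is proportional to [alpha k], hence so is the variance budget
    of batch [k], and these add up to a multiple of [Acc N * eps], which is at
    most a multiple of [R0 ^+ 2] for admissible [N]. *)
Lemma batch_size_sufficient (kl Chat ell lmax sigma_x beta : R) (k m : nat) :
  0 < kl -> 0 < H -> Chat = (2048 * kl ^+ 2 * H)^-1 -> 0 < lmax ->
  ell = ln (N%:R / beta) -> 0 <= ell ->
  eps <= H * Lt * R0 ^+ 2 / N%:R ^+ 2 ->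
  batch_bound Lt (Num.sqrt lmax * sigma_x) Chat eps beta N k <= m%:R ->
  1024 * ell * (Acc N * alpha k * (lmax * sigma_x ^+ 2)) <=
    (R0 / (2 * kl)) ^+ 2 * m%:R.
Proof.
move=> kl0 H0 ChatE lmax0 ellE ell0 epsN.
rewrite /batch_bound ge_max => /andP[_ hrk].
apply: le_trans (ler_wpM2l (sqr_ge0 _) hrk).
have ak : alpha k <= k.+1%:R / (2 * Lt).
  apply: le_trans (alpha_le Lt alpha Acc Lt0 hc k) _.
  by rewrite ler_pM2r ?invr_gt0 ?mulr_gt0// ler_nat.
have sp : (Num.sqrt lmax * sigma_x) ^+ 2 = lmax * sigma_x ^+ 2.
  by rewrite exprMn sqr_sqrtr// ltW.
rewrite sp -ellE; move: (k.+1%:R / _) ak => t ak.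
have lst : 0 <= lmax * sigma_x ^+ 2 * ell :=
  mulr_ge0 (mulr_ge0 (ltW lmax0) (sqr_ge0 sigma_x)) ell0.
have a0 := alpha_ge0 Lt alpha Acc hc k.
have Ae0 := mulr_ge0 (Acc_ge0 Lt alpha Acc hc N) (ltW eps0).
have h := ler_pM Ae0 a0 (Acc_eps_le epsN) ak.
have cc : 0 <= lmax * sigma_x ^+ 2 * ell * (1024 / eps) :=
  mulr_ge0 lst (divr_ge0 (ler0n R 1024) (ltW eps0)).
have := ler_wpM2l cc h.
rewrite [leLHS](_ : _ = 1024 * ell * (Acc N * alpha k * (lmax * sigma_x ^+ 2))).
  move=> /le_trans; apply; rewrite le_eqVlt; apply/orP; left; apply/eqP.
  by rewrite ChatE; field; rewrite !gt_eqF.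
by field; rewrite gt_eqF.
Qed.

Lemma oracle_bias_small (kl b : R) : 0 < kl ->
  b <= kl^-1 * Lt * R0 / N.+1%:R ^+ 2 -> 4 * b * Acc N <= R0 / kl.
Proof.
move=> kl0 hb; have A0 := Acc_ge0 Lt alpha Acc hc N.
have NS : 0 < N.+1%:R :> R by rewrite ltr0n.
rewrite -mulrA; apply: (@le_trans _ _ (4 * (kl^-1 * Lt * R0 / N.+1%:R ^+ 2 * Acc N))).
  by rewrite ler_pM2l//; exact: ler_wpM2r.
have -> : 4 * (kl^-1 * Lt * R0 / N.+1%:R ^+ 2 * Acc N) =
    R0 / kl * (4 * Lt * Acc N / N.+1%:R ^+ 2).
  by field; rewrite !gt_eqF.
rewrite ler_piMr ?divr_ge0 ?(ltW kl0) ?(ltW R00)//.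
rewrite ler_pdivrMr ?exprn_gt0// mul1r.
apply: le_trans (Acc_le Lt alpha Acc Lt0 hc N) _.
by rewrite expr2 ler_pM2r// ler_nat.
Qed.

End ParameterChoice.

Theorem theorem5p1 (R : realType) :
  exists C_R : R, 0 < C_R /\
  forall kappa_R : R,
  exists (H C_N : R) (p_N : nat), 0 < H /\ 0 < C_N /\
  forall kappa_L : R,
  exists (G Chat C_c : R) (p_c : nat), 0 < G /\ 0 < Chat /\ 0 < C_c /\
  forall (n : nat) (A : 'M[R]_n) (f : 'cV[R]_n -> R) (xs ys g : 'cV[R]_n)
    (mu M_f L_f R_y lmax lmin eps beta sigma_x : R),
  let R_0 : R := enorm (ys - 0) in
  let R_x : R := enorm (dual_argmax f (A^T *m ys)) in
  let Lt : R := 2 * (lmax / mu) in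
  let chi : R := lmax / lmin in
  let sigma_psi : R := Num.sqrt lmax * sigma_x in
  let Z : R := Num.sqrt (M_f ^+ 2 / (mu * eps) * chi) in
  let ps := [:: mu; M_f; L_f; R_y; lmax; lmin; eps; beta; sigma_x] in
  (exists x : 'cV[R]_n, x != 0 /\ A *m x = 0) ->
  is_lambda_max (A^T *m A) lmax ->
  is_lambda_min_pos (A^T *m A) lmin ->
  0 < mu ->
  strongly_convex mu f ->
  is_primal_solution A f xs ->
  is_gradient f xs g ->
  enorm g = M_f ->
  is_min_norm_dual_solution A f ys ->
  enorm ys <= R_y ->
  R_y <= kappa_R * R_0 ->
  L_f <= kappa_L * (Num.sqrt lmax * R_y) ->
  0 < beta < 1 / 4 ->
  0 < sigma_x ->
  0 < eps ->
  eps <= H * Lt * R_0 ^+ 2 ->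
  exists N0 : nat,
    [/\ (1 <= N0)%N,
        N0%:R <= C_N * polylog ps p_N * Z,
        eps <= H * Lt * R_0 ^+ 2 / N0%:R ^+ 2,
        (oracle_calls (min_batch Lt sigma_psi Chat eps beta N0) N0)%:R
          <= C_c * polylog ps p_c *
             Num.max (sigma_x ^+ 2 * M_f ^+ 2 / eps ^+ 2 * chi
                        * soft_ln (1 / beta * Z)) Z
      & forall (N : nat) (alpha Acc : nat -> R) (R_f delta_y : R)
          (r : nat -> nat),
        (N0 <= N)%N ->
        (1 <= N)%N ->
        eps <= H * Lt * R_0 ^+ 2 / N%:R ^+ 2 ->
        (1 + Num.sqrt (ln (1 / beta))) / Num.sqrt (ln (N%:R / beta)) <= 2 ->
        0 <= delta_y ->
        Num.sqrt lmax * delta_y <= G * Lt * R_0 / N.+1%:R ^+ 2 ->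
        spdstm_coefs Lt alpha Acc ->
        C_R * Num.max (R_y / (Acc N * Num.sqrt lmax))
                (Num.max (Num.sqrt lmax * R_y / mu) R_x) <= R_f ->
        lipschitz_on_ball L_f R_f f ->
        (forall k, (1 <= k <= N)%N ->
           batch_bound Lt sigma_psi Chat eps beta N k <= (r k)%:R) ->
        forall (d : measure_display) (Xi : measurableType d)
          (D : probability Xi R) (F : Xi -> 'cV[R]_n -> R)
          (err : 'cV[R]_n -> Xi -> 'cV[R]_n),
        stochastic_dual_oracle D f F err delta_y sigma_x ->
        forall (d' : measure_display) (Omega : measurableType d')
          (P : probability Omega R) (xi : nat -> nat -> Omega -> Xi),
        iid_samples P D (fun j => (1 <= j.1 <= N)%N && (j.2 < r j.1)%N) xi ->
        let xN := fun w : Omega =>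
          spdstm_x A (noisy_x F err) alpha Acc r (fun k l => xi k l w) N in
        let yN := fun w : Omega =>
          spdstm_y A (noisy_x F err) alpha Acc r (fun k l => xi k l w) N in
        let good : set Omega :=
          [set w | [/\ f (xN w) - f xs <= f (xN w) + psi A f (yN w),
                       f (xN w) + psi A f (yN w) <= eps
                     & enorm (A *m xN w) <= eps / R_y]] in
        ((1 - 4 * beta)%:E <= P good)%E].
Proof.
(* In units of the maximum in the condition on the ball, the average is within 1 of
   the exact average, which is within 2 of [xs], whose own norm is at most 1. *)
exists 4; split=> // kappa_R.
have [K K1 kK] : exists2 K : R, 1 <= K & kappa_R <= K.
  by exists (Num.max kappa_R 1); rewrite le_max lexx ?orbT.
have K0 : 0 < K by apply: lt_le_trans K1.
(* [Acc N * eps] is at least [H / 32 * R_0 ^+ 2], and [176 / 32 = 11 / 2] is the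
   constant of [accuracy_of_small_errors]. *)
have [H HE] : exists H, H = 176 * K ^+ 2 by exists (176 * K ^+ 2).
have H0 : 0 < H by rewrite HE mulr_gt0 ?exprn_gt0// ltr0n.
have [S S0 S2] : exists2 S, 0 < S & S ^+ 2 = 2 * H.
  by exists (Num.sqrt (2 * H)); rewrite ?sqrtr_gt0 ?mulr_gt0// sqr_sqrtr// mulr_ge0// ltW.
exists H, S, 0%N; split=> //; split=> // kappa_L.
have [kl kl1 kL] : exists2 kl : R, 1 <= kl & kappa_L <= kl.
  by exists (Num.max kappa_L 1); rewrite le_max lexx ?orbT.
have kl0 : 0 < kl by apply: lt_le_trans kl1.
(* The factor [kl ^- 2] keeps the noise of the average below [R_0 / (2 * kl)], which
   the Lipschitz constant multiplies by [kl]. *)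
have [Chat ChatE] : exists C, C = (2048 * kl ^+ 2 * H)^-1.
  by exists (2048 * kl ^+ 2 * H)^-1.
have Chat0 : 0 < Chat.
  rewrite ChatE invr_gt0; apply: mulr_gt0; last exact: H0.
  apply: mulr_gt0; last exact: exprn_gt0.
  rewrite ltr0n; exact: isT.
have Cc0 : 0 < 2 * S + H / Chat * (1 + `|ln S|).
  apply: ltr_pwDl; first exact: mulr_gt0.
  by apply: mulr_ge0; [exact: ltW (divr_gt0 H0 Chat0)|exact: addr_ge0].
exists kl^-1, Chat, (2 * S + H / Chat * (1 + `|ln S|)), 0%N.
split; first by rewrite invr_gt0.
split=> //; split=> //.
move=> n A f xs ys g mu M_f L_f R_y lmax lmin eps beta sigma_x R_0 R_x Lt chi
  sigma_psi Z ps _ hmax hmin mu0 scf hxs fg gM hys ysRy RyR0 LfRy /andP[beta0 beta1]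
  sigma0 eps0 epsH.
have R0E : R_0 = enorm ys by rewrite /R_0 subr0.
have lmin0 : 0 < lmin by case: hmin.
have lmax0 : 0 < lmax.
  by case: hmin => ev _ _; case: hmax => _ /(_ _ ev); exact: lt_le_trans.
have Lt0 : 0 < Lt by rewrite mulr_gt0// divr_gt0.
have R00 : 0 < enorm ys.
  rewrite lt_neqAle enorm_ge0 andbT; apply/eqP => e0.
  by move: epsH; rewrite R0E -e0 expr0n mulr0 leNgt eps0.
have Ry0 : 0 < R_y by apply: lt_le_trans ysRy.
have RyK : R_y <= K * enorm ys.
  by apply: le_trans RyR0 _; rewrite R0E ler_pM2r.
pose X := H * Lt * R_0 ^+ 2 / eps.
have X1 : 1 <= X by rewrite ler_pdivlMr// mul1r.
have X0 : 0 <= X := le_trans ler01 X1.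
have Z2 : Z ^+ 2 = M_f ^+ 2 / (mu * eps) * chi.
  by rewrite sqr_sqrtr// mulr_ge0 ?divr_ge0 ?sqr_ge0 ?mulr_ge0// ltW.
(* [lmin * R_0 ^+ 2 <= M_f ^+ 2] brings in the condition number. *)
have XZ : X <= (S * Z) ^+ 2.
  have := dual_solution_norm A f mu lmin xs ys g mu0 scf fg hxs hys hmin.
  rewrite gM exprMn Z2 S2 => hM.
  have c0 : 0 <= 2 * H * lmax / (mu * eps * lmin).
    by rewrite divr_ge0 ?mulr_ge0 ?(ltW _).
  have := ler_wpM2l c0 hM.
  rewrite (_ : _ * (lmin * _) = X); last first.
    by rewrite /X R0E /Lt; field; rewrite !gt_eqF.
  move=> /le_trans; apply; rewrite le_eqVlt; apply/orP; left; apply/eqP.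
  by rewrite /chi; field; rewrite !gt_eqF.
have Z0 : 0 <= Z by exact: sqrtr_ge0.
(* [N0] is the largest number of iterations for which [eps] is admissible, so that
   the rate cannot be much smaller than [eps] at [N0]. *)
pose N0 := Num.truncn (Num.sqrt X).
have /andP[N0X XN0] := truncn_itv (sqrtr_ge0 X).
rewrite -/N0 in N0X XN0.
have sX1 : 1 <= Num.sqrt X by rewrite -sqrtr1 ler_sqrt.
have N01 : (1 <= N0)%N.
  by rewrite -ltnS -(ltr_nat R) (le_lt_trans sX1).
have N0SZ : N0%:R <= S * Z.
  apply: le_trans N0X _; rewrite -[leRHS]ger0_norm ?mulr_ge0 ?(ltW S0)//.
  by rewrite -sqrtr_sqr ler_wsqrtr.
have N02 : N0%:R ^+ 2 <= X.
  by rewrite -[leRHS]sqr_sqrtr// ler_sqr ?nnegrE ?sqrtr_ge0.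
have ell_ge1 N : (1 <= N)%N -> 1 <= ln (N%:R / beta).
  move=> N1; apply: ln_ge1; rewrite ler_pdivlMr//.
  have : 1 <= N%:R :> R by rewrite ler1n.
  by move: beta1; clear; lra.
exists N0; split=> //.
- by rewrite /polylog expr0 mulr1.
- rewrite ler_pdivlMr ?exprn_gt0 ?ltr0n//.
  by move: N02; rewrite /X ler_pdivlMr// mulrC.
- rewrite /polylog expr0 mulr1; apply: oracle_calls_softO => //.
  exact: le_trans ler01 (ell_ge1 _ N01).
move=> N alpha Acc R_f delta_y r N0N N1 epsN _ _ hdelta hc hRf lipf hr d Xi D F err
  oracle d' Omega P xi iid; cbv zeta.
have r_gt0 k : (1 <= k <= N)%N -> (0 < r k)%N.
  move=> /hr; rewrite /batch_bound ge_max => /andP[+ _].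
  by rewrite ler1n.
have RxE : R_x = enorm xs.
  by rewrite /R_x (dual_argmax_solution A f mu xs ys g mu0 scf fg hxs hys).
have ell1 := ell_ge1 N N1.
apply: (@le_trans _ _ (1 - 2 * beta)%:E).
  by rewrite lee_fin lerD2l lerN2 ler_pM2r// ler_nat.
rewrite R0E in epsN hdelta.
apply: (high_probability_accuracy D f F err delta_y sigma_x oracle sigma0 P N r xi
  iid r_gt0 A mu lmax xs g ys alpha Acc mu0 lmax0 scf fg hmax hxs hys hc
  R_y eps kl L_f R_f (ln (N%:R / beta)) beta) => //.
- apply: le_trans LfRy _; apply: ler_wpM2r => //.
  by rewrite mulr_ge0 ?sqrtr_ge0// ltW.
- by rewrite -RxE.
- have epsX : H * Lt * enorm ys ^+ 2 < eps * N.+1%:R ^+ 2.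
    have : X < N.+1%:R ^+ 2.
      rewrite -[ltLHS]sqr_sqrtr// ltr_sqr ?nnegrE ?sqrtr_ge0//.
      by apply: lt_le_trans XN0 _; rewrite ler_nat.
    by rewrite /X R0E ltr_pdivrMr// [eps * _]mulrC.
  apply: le_trans (Acc_eps_ge Lt alpha Acc H (enorm ys) eps N Lt0 hc N1 eps0 epsX).
  have : R_y ^+ 2 <= K ^+ 2 * enorm ys ^+ 2.
    by rewrite -exprMn ler_sqr ?nnegrE ?mulr_ge0 ?(ltW K0) ?(ltW Ry0)// ltW.
  by rewrite HE; clear; lra.
- rewrite expRN lnK ?posrE ?divr_gt0 ?ltr0n// invf_div mulrC divfK//.
  by rewrite gt_eqF// ltr0n.
- move=> k kN; apply: (batch_size_sufficient Lt alpha Acc H (enorm ys) eps N Lt0 hc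
    N1 eps0 kl Chat _ lmax sigma_x beta) => //; last exact: hr.
  exact: le_trans ler01 ell1.
- exact: (oracle_bias_small Lt alpha Acc (enorm ys) N Lt0 hc R00).
Qed.
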